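(* Let $P_q(y|x)$ be the query observation channel for a query region of size $q$, satisfying the standing assumptions listed in the context, and let $q^*$ be the maximizer of $I_{XY}(q,q)$ over $q\in(0,\frac12)$. Consider the search problem for a stationary target on $[0,1)$ described in the context. For any $\alpha\in(0,\tfrac12)$, there exists a $\gamma\in(0,1)$ and a search scheme with error probability $\varepsilon$ and resolution $\delta$, satisfying $$\mathbb E[\tau]\ \le\ \left(\frac{\log(1/\alpha)}{I_{XY}(q^*,q^* )}+\frac{\log(1/\delta)}{\max_{q} I_{XY}(q,\alpha q)}+\frac{\log(1/\varepsilon)}{C_1(\delta)}\right)\Big/(1-\gamma),$$ where $\gamma\to0$ as $\alpha\to0$ and $\delta\to0$.
   Context: All logarithms are to base 2. Search model. A target sits at an arbitrary unknown point $w\in[0,1)$. At each time $n=1,2,\dots$ an agent chooses (possibly at random) a measurable query set $S_n\subset[0,1)$; let $q_n=|S_n|$ be its Lebesgue measure and $X_n=\mathbf 1(w\in S_n)$. The agent observes $Y_n\in\mathcal Y$ ($\mathcal Y$ discrete or continuous), where, given $X_n=x_n$ and $|S_n|=q_n$, $Y_n$ is drawn from $P_{q_n}(\cdot|x_n)$ (memoryless observation channel). Here $P_q(\cdot|x)$ denotes a probability mass function or density. Channel quantities. $I_{XY}(p,q)$ is the mutual information between a binary $X$ with $\Pr(X=1)=p$ and the output $Y$ of $P_q(y|x)$; thus $I_{XY}(q,\alpha q)$ uses input probability $q$ and the channel $P_{\alpha q}$. $C(q)=\max_p I_{XY}(p,q)$. $C_1(q)=D(P_q(\cdot|1)\,\|\,P_q(\cdot|0))$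 (KL divergence). Standing assumptions. $P_q(y|x)$ is continuous in $q$ for $0\le q\le1$; $C_1(q)<\infty$; and for $q_1<q_2$, $C(q_1)\ge C(q_2)$ and $C_1(q_1)\ge C_1(q_2)$. Strategies. A search strategy (scheme) is a causal protocol for choosing $S_n=S_n(Y^{n-1})$ (possibly randomized, with the agent knowing the randomness it used), a stopping time $\tau$ (possibly random, depending on the observations), and an estimator $\widehat W_\tau=\widehat W_\tau(Y^\tau)$. It has resolution $\delta$ and error probability $\varepsilon$ if $\Pr(|\widehat W_\tau-w|\le\delta)\ge1-\varepsilon$ for every $w$. *)

(* Defs.v *)
(* MathComp-Analysis. *)
From HB Require Import structures.
From mathcomp Require Import all_boot all_order all_algebra.
From mathcomp Require Import all_classical all_reals all_analysis.

Set Implicit Arguments.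
Unset Strict Implicit.
Unset Printing Implicit Defensive.
Import Order.TTheory GRing.Theory Num.Theory.
Import numFieldNormedType.Exports.

Local Open Scope classical_set_scope.
Local Open Scope ring_scope.
Local Open Scope ereal_scope.

Definition log2 (R : realType) (x : R) : R := (ln x / ln 2)%R.

Section channel.
Context d (Y : measurableType d) (R : realType).
Variable mu : {sigma_finite_measure set Y -> \bar R}.

(* The conventions are 0 log (0 / g) = 0 and f log (f / 0) = +oo for f > 0. *)
Definition kl_div (f g : Y -> R) : \bar R :=
  \int[mu]_y (if f y == 0%R then 0 else
              if g y == 0%R then +oo else (f y * log2 (f y / g y))%:E).

(* [p q x] is the density P_q(. | x) with respect to mu, where [x : bool] is the
   indicator that the target lies in the query set. Taking the counting measure
   for mu gives probability mass functions, Lebesgue measure gives densities. *)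
Variable p : R -> bool -> Y -> R.

Record query_channel : Prop := QueryChannel {
  channel_ge0 : forall q x y, (0 <= q <= 1)%R -> (0 <= p q x y)%R ;
  channel_measurable : forall q x, (0 <= q <= 1)%R ->
    measurable_fun [set: Y] (p q x) ;
  channel_mass1 : forall q x, (0 <= q <= 1)%R ->
    \int[mu]_y (p q x y)%:E = 1 }.

Definition input_prob (a : R) (x : bool) : R := (if x then a else 1 - a)%R.

Definition output_density (a q : R) (y : Y) : R :=
  (\sum_(x : bool) input_prob a x * p q x y)%R.

(* I_XY(a, q) = D(P_XY || P_X x P_Y) for X ~ Bernoulli(a) and the channel P_q,
   with the integral over {0, 1} x Y written as a sum over x of integrals. *)
Definition mutual_info (a q : R) : \bar R :=
  \sum_(x : bool) kl_div (fun y => (input_prob a x * p q x y)%R)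
                         (fun y => (input_prob a x * output_density a q y)%R).

Definition capacity (q : R) : \bar R :=
  ereal_sup [set mutual_info a q | a in `[0%R, 1%R]].

Definition C1 (q : R) : \bar R := kl_div (p q true) (p q false).

Definition max_info (alpha : R) : \bar R :=
  ereal_sup [set mutual_info q (alpha * q)%R | q in `[0%R, 1%R]].

Record standing_assumptions : Prop := StandingAssumptions {
  channel_continuous : forall x y,
    {within `[0%R, 1%R], continuous (fun q => p q x y)} ;
  C1_finite : forall q, (0 <= q <= 1)%R -> C1 q < +oo ;
  capacity_noninc : forall q1 q2, (0 <= q1)%R -> (q1 < q2)%R -> (q2 <= 1)%R ->
    capacity q2 <= capacity q1 ;
  C1_noninc : forall q1 q2, (0 <= q1)%R -> (q1 < q2)%R -> (q2 <= 1)%R ->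
    C1 q2 <= C1 q1 }.

End channel.

(* [rnd] carries all the randomness of the agent, drawn before the search with a
   law that does not depend on the target. Given that randomness and the n
   observations Y_1, ..., Y_n, [query n] is the set S_{n+1} asked next, [stop n]
   is the event that the agent stops with these n observations (if it has not
   stopped earlier), and [estimate n] is the estimate it then returns. *)
Record scheme d (Y : measurableType d) (R : realType) := Scheme {
  rnd_disp : measure_display ;
  rnd : measurableType rnd_disp ;
  rnd_law : probability rnd R ;
  query : forall n, rnd * n.-tuple Y -> set R ;
  stop : forall n, set (rnd * n.-tuple Y) ;
  estimate : forall n, rnd * n.-tuple Y -> R ;
  query_sub : forall n h, @query n h `<=` `[0%R, 1%R[ ;
  query_measurable : forall n,
    measurable [set z : (rnd * n.-tuple Y) * measurableTypeR R |
                @query n z.1 z.2] ;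
  stop_measurable : forall n, measurable (@stop n) ;
  estimate_measurable : forall n, measurable_fun setT (@estimate n) }.

Section run.
Context d (Y : measurableType d) (R : realType) (s : scheme Y R).
Context d' (Om : measurableType d').
Variables (V : Om -> rnd s) (Yobs : nat -> Om -> Y).

(* [Yobs n] is Y_{n+1}. *)
Definition history n (om : Om) : rnd s * n.-tuple Y :=
  (V om, [tuple Yobs i om | i < n]).

Definition query_set n (om : Om) : set R := query (history n om).

Definition query_size n (om : Om) : R :=
  fine (lebesgue_measure (query_set n om)).

(* tau, equal to +oo when the agent never stops *)
Definition stopping_time (om : Om) : \bar R :=
  ereal_inf [set n%:R%:E | n in [set n | stop (history n om)]].

Definition located (delta w : R) : set Om :=
  [set om | exists2 n, stopping_time om = n%:R%:E &
            (`|estimate (history n om) - w| <= delta)%R].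

(* (V, Yobs) is a run of s against the target w: V has the prescribed law, and
   the conditional law of Y_{n+1} given V, Y_1, ..., Y_n has density
   P_{|S_{n+1}|}(. | 1(w \in S_{n+1})). By the Ionescu-Tulcea theorem such runs
   exist for every scheme and every w, and these conditions determine the law
   of (V, Yobs); so it does not matter which run is considered. *)
Record search_run (mu : {sigma_finite_measure set Y -> \bar R})
    (p : R -> bool -> Y -> R) (w : R) (P : probability Om R) : Prop :=
  SearchRun {
  run_rnd_measurable : measurable_fun setT V ;
  run_obs_measurable : forall n, measurable_fun setT (Yobs n) ;
  run_rnd_law : forall A, measurable A -> P (V @^-1` A) = rnd_law s A ;
  run_obs_law : forall n (A : set (rnd s * n.-tuple Y)) (B : set Y),
    measurable A -> measurable B ->
    P ((history n @^-1` A) `&` (Yobs n @^-1` B)) =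
    \int[P]_(om in history n @^-1` A)
      \int[mu]_(y in B) (p (query_size n om) (w \in query_set n om) y)%:E }.

End run.

(* Main.v *)
Require Import Defs.
From HB Require Import structures.
From mathcomp Require Import all_boot all_order all_algebra.
From mathcomp Require Import all_classical all_reals all_analysis.
From mathcomp Require Import measurable_realfun ring lra zify.

Set Implicit Arguments.
Unset Strict Implicit.
Unset Printing Implicit Defensive.
Import Order.TTheory GRing.Theory Num.Theory.
Import numFieldNormedType.Exports.

Local Open Scope classical_set_scope.
Local Open Scope ring_scope.

(* By monotonicity max_q I(q, alpha q) <= C(0) and C_1(delta) <= C_1(0), so it suffices
   to reach a cost of (1 + o(1)) (log(1/delta) / C(0) + log(1/eps) / C_1(0)) as delta -> 0,
   uniformly in eps. Episodes of fixed length are repeated until one is accepted: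
   - the coarse bins of a partition of [0, 1), of a fixed small size, are tested one by one;
   - the fine bin inside the coarse bin found is decoded from a fixed block code; each query
     is padded, by the complementary pattern in the next coarse bin, to the size of a coarse
     bin, so that the code faces one memoryless channel and the scheme is deterministic;
   - the fine bin found is queried repeatedly, and accepted if a likelihood test passes.
   An episode fails to accept with small probability, hence the number of episodes has mean
   close to 1. All error bounds are of Chernoff type, for truncated log-likelihood ratios of
   the channel P_0: as bounded statistics, they keep almost the same exponential moments on
   the channels P_q with q small, by Fatou's lemma. The code is built greedily, as in
   Feinstein's lemma, so that each codeword, and not only the average one, is good. *)

(** * Truncated likelihood ratios *)

(** The obstacle is uniformity: [gamma] may depend on [alpha] and [delta] but not on [eps], whereas
    the scheme may depend on all three. Hence every loss must be a fixed factor or an additive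
    constant independent of [delta] and [eps]. The ideal cost is at least log(1/delta) / C(0), which
    grows as [delta] tends to 0, so the constant is absorbed into the factor whatever [eps] is. For
    the same reason the errors of the first two phases are kept constant instead of being of order
    [eps]: a detected error costs time only. The final error comes from accepting a wrong candidate.
    Its bound exp(-L3) per episode carries no union bound over the bins, because the candidate is
    fixed before its test starts. Continuity in q is only pointwise, and a finite C_1 gives no
    exponential moments, so a raw log-likelihood ratio cannot be moved from q = 0 to small q. A
    bounded statistic can, provided that its inequalities at q = 0 are strict. Positivity of the
    mutual information at [qs] gives C(0) > 0, and this forces C_1(0) > 0, so both limiting rates
    are positive. *)

Lemma expR_le_quad (R : realType) (x : R) : x <= 1 / 3 -> expR x <= 1 + x + x ^+ 2.
Proof.
move=> x3.
have h : 0 < 1 - x / 2 by lra.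
have h1 : 1 - x / 2 <= expR (- (x / 2)) by exact: expR_ge1Dx.
have -> : x = x / 2 + x / 2 by field.
have e : expR (x / 2) <= (1 - x / 2)^-1.
  have -> : expR (x / 2) = (expR (- (x / 2)))^-1 by rewrite expRN invrK.
  by rewrite lef_pV2 ?posrE ?expR_gt0.
rewrite expRD.
have e2 : expR (x / 2) * expR (x / 2) <= (1 - x / 2)^-1 * (1 - x / 2)^-1.
  by apply: ler_pM => //; exact: expR_ge0.
apply: (le_trans e2).
(* The claim is now 1 <= (1 - x/2)^2 (1 + x + x^2) = 1 + x^2 (1 - 3 x + x^2) / 4, and the last
   factor is nonnegative for x <= 1/3. *)
rewrite -invfM -[leRHS]mul1r -[leLHS]mul1r ler_pdivrMr ?mulr_gt0//.
by nra.
Qed.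

Lemma ln_ge_1subV (R : realType) (x : R) : 0 < x -> 1 - x^-1 <= ln x.
Proof.
move=> x0; rewrite -lerN2 opprB -lnV ?posrE//.
have := @le_ln1Dx R (x^-1 - 1); rewrite [1 + _]addrC subrK; apply.
have : 0 < x^-1 by rewrite invr_gt0.
by lra.
Qed.

Section truncated_ratio.
Context (R : realType) (T : Type) (f g : T -> R).
Hypotheses (f0 : forall y, 0 <= f y) (g0 : forall y, 0 <= g y).

(** Where [g] vanishes the likelihood ratio is read as +oo, in accordance with [kl_div], and is
    therefore cut down to [n]. *)
Definition trunc_ratio (n : R) (y : T) : R :=
  if g y == 0 then n else Num.min (f y / g y) n.

Lemma trunc_ratio_le n y : trunc_ratio n y <= n.
Proof. by rewrite /trunc_ratio; case: ifP => // _; rewrite ge_min lexx orbT. Qed.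

Lemma trunc_ratio_gt0 n y : 0 < n -> 0 < f y -> 0 < trunc_ratio n y.
Proof.
move=> n0 fy; rewrite /trunc_ratio; case: ifPn => // gy.
by rewrite lt_min n0 andbT divr_gt0// lt0r gy g0.
Qed.

Lemma mul_trunc_ratio_le n y : g y * trunc_ratio n y <= f y.
Proof.
rewrite /trunc_ratio; case: ifPn => [/eqP ->|gy]; first by rewrite mul0r.
apply: (@le_trans _ _ (g y * (f y / g y))).
  by rewrite ler_wpM2l// ge_min lexx.
by rewrite mulrC divfK.
Qed.

(** From ln r >= 1 - 1/r it suffices that f / r <= f + g: either r = f / g and f / r = g, or r = n
    >= 1 and f / r <= f. Adding [g] thus makes the truncated entropy integrand nonnegative, as
    monotone convergence requires. *)
Lemma trunc_ratio_entropy_ge0 n y : 1 <= n ->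
  0 <= f y * ln (trunc_ratio n y) + g y.
Proof.
move=> n1; have := f0 y; rewrite le_eqVlt => /predU1P[<-|fy].
  by rewrite mul0r add0r.
have n0 : 0 < n by lra.
have r0 := trunc_ratio_gt0 n0 fy.
have : f y * (1 - (trunc_ratio n y)^-1) <= f y * ln (trunc_ratio n y).
  by rewrite ler_pM2l// ln_ge_1subV.
suff : f y / trunc_ratio n y <= f y + g y by lra.
rewrite ler_pdivrMr// /trunc_ratio; case: ifPn => [/eqP ->|gy].
  by rewrite addr0 ler_peMr// ltW.
have gy0 : 0 < g y by rewrite lt0r gy g0.
rewrite /Num.min; case: ifP => _; last by rewrite mulrDl; have := g0 y; nra.
rewrite mulrA ler_pdivlMr//; nra.
Qed.

Lemma trunc_ratio_homo y : {homo (trunc_ratio ^~ y) : a b / a <= b}.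
Proof.
move=> a b ab; rewrite /trunc_ratio; case: ifP => // _.
by rewrite le_min !ge_min lexx/= ab orbT.
Qed.

End truncated_ratio.

Lemma measurable_div_ge0 d (Y : measurableType d) (R : realType) (f g : Y -> R) :
  (forall y, 0 <= g y) -> measurable_fun setT f -> measurable_fun setT g ->
  measurable_fun setT (fun y => f y / g y).
Proof.
move=> g0 mf mg; apply: measurable_funM => //.
rewrite (_ : (fun x => (g x)^-1) = (fun x => g x `^ (-1))).
  by apply: (@measurableT_comp _ _ _ _ _ _ (fun x : R => x `^ (-1)) setT g).
by apply/funext => x; rewrite powR_inv1.
Qed.

Lemma measurable_trunc_ratio d (Y : measurableType d) (R : realType) (f g : Y -> R) n :
  (forall y, 0 <= g y) -> measurable_fun setT f -> measurable_fun setT g ->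
  measurable_fun setT (trunc_ratio f g n).
Proof.
move=> g0 mf mg; apply: measurable_fun_ifT; first exact: measurable_fun_eqr.
  exact: measurable_cst.
apply: measurable_minr; last exact: measurable_cst.
exact: measurable_div_ge0.
Qed.

(** * Divergence as a limit of truncated divergences, and the bounded statistic drawn from it *)

Section kl_truncation.
Context d (Y : measurableType d) (R : realType).
Variable mu : {sigma_finite_measure set Y -> \bar R}.
Variables (f g : Y -> R) (m : R).
Hypotheses (f0 : forall y, 0 <= f y) (g0 : forall y, 0 <= g y).
Hypotheses (mf : measurable_fun setT f) (mg : measurable_fun setT g).
Hypotheses (intg : (\int[mu]_y (g y)%:E = m%:E)%E).

Let k : R := (ln 2)^-1.
Let k0 : 0 < k. Proof. by rewrite invr_gt0 ln_gt0// ltr1n. Qed.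

(** The factor [k] converts nats to bits. The shift by [g] makes [F n] nonnegative, and [F n]
    increases to [G], the integrand of the divergence with the same shift. *)
Let F n y := (k * (f y * ln (trunc_ratio f g n.+1%:R y) + g y))%:E.

Let F0 n y : (0 <= F n y)%E.
Proof.
by rewrite lee_fin mulr_ge0 ?(ltW k0)// trunc_ratio_entropy_ge0// ler1n.
Qed.

Let mF n : measurable_fun setT (F n).
Proof.
apply/measurable_EFinP; apply: measurable_funM; first exact: measurable_cst.
apply: measurable_funD => //; apply: measurable_funM => //.
apply: measurableT_comp; first exact: measurable_ln.
exact: measurable_trunc_ratio.
Qed.

Let F_nd y : {homo F^~ y : a b / (a <= b)%N >-> (a <= b)%E}.
Proof.
move=> a b ab; rewrite lee_fin ler_wpM2l ?(ltW k0)// lerD2r.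
have := f0 y; rewrite le_eqVlt => /predU1P[<-|fy]; first by rewrite !mul0r.
rewrite ler_wpM2l// ler_ln ?posrE ?trunc_ratio_gt0//.
by apply: trunc_ratio_homo; rewrite ler_nat.
Qed.

Let G y : \bar R := if f y == 0 then (k * g y)%:E else
  if g y == 0 then +oo%E else (f y * log2 (f y / g y) + k * g y)%:E.

Let F_cvg y : F n y @[n --> \oo] --> G y.
Proof.
rewrite /G; case: ifPn => [/eqP fy|fy].
  rewrite /F; under eq_fun do rewrite fy mul0r add0r.
  exact: cvg_cst.
have fy0 : 0 < f y by rewrite lt0r fy f0.
case: ifPn => gy.
  apply/cvgeryP/cvgryPge => A; near=> n.
  rewrite /trunc_ratio gy (eqP gy) addr0.
  have -> : A = k * (f y * (A / (k * f y))) by field; rewrite fy gt_eqF.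
  rewrite ler_pM2l// ler_pM2l// -ler_expR lnK ?posrE//.
  have : expR (A / (k * f y)) <= n%:R by near: n; exact: nbhs_infty_ger.
  by move=> /le_trans; apply; rewrite ler_nat.
have gy0 : 0 < g y by rewrite lt0r gy g0.
apply: cvg_near_cst; near=> n.
rewrite /F /trunc_ratio (negbTE gy).
have h : f y / g y <= n%:R by near: n; exact: nbhs_infty_ger.
rewrite (min_idPl _); last by rewrite (le_trans h)// ler_nat.
by rewrite /log2 mulrDr; congr (_ + _)%:E; rewrite /k; ring.
Unshelve. all: by end_near. Qed.

Let G0 y : (0 <= G y)%E.
Proof.
rewrite -(cvg_lim _ (@F_cvg y))//; apply: lime_ge.
  by apply/cvg_ex; eexists; exact: F_cvg.
exact: nearW.
Qed.

Let mG : measurable_fun setT G.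
Proof. by apply: (emeasurable_fun_cvg _ _ mF) => y _; exact: F_cvg. Qed.

Let intkg : (\int[mu]_y (k * g y)%:E = (k * m)%:E)%E.
Proof.
under eq_integral do rewrite EFinM.
rewrite ge0_integralZl_EFin ?(ltW k0)//.
- by rewrite intg.
- by move=> y _; rewrite lee_fin.
- exact/measurable_EFinP.
Qed.

(** Monotone convergence: the integrals of [F n] tend to that of [G], which is the divergence plus
    [k * m]. *)
Lemma kl_div_lt_trunc (c : R) : (c%:E < kl_div mu f g)%E ->
  exists n0 : nat, forall n, (n0 <= n)%N ->
  ((c + k * m)%:E < \int[mu]_y (k * (f y * ln (trunc_ratio f g n.+1%:R y) + g y))%:E)%E.
Proof.
move=> cK.
have cG : ((c + k * m)%:E < \int[mu]_y G y)%E.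
  (* Splitting off [k * g] requires [G] to be integrable; an infinite integral exceeds any real
     bound directly. *)
  have [Goo|Gfin] := eqVneq (\int[mu]_y G y)%E +oo%E; first by rewrite Goo ltry.
  have iG : mu.-integrable setT G.
    apply/integrableP; split => //.
    under eq_integral => y _ do rewrite gee0_abs//.
    by rewrite ltey.
  have ig : mu.-integrable setT (fun y => (k * g y)%:E).
    apply/integrableP; split.
      by apply/measurable_EFinP; apply: measurable_funM => //; exact: measurable_cst.
    under eq_integral => y _.
      rewrite gee0_abs; last by rewrite lee_fin mulr_ge0 ?(ltW k0).
      over.
    by rewrite intkg ltry.
  have : kl_div mu f g = (\int[mu]_y (G y - (k * g y)%:E))%E.
    apply: eq_integral => y _; rewrite /G; case: ifP => _.
      by rewrite subee.
    by case: ifP => // _; rewrite EFinD addeK.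
  rewrite integralB// intkg => KE; move: cK; rewrite KE EFinD.
  by rewrite lteBrDr.
have cv := @cvg_monotone_convergence _ _ _ mu setT measurableT F mF
  (fun n y _ => F0 n y) (fun y _ => @F_nd y).
have GE : (\int[mu]_y G y = \int[mu]_y limn (F^~ y))%E.
  by apply: eq_integral => y _; apply/esym/cvg_lim => //; exact: F_cvg.
rewrite GE in cG.
have : nbhs (\int[mu]_y limn (F^~ y))%E [set x | ((c + k * m)%:E < x)%E].
  by apply: open_nbhs_nbhs; split => //; exact: open_ereal_gt_ereal.
by move=> /cv[n0 _ h]; exists n0 => n hn; exact: h.
Qed.

End kl_truncation.

Section real_integrals.
Context d (Y : measurableType d) (R : realType) (mu : {measure set Y -> \bar R}).
Implicit Types u v : Y -> R.

Lemma integral_EFinD_ge0 u v : (forall y, 0 <= u y) -> (forall y, 0 <= v y) ->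
  measurable_fun setT u -> measurable_fun setT v ->
  (\int[mu]_y (u y + v y)%:E = \int[mu]_y (u y)%:E + \int[mu]_y (v y)%:E)%E.
Proof.
move=> u0 v0 mu_ mv; under eq_integral do rewrite EFinD.
by rewrite ge0_integralD//; try (by move=> y _; rewrite lee_fin); exact/measurable_EFinP.
Qed.

Lemma integral_EFinZl_ge0 (a : R) u : 0 <= a -> (forall y, 0 <= u y) ->
  measurable_fun setT u ->
  (\int[mu]_y (a * u y)%:E = a%:E * \int[mu]_y (u y)%:E)%E.
Proof.
move=> a0 u0 mu_; under eq_integral do rewrite EFinM.
by rewrite ge0_integralZl_EFin//; [by move=> y _; rewrite lee_fin|exact/measurable_EFinP].
Qed.

Lemma le_integral_EFin u v : (forall y, 0 <= u y) -> (forall y, u y <= v y) ->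
  measurable_fun setT u -> measurable_fun setT v ->
  (\int[mu]_y (u y)%:E <= \int[mu]_y (v y)%:E)%E.
Proof.
move=> u0 uv mu_ mv; apply: ge0_le_integral => //.
- by move=> y _; rewrite lee_fin.
- exact/measurable_EFinP.
- exact/measurable_EFinP.
- by move=> y _; rewrite lee_fin.
Qed.

Lemma integral_EFin_ge0 u : (forall y, 0 <= u y) -> (0 <= \int[mu]_y (u y)%:E)%E.
Proof. by move=> u0; apply: integral_ge0 => y _; rewrite lee_fin. Qed.

End real_integrals.

Lemma lte_real_between (R : realType) (c : R) (x : \bar R) : (c%:E < x)%E ->
  exists2 c', c < c' & (c'%:E < x)%E.
Proof.
case: x => [x| |//]; last by exists (c + 1); rewrite ?ltrDl ?ltry.
by rewrite lte_fin => cx; exists ((c + x) / 2); rewrite ?lte_fin; lra.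
Qed.

Lemma measurable_expR_scale d (Y : measurableType d) (R : realType) (X : Y -> R) (s : R) :
  measurable_fun setT X -> measurable_fun setT (fun y => expR (s * X y)).
Proof.
move=> mX; apply: measurableT_comp; first exact: measurable_expR.
by apply: measurable_funM => //; exact: measurable_cst.
Qed.

Section kl_statistic.
Context d (Y : measurableType d) (R : realType).
Variable mu : {sigma_finite_measure set Y -> \bar R}.
Variables (f g : Y -> R) (m : R).
Hypotheses (f0 : forall y, 0 <= f y) (g0 : forall y, 0 <= g y).
Hypotheses (mf : measurable_fun setT f) (mg : measurable_fun setT g).
Hypotheses (intf : (\int[mu]_y (f y)%:E = m%:E)%E).
Hypotheses (intg : (\int[mu]_y (g y)%:E = m%:E)%E).
Hypothesis m0 : 0 < m.

(* X is a truncation of ln (f / g), lowered by a small constant. The strict inequality and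
   the slack in c leave room for a small change of f and g. *)
Lemma kl_statistic (c : R) : (c%:E < kl_div mu f g)%E ->
  exists (X : Y -> R) (b : R), [/\ measurable_fun setT X, 0 <= b,
    forall y, `|X y| <= b,
    (\int[mu]_y (g y * expR (X y))%:E < m%:E)%E &
    exists2 s0, 0 < s0 & forall s, 0 < s <= s0 ->
    (\int[mu]_y (f y * expR (- s * X y))%:E <= (m - s * c * ln 2)%:E)%E].
Proof.
move=> /lte_real_between[c' cc' c'K].
have [n0 hn0] := kl_div_lt_trunc f0 g0 mf mg intg c'K.
have ln20 : 0 < ln 2 :> R by rewrite ln_gt0// ltr1n.
pose gap := (c' - c) * ln 2.
have gap0 : 0 < gap by rewrite mulr_gt0// subr_gt0.
(* Large enough for the truncated divergence to exceed [c'] and for the loss 2 m / N, caused by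
   lowering the statistic, to take at most half of [gap]. *)
pose n := maxn n0 (Num.truncn (4 * m / gap)).
have {hn0} := hn0 n (leq_maxl _ _).
pose N : R := n.+1%:R.
have N1 : 1 <= N by rewrite ler1n.
have N0 : 0 < N by lra.
have hN : 2 / N * m <= gap / 2.
  have : 4 * m / gap <= N.
    apply: (@le_trans _ _ (Num.truncn (4 * m / gap)).+1%:R).
      by apply/ltW/truncnS_gt.
    by rewrite ler_nat ltnS leq_maxr.
  rewrite ler_pdivrMr// => h.
  by rewrite mulrAC ler_pdivrMr//; lra.
rewrite -/N => hF; clearbody N.
pose r := trunc_ratio f g N.
have mr : measurable_fun setT r by exact: measurable_trunc_ratio.
(* Cutting from below as well makes [ln (v y)] bounded. As max(r, 1/N) <= r + 1/N and g r <= f, the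
   price is that g v <= f + g / N. *)
pose v y := Num.max (r y) N^-1.
have mv : measurable_fun setT v by apply: measurable_maxr => //; exact: measurable_cst.
have v0 y : 0 < v y by rewrite lt_max invr_gt0 N0 orbT.
(* The integral of g v is at most m (1 + 1/N). Dividing by the larger number 1 + 2/N makes the
   moment under [g] strictly less than [m], while ln z <= 2/N remains small. *)
pose z := 1 + 2 / N.
have z1 : 0 < 2 / N by rewrite divr_gt0.
have N1V : N^-1 <= 1 by rewrite invf_le1.
have z0 : 0 < z by rewrite /z; lra.
pose X y := ln (v y) - ln z.
have mX : measurable_fun setT X.
  apply: measurable_funB; last exact: measurable_cst.
  by apply: measurableT_comp => //; exact: measurable_ln.
have lnz : 0 <= ln z <= 2 / N.
  by rewrite ln_ge0/= ?le_ln1Dx// /z; lra.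
pose b := ln N + 2.
have lnN : 0 <= ln N by rewrite ln_ge0.
have b0 : 0 <= b by rewrite /b; lra.
have Xb y : `|X y| <= b.
  have h1 : ln (v y) <= ln N.
    rewrite ler_ln ?posrE// ge_max trunc_ratio_le//=; lra.
  have h2 : - ln N <= ln (v y).
    by rewrite -lnV ?posrE// ler_ln ?posrE ?invr_gt0// le_max lexx orbT.
  rewrite ler_norml /X /b; lra.
exists X, b; split => //.
- have e y : expR (X y) = v y / z by rewrite /X expRB !lnK ?posrE.
  apply: (@le_lt_trans _ _ (\int[mu]_y (z^-1 * f y + (z * N)^-1 * g y)%:E)%E).
    apply: le_integral_EFin => [y|y||].
    + by rewrite mulr_ge0// expR_ge0.
    + have -> : z^-1 * f y + (z * N)^-1 * g y = z^-1 * (f y + N^-1 * g y).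
        by rewrite invfM; ring.
      rewrite e mulrA mulrC ler_pM2l ?invr_gt0// /v /Num.max; case: ifP => _.
        by rewrite mulrC lerDr.
      have := @mul_trunc_ratio_le _ _ f g f0 g0 N y; rewrite -/(r y).
      by have : 0 <= N^-1 * g y; [rewrite mulr_ge0// invr_ge0 ltW|lra].
    + apply: measurable_funM => //; apply: measurableT_comp => //; exact: measurable_expR.
    + by apply: measurable_funD; apply: measurable_funM => //; exact: measurable_cst.
  have zV : 0 <= z^-1 by rewrite invr_ge0 ltW.
  have zNV : 0 <= (z * N)^-1 by rewrite invr_ge0 ltW// mulr_gt0.
  rewrite integral_EFinD_ge0//; last 4 first.
  + by move=> y; rewrite mulr_ge0.
  + by move=> y; rewrite mulr_ge0.
  + by apply: measurable_funM => //; exact: measurable_cst.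
  + by apply: measurable_funM => //; exact: measurable_cst.
  rewrite !integral_EFinZl_ge0// intf intg -!EFinM -EFinD lte_fin.
  rewrite -mulrDl gtr_pMl// invfM -[X in X + _]mulr1 -mulrDr.
  rewrite mulrC ltr_pdivrMr// mul1r /z.
  have : 0 < N^-1 by rewrite invr_gt0.
  lra.
have B1 : 0 < b ^+ 2 * m + 1 by rewrite ltr_wpDl// mulr_ge0 ?sqr_ge0 ?ltW.
have B2 : 0 < b + 1 by lra.
(* The first bound gives s |X| <= 1/3, the range of [expR_le_quad]; the second keeps the quadratic
   term s^2 b^2 m below s gap / 2. *)
exists (Num.min (3^-1 / (b + 1)) (gap / 2 / (b ^+ 2 * m + 1))).
  by rewrite lt_min !divr_gt0.
move=> s /andP[s0]; rewrite le_min => /andP[].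
rewrite ler_pdivlMr// ler_pdivlMr//.
move=> sb sbm.
(* The entropy term stands on the left so that both sides are nonnegative; the integrals can then be
   compared and split without integrability conditions, before [hF] bounds that term from below. *)
have pw y : f y * expR (- s * X y) + s * (f y * ln (r y) + g y) <=
    (1 + s ^+ 2 * b ^+ 2 + s * (2 / N)) * f y + s * g y.
  have := f0 y; rewrite le_eqVlt => /predU1P[<-|fy]; first by rewrite !mul0r mulr0 !add0r.
  have rX : ln (r y) <= X y + 2 / N.
    have : ln (r y) <= ln (v y).
      by rewrite ler_ln ?posrE ?trunc_ratio_gt0// le_max lexx.
    by move: lnz; rewrite /X; lra.
  have := Xb y; rewrite ler_norml => /andP[X1 X2].
  have X3 : X y ^+ 2 <= b ^+ 2 by rewrite -real_normK ?num_real// lerXn2r ?nnegrE.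
  have /expR_le_quad : - s * X y <= 1 / 3 by nra.
  move=> E.
  have : f y * expR (- s * X y) <= f y * (1 + - s * X y + (- s * X y) ^+ 2) by rewrite ler_pM2l.
  have : s * f y * ln (r y) <= s * f y * (X y + 2 / N) by rewrite ler_pM2l// mulr_gt0.
  have : f y * s ^+ 2 * X y ^+ 2 <= f y * s ^+ 2 * b ^+ 2 by rewrite ler_wpM2l// mulr_ge0 ?sqr_ge0.
  by rewrite exprMn sqrrN; lra.
have mfe : measurable_fun setT (fun y => f y * expR (- s * X y)).
  by apply: measurable_funM => //; exact: measurable_expR_scale.
have mF : measurable_fun setT (fun y => (ln 2)^-1 * (f y * ln (r y) + g y)).
  apply: measurable_funM; first exact: measurable_cst.
  apply: measurable_funD => //; apply: measurable_funM => //.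
  by apply: measurableT_comp => //; exact: measurable_ln.
have k0 : 0 <= (ln 2)^-1 :> R by rewrite invr_ge0 ltW.
have F0 y : 0 <= (ln 2)^-1 * (f y * ln (r y) + g y).
  by rewrite mulr_ge0// trunc_ratio_entropy_ge0.
have sl0 : 0 <= s * ln 2 by rewrite mulr_ge0// ltW.
have C0 : 0 <= 1 + s ^+ 2 * b ^+ 2 + s * (2 / N).
  apply: addr_ge0; last by apply: mulr_ge0; exact: ltW.
  by apply: addr_ge0 => //; apply: mulr_ge0; exact: sqr_ge0.
have : (\int[mu]_y (f y * expR (- s * X y) +
      s * ln 2 * ((ln 2)^-1 * (f y * ln (r y) + g y)))%:E <=
    \int[mu]_y ((1 + s ^+ 2 * b ^+ 2 + s * (2 / N)) * f y + s * g y)%:E)%E.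
  apply: le_integral_EFin => [y|y||].
  - by apply: addr_ge0; apply: mulr_ge0 => //; exact: expR_ge0.
  - by rewrite mulrA -[s * ln 2 * _]mulrA divff ?gt_eqF// mulr1; exact: pw.
  - by apply: measurable_funD => //; apply: measurable_funM => //; exact: measurable_cst.
  - by apply: measurable_funD; apply: measurable_funM => //; exact: measurable_cst.
rewrite integral_EFinD_ge0//; last 3 first.
- by move=> y; rewrite mulr_ge0 ?expR_ge0.
- by move=> y; rewrite mulr_ge0.
- by apply: measurable_funM => //; exact: measurable_cst.
rewrite integral_EFinD_ge0//; last 4 first.
- by move=> y; rewrite mulr_ge0.
- by move=> y; rewrite mulr_ge0// ltW.
- by apply: measurable_funM => //; exact: measurable_cst.
- by apply: measurable_funM => //; exact: measurable_cst.
rewrite (integral_EFinZl_ge0 _ sl0 F0 mF) (integral_EFinZl_ge0 _ C0 f0 mf).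
rewrite (integral_EFinZl_ge0 _ (ltW s0) g0 mg) intf intg -!EFinM -EFinD.
move=> H.
have H2 : (\int[mu]_y (f y * expR (- s * X y))%:E + (s * ln 2 * (c' + (ln 2)^-1 * m))%:E <=
   ((1 + s ^+ 2 * b ^+ 2 + s * (2 / N)) * m + s * m)%:E)%E.
  apply: le_trans H; rewrite leeD2l// EFinM lee_wpmul2l ?lee_fin//.
  exact: ltW.
rewrite -leeBrDr// in H2; apply: (le_trans H2).
rewrite -EFinB lee_fin mulrDr [s * ln 2 * (_ * m)]mulrA mulfK ?gt_eqF//.
have : s * (s * (b ^+ 2 * m + 1)) <= s * (gap / 2) by rewrite ler_pM2l.
have : s * (2 / N * m) <= s * (gap / 2) by rewrite ler_pM2l.
rewrite /gap.
have : 0 <= s * s by rewrite mulr_ge0 ?ltW.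
by rewrite expr2; lra.
Qed.

End kl_statistic.

(** * Channels with small query regions *)

(** Fatou's lemma gives lower semicontinuity in q for the integral of any nonnegative statistic.
    Applied to [B - u], with the total mass [m] constant in q, it becomes the upper semicontinuity
    wanted for [u]. *)
Lemma integral_near0_le d (Y : measurableType d) (R : realType)
    (mu : {measure set Y -> \bar R}) (f : R -> Y -> R) (u : Y -> R) (m B c : R) :
  (forall q y, 0 <= q <= 1 -> 0 <= f q y) ->
  (forall q, 0 <= q <= 1 -> measurable_fun setT (f q)) ->
  (forall q, 0 <= q <= 1 -> (\int[mu]_y (f q y)%:E = m%:E)%E) ->
  (forall y, {within `[0, 1], continuous (f ^~ y)}) ->
  measurable_fun setT u -> (forall y, 0 <= u y <= B) ->
  (\int[mu]_y (f 0%R y * u y)%:E < c%:E)%E ->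
  exists2 a, 0 < a <= 1 & forall q, 0 <= q <= a ->
    (\int[mu]_y (f q y * u y)%:E <= c%:E)%E.
Proof.
move=> f0 mf intf cf mu_ uB h0; apply: contrapT => H.
(* If every interval [0, 1/(n+1)] contains a violation, the violations form a sequence tending to
   0. *)
have Hn (n : nat) : exists q, 0 <= q <= n.+1%:R^-1 /\ (c%:E < \int[mu]_y (f q y * u y)%:E)%E.
  apply: contrapT => Hq; apply: H; exists n.+1%:R^-1.
    by rewrite invr_gt0 ltr0n/= invf_le1 ?ler1n.
  by move=> q hq; rewrite leNgt; apply/negP => hc; apply: Hq; exists q.
have [q hq] := choice Hn.
have q01 n : 0 <= q n <= 1.
  have [/andP[q0 qn] _] := hq n; rewrite q0/= (le_trans qn)//.
  by rewrite invf_le1 ?ler1n.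
have zero01 : 0 <= (0 : R) <= 1 by rewrite lexx ler01.
have cvq : q n @[n --> \oo] --> (0 : R).
  apply: (@squeeze_cvgr _ _ _ _ (cst 0) (@harmonic R)).
  - by apply: nearW => n; have [] := hq n.
  - exact: cvg_cst.
  - exact: cvg_harmonic.
have cvf y : f (q n) y @[n --> \oo] --> f 0 y.
  have /subspace_continuousP/(_ 0) := cf y.
  rewrite /= in_itv/= lexx ler01 => /(_ isT) c0.
  move=> A /c0 wA.
  have h : \forall n \near \oo, q n \in `[0, 1] -> A (f (q n) y) by exact: (cvq _ wA).
  by rewrite /nbhs/=; apply: filterS h => n; apply; rewrite in_itv/=.
have split_int p : 0 <= p <= 1 ->
    (\int[mu]_y (f p y * u y)%:E + \int[mu]_y (f p y * (B - u y))%:E = (B * m)%:E)%E.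
  move=> p01; rewrite -integral_EFinD_ge0.
  - under eq_integral => y _.
      rewrite -mulrDr addrCA subrr addr0 mulrC; over.
    have B0 : 0 <= B by have /andP[] := uB point; exact: le_trans.
    by rewrite integral_EFinZl_ge0 ?intf ?EFinM//; [move=> y; exact: f0|exact: mf].
  - by move=> y; rewrite mulr_ge0 ?f0//; case/andP: (uB y).
  - by move=> y; rewrite mulr_ge0 ?f0// subr_ge0; case/andP: (uB y).
  - by apply: measurable_funM => //; exact: mf.
  - apply: measurable_funM; first exact: mf.
    by apply: measurable_funB => //; exact: measurable_cst.
have g0 p y : 0 <= p <= 1 -> 0 <= f p y * (B - u y).
  by move=> p01; rewrite mulr_ge0 ?f0// subr_ge0; case/andP: (uB y).
have ge0u p : 0 <= p <= 1 -> (0 <= \int[mu]_y (f p y * u y)%:E)%E.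
  by move=> p01; apply: integral_EFin_ge0 => y; rewrite mulr_ge0 ?f0//; case/andP: (uB y).
have bound n : (\int[mu]_y (f (q n) y * (B - u y))%:E <= (B * m - c)%:E)%E.
  have [_ cn] := hq n; have := split_int _ (q01 n).
  move=> E; rewrite EFinB -E leeBrDr// [leLHS]addeC; apply: leeD => //; exact: ltW.
have F : (\int[mu]_y (f 0%R y * (B - u y))%:E <= (B * m - c)%:E)%E.
  have := @fatou _ _ _ mu setT measurableT (fun n y => (f (q n) y * (B - u y))%:E).
  move=> /(_ _ _)/wrap[]; first last.
  - move=> fat; apply: (@le_trans _ _
      (limn_einf (fun n => \int[mu]_y (f (q n) y * (B - u y))%:E)%E)).
      apply: le_trans fat; rewrite le_eqVlt; apply/orP; left; apply/eqP.
      apply: eq_integral => y _; apply/esym; apply: (cvg_limn_einf_sup _).1.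
      by apply: cvg_EFin; [exact: nearW|apply: cvgM; [exact: cvf|exact: cvg_cst]].
    rewrite limn_einf_lim; apply: lime_le.
      exact: is_cvg_einfs.
    apply: nearW => n; apply: le_trans (bound n).
    by apply: ereal_inf_lbound; exists n => /=.
  - by move=> n y _; rewrite lee_fin g0.
  - move=> n; apply/measurable_EFinP; apply: measurable_funM; first exact: mf.
    by apply: measurable_funB => //; exact: measurable_cst.
have E := split_int _ zero01.
have : ((B * m)%:E <= \int[mu]_y (f 0%R y * u y)%:E + (B * m - c)%:E)%E.
  by rewrite -E; apply: leeD.
rewrite -leeBlDr// -EFinB opprB addrCA subrr addr0 => /le_lt_trans/(_ h0).
by rewrite ltxx.
Qed.

(** Divergence integrands are signed and possibly not integrable, so positive and negative parts are
    compared separately. *)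
Lemma le_integral_signed d (Y : measurableType d) (R : realType)
    (mu : {measure set Y -> \bar R}) (h1 h2 : Y -> \bar R) :
  measurable_fun setT h1 -> measurable_fun setT h2 ->
  (forall y, (h1 y <= h2 y)%E) -> (\int[mu]_y h1 y <= \int[mu]_y h2 y)%E.
Proof.
move=> m1 m2 h12; rewrite integralE [leRHS]integralE leeB//.
- apply: ge0_le_integral => //; [exact: measurable_funepos|exact: measurable_funepos|].
  by move=> y _; apply: (@funepos_le _ _ setT) => [x _|]; rewrite ?inE//; exact: h12.
- apply: ge0_le_integral => //; [exact: measurable_funeneg|exact: measurable_funeneg|].
  by move=> y _; apply: (@funeneg_le _ _ setT) => [x _|]; rewrite ?inE//; exact: h12.
Qed.

(** * Gibbs' inequality with its equality case, and bounds on the channel quantities *)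

Definition kl_integrand (Y : Type) (R : realType) (f g : Y -> R) (y : Y) : \bar R :=
  if f y == 0 then 0%E else
  if g y == 0 then +oo%E else (f y * log2 (f y / g y))%:E.

Lemma measurable_kl_integrand d (Y : measurableType d) (R : realType) (f g : Y -> R) :
  (forall y, 0 <= g y) -> measurable_fun setT f -> measurable_fun setT g ->
  measurable_fun setT (kl_integrand f g).
Proof.
move=> g0 mf mg; apply: measurable_fun_ifT; [exact: measurable_fun_eqr|exact: measurable_cst|].
apply: measurable_fun_ifT; [exact: measurable_fun_eqr|exact: measurable_cst|].
apply/measurable_EFinP; apply: measurable_funM => //; apply: measurable_funM => //.
apply: measurableT_comp; first exact: measurable_ln.
exact: measurable_div_ge0.
Qed.

(** Gibbs' inequality before integration, from ln t >= 1 - 1/t at t = f / g. For densities of equal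
    mass the lower bound integrates to 0. *)
Lemma kl_integrand_ge (Y : Type) (R : realType) (f g : Y -> R) (y : Y) :
  0 <= f y -> 0 <= g y -> (((ln 2)^-1 * (f y - g y))%:E <= kl_integrand f g y)%E.
Proof.
have k0 : 0 < (ln 2)^-1 :> R by rewrite invr_gt0 ln_gt0// ltr1n.
move=> f0 g0; rewrite /kl_integrand; case: ifPn => [/eqP->|fy].
  by rewrite lee_fin pmulr_rle0// sub0r oppr_le0.
case: ifPn => gy; first by rewrite leey.
have fy0 : 0 < f y by rewrite lt0r fy.
have gy0 : 0 < g y by rewrite lt0r gy.
rewrite lee_fin /log2 mulrC mulrA ler_pM2r//.
have : f y * (1 - (f y / g y)^-1) <= f y * ln (f y / g y).
  by rewrite ler_pM2l// ln_ge_1subV// divr_gt0.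
by rewrite invfM invrK mulrBr mulr1 mulrA divff// mul1r.
Qed.

(** Equality in [kl_integrand_ge] reads ln t = t - 1 for t = g / f, and the strict inequality 1 + x
    < exp x for nonzero x leaves only t = 1. *)
Lemma kl_integrand_eq (Y : Type) (R : realType) (f g : Y -> R) (y : Y) :
  0 <= f y -> 0 <= g y -> kl_integrand f g y = ((ln 2)^-1 * (f y - g y))%:E ->
  f y = g y.
Proof.
have k0 : 0 < (ln 2)^-1 :> R by rewrite invr_gt0 ln_gt0// ltr1n.
move=> f0 g0; rewrite /kl_integrand; case: ifPn => [/eqP->|fy].
  by move=> [] /esym/eqP; rewrite mulf_eq0 gt_eqF//= sub0r oppr_eq0 => /eqP.
case: ifPn => gy //.
have fy0 : 0 < f y by rewrite lt0r fy.
have gy0 : 0 < g y by rewrite lt0r gy.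
have fg0 : 0 < f y / g y by rewrite divr_gt0.
move=> [] E0.
have E : f y * ln (f y / g y) = f y - g y.
  apply: (@mulfI _ (ln 2)^-1); first by rewrite gt_eqF.
  by rewrite -E0 /log2; ring.
have {}E : ln (g y / f y) = g y / f y - 1.
  have -> : g y / f y = (f y / g y)^-1 by rewrite invfM invrK mulrC.
  rewrite lnV ?posrE//; apply: (mulfI fy); rewrite mulrN E opprB mulrBr mulr1.
  by rewrite invfM invrK [(f y)^-1 * _]mulrC mulrCA divff// mulr1.
have gf0 : 0 < g y / f y by rewrite divr_gt0.
apply/eqP; rewrite eq_sym; apply: contraTT isT => gf.
have : ln (g y / f y) != 0.
  rewrite ln_eq0//; apply: contra gf => /eqP h.
  by rewrite -[f y]mul1r -h divfK.
by move=> /expR_gt1Dx; rewrite lnK ?posrE// E addrC subrK ltxx.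
Qed.

Section kl_div_properties.
Context d (Y : measurableType d) (R : realType).
Variable mu : {sigma_finite_measure set Y -> \bar R}.
Variables (f g : Y -> R) (m : R).
Hypotheses (f0 : forall y, 0 <= f y) (g0 : forall y, 0 <= g y).
Hypotheses (mf : measurable_fun setT f) (mg : measurable_fun setT g).
Hypotheses (intf : (\int[mu]_y (f y)%:E = m%:E)%E).
Hypotheses (intg : (\int[mu]_y (g y)%:E = m%:E)%E).

Let k : R := (ln 2)^-1.
Let k0 : 0 < k. Proof. by rewrite invr_gt0 ln_gt0// ltr1n. Qed.

Let integrable_density (h : Y -> R) : (forall y, 0 <= h y) -> measurable_fun setT h ->
  (\int[mu]_y (h y)%:E = m%:E)%E -> mu.-integrable setT (EFin \o h).
Proof.
move=> h0 mh inth; apply/integrableP; split; first exact/measurable_EFinP.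
under eq_integral => y _ do rewrite gee0_abs//= ?lee_fin//.
by rewrite inth ltry.
Qed.

Let intkfg : (\int[mu]_y (k * (f y - g y))%:E = 0)%E.
Proof.
have If := integrable_density f0 mf intf; have Ig := integrable_density g0 mg intg.
under eq_integral do rewrite EFinM EFinB.
rewrite integralZl//; last exact: (integrableB measurableT If Ig).
by rewrite integralB//= intf intg subee// mule0.
Qed.

Let mkfg : measurable_fun setT (fun y => (k * (f y - g y))%:E).
Proof.
apply/measurable_EFinP/measurable_funM; first exact: measurable_cst.
exact: measurable_funB.
Qed.

Let mH := measurable_kl_integrand g0 mf mg.

Lemma kl_div_ge0 : (0 <= kl_div mu f g)%E.
Proof.
by rewrite -intkfg; apply: le_integral_signed => // y; exact: kl_integrand_ge.
Qed.

(** The defect [h] in Gibbs' inequality is nonnegative with integral 0, hence 0 almost everywhere,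
    where the equality case applies. *)
Lemma kl_div_eq0 : (kl_div mu f g = 0)%E -> {ae mu, forall y, f y = g y}.
Proof.
move=> K0.
have If := integrable_density f0 mf intf; have Ig := integrable_density g0 mg intg.
have IL : mu.-integrable setT (fun y => (k * (f y - g y))%:E).
  have := integrableZl measurableT k (integrableB measurableT If Ig).
  by apply: eq_integrable => // y _; rewrite /= -EFinB -EFinM.
pose h y := (kl_integrand f g y - (k * (f y - g y))%:E)%E.
have h0 y : (0 <= h y)%E by rewrite sube_ge0 ?kl_integrand_ge.
have mh : measurable_fun setT h by apply: emeasurable_funB.
(* The negative part is dominated by that of the linear lower bound; since the divergence is 0, the
   positive part is then finite too. *)
have IH : mu.-integrable setT (kl_integrand f g).
  have neg : (\int[mu]_y (kl_integrand f g)^\- y < +oo)%E.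
    have L := integral_funeneg_lt_pinfty measurableT IL; apply: le_lt_trans L.
    apply: ge0_le_integral => //; [exact: measurable_funeneg|exact: measurable_funeneg|].
    by move=> y _; apply: (@funeneg_le _ _ setT) => [x _|]; rewrite ?inE//; exact: kl_integrand_ge.
  have neg0 : (0 <= \int[mu]_y (kl_integrand f g)^\- y)%E by apply: integral_ge0.
  have fneg : (\int[mu]_y (kl_integrand f g)^\- y)%E \is a fin_num by rewrite ge0_fin_numE.
  have pos : (\int[mu]_y (kl_integrand f g)^\+ y < +oo)%E.
    have E : (\int[mu]_y (kl_integrand f g)^\+ y - \int[mu]_y (kl_integrand f g)^\- y = 0)%E.
      by rewrite -integralE.
    by rewrite -[X in (X < _)%E](@subeK _ _ _ fneg) E add0e.
  apply/integrableP; split => //.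
  under eq_integral => y _ do rewrite -/((abse \o kl_integrand f g) y) fune_abse.
  rewrite ge0_integralD//; last 2 first.
  - exact: measurable_funepos.
  - exact: measurable_funeneg.
  by rewrite lte_add_pinfty.
have : (\int[mu]_y `|h y| = 0)%E.
  under eq_integral => y _ do rewrite gee0_abs//.
  by rewrite /h integralB// intkfg sube0.
move/(ae_eq_integral_abs mu measurableT mh); apply: filterS => y /(_ Logic.I)/= E.
apply: kl_integrand_eq => //.
by rewrite -[LHS](@subeK _ _ (k * (f y - g y))%:E)// -/(h y) E add0e.
Qed.

End kl_div_properties.

Section channel_tests.
Context (R : realType) d (Y : measurableType d).
Variables (mu : {sigma_finite_measure set Y -> \bar R}) (p : R -> bool -> Y -> R).
Hypotheses (hp : query_channel mu p) (hstd : standing_assumptions mu p).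

Let zero01 : 0 <= (0 : R) <= 1. Proof. by rewrite lexx ler01. Qed.
Let ln20 : 0 < ln 2 :> R. Proof. by rewrite ln_gt0// ltr1n. Qed.
Let p_ge0 := channel_ge0 hp.
Let p_meas := channel_measurable hp.
Let p_mass := channel_mass1 hp.

Lemma channel_near0_le x (u : Y -> R) (B c : R) :
  measurable_fun setT u -> (forall y, 0 <= u y <= B) ->
  (\int[mu]_y (p 0 x y * u y)%:E < c%:E)%E ->
  exists2 a, 0 < a <= 1 & forall q, 0 <= q <= a ->
    (\int[mu]_y (p q x y * u y)%:E <= c%:E)%E.
Proof.
move=> mu_ uB; apply: (@integral_near0_le _ _ _ mu (fun q => p q x) u 1 B c) => //.
- by move=> q y; exact: p_ge0.
- by move=> q; exact: p_meas.
- by move=> q; exact: p_mass.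
- by move=> y; exact: (channel_continuous hstd).
Qed.

Lemma output_density_ge0 a q y : 0 <= a <= 1 -> 0 <= q <= 1 ->
  0 <= output_density p a q y.
Proof.
move=> /andP[a0 a1] q01; rewrite /output_density big_bool/=.
by rewrite addr_ge0// mulr_ge0 ?p_ge0// subr_ge0.
Qed.

Lemma measurable_output_density a q : 0 <= q <= 1 ->
  measurable_fun setT (output_density p a q).
Proof.
move=> q01; rewrite /output_density; under eq_fun do rewrite big_bool/=.
by apply: measurable_funD; apply: measurable_funM; try exact: measurable_cst; exact: p_meas.
Qed.

Lemma integral_output_density a q (u : Y -> R) : 0 <= a <= 1 -> 0 <= q <= 1 ->
  measurable_fun setT u -> (forall y, 0 <= u y) ->
  (\int[mu]_y (output_density p a q y * u y)%:E =
   a%:E * \int[mu]_y (p q true y * u y)%:E +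
   (1 - a)%:E * \int[mu]_y (p q false y * u y)%:E)%E.
Proof.
move=> /andP[a0 a1] q01 mu_ u0.
have pu0 x y : 0 <= p q x y * u y by rewrite mulr_ge0// p_ge0.
have mpu x : measurable_fun setT (fun y => p q x y * u y).
  by apply: measurable_funM => //; exact: p_meas.
have b0 : 0 <= 1 - a by rewrite subr_ge0.
under eq_integral => y _.
  rewrite /output_density big_bool/= mulrDl -!mulrA; over.
rewrite integral_EFinD_ge0.
- by rewrite !integral_EFinZl_ge0.
- by move=> y; rewrite mulr_ge0.
- by move=> y; rewrite mulr_ge0.
- by apply: measurable_funM => //; exact: measurable_cst.
- by apply: measurable_funM => //; exact: measurable_cst.
Qed.

Lemma output_density_mass1 a q : 0 <= a <= 1 -> 0 <= q <= 1 ->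
  (\int[mu]_y (output_density p a q y)%:E = 1)%E.
Proof.
move=> a01 q01.
have E x : (\int[mu]_y (p q x y * 1)%:E = 1)%E.
  by under eq_integral do rewrite mulr1; exact: p_mass.
have := @integral_output_density a q (fun=> 1) a01 q01 (measurable_cst _) (fun=> ler01).
rewrite !E !mule1 -EFinD addrC subrK => <-.
by apply: eq_integral => y _; rewrite mulr1.
Qed.

Lemma input_prob_ge0 a x : 0 <= a <= 1 -> 0 <= input_prob a x :> R.
Proof. by move=> /andP[a0 a1]; case: x => //=; rewrite subr_ge0. Qed.

Section one_input.
Variables (a q : R) (x : bool).
Hypotheses (a01 : 0 <= a <= 1) (q01 : 0 <= q <= 1).
Let P := input_prob a x.
Let P0 : 0 <= P. Proof. exact: input_prob_ge0. Qed.
Let f y := P * p q x y.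
Let g y := P * output_density p a q y.

Lemma joint_density_props : [/\ forall y, 0 <= f y, measurable_fun setT f &
  (\int[mu]_y (f y)%:E = P%:E)%E].
Proof.
split.
- by move=> y; rewrite mulr_ge0// p_ge0.
- by apply: measurable_funM; [exact: measurable_cst|exact: p_meas].
- rewrite integral_EFinZl_ge0 ?p_mass ?mule1//; last exact: p_meas.
  by move=> y; exact: p_ge0.
Qed.

Lemma product_density_props : [/\ forall y, 0 <= g y, measurable_fun setT g &
  (\int[mu]_y (g y)%:E = P%:E)%E].
Proof.
split.
- by move=> y; rewrite mulr_ge0// output_density_ge0.
- by apply: measurable_funM; [exact: measurable_cst|exact: measurable_output_density].
- rewrite integral_EFinZl_ge0 ?output_density_mass1 ?mule1//.
    by move=> y; exact: output_density_ge0.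
  exact: measurable_output_density.
Qed.

Lemma kl_input_ge0 : (0 <= kl_div mu f g)%E.
Proof.
have [f0 mf fi] := joint_density_props; have [g0 mg gi] := product_density_props.
exact: (kl_div_ge0 f0 g0 mf mg fi gi).
Qed.

(** The joint density is at most the output density, so the likelihood ratio is at most 1 / P, and -
    P ln P <= 1 bounds the integral. This keeps the capacity finite for an arbitrary output
    alphabet. *)
Lemma kl_input_le : (kl_div mu f g <= (ln 2)^-1%:E)%E.
Proof.
have [f0 mf fi] := joint_density_props; have [g0 mg gi] := product_density_props.
have fQ y : f y <= output_density p a q y.
  rewrite /output_density big_bool/= /f /P; case: x => /=.
    by rewrite lerDl mulr_ge0 ?p_ge0// subr_ge0; case/andP: a01.
  by rewrite lerDr mulr_ge0 ?p_ge0//; case/andP: a01.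
apply: (@le_trans _ _ (\int[mu]_y ((ln 2)^-1 * p q x y)%:E)%E); last first.
  rewrite integral_EFinZl_ge0 ?p_mass ?mule1//.
  - by rewrite invr_ge0 ltW.
  - by move=> y; exact: p_ge0.
  - exact: p_meas.
apply: le_integral_signed.
- exact: measurable_kl_integrand.
- by apply/measurable_EFinP/measurable_funM; [exact: measurable_cst|exact: p_meas].
move=> y; have k0 : 0 <= (ln 2)^-1 :> R by rewrite invr_ge0 ltW.
have p0 : 0 <= p q x y by exact: p_ge0.
rewrite -/(kl_integrand f g y) /kl_integrand; case: ifPn => fy; first by rewrite lee_fin mulr_ge0.
have fy0 : 0 < f y by rewrite lt0r fy f0.
have Ppos : 0 < P by rewrite lt0r P0 andbT; apply: contra fy; rewrite /f => /eqP ->; rewrite mul0r.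
have Q0 : 0 < output_density p a q y by exact: (lt_le_trans fy0 (fQ y)).
case: ifPn => [|gy]; first by rewrite /g mulf_eq0 !gt_eqF.
rewrite lee_fin /log2 mulrA mulrC ler_wpM2l//.
have -> : f y / g y = p q x y / output_density p a q y.
  by rewrite /f /g -mulf_div divff ?mul1r// gt_eqF.
have pxy : 0 < p q x y by move: fy0; rewrite /f pmulr_rgt0.
have : ln (p q x y / output_density p a q y) <= - ln P.
  rewrite -lnV ?posrE// ler_ln ?posrE ?divr_gt0 ?invr_gt0//.
  by rewrite ler_pdivrMr// mulrC ler_pdivlMr// mulrC; exact: fQ.
move=> h; apply: (@le_trans _ _ (f y * - ln P)); first by rewrite ler_pM2l.
have := ln_ge_1subV Ppos => h2.
have : P * (1 - P^-1) <= P * ln P by rewrite ler_pM2l.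
rewrite mulrBr divff ?gt_eqF// mulr1 => h3.
have : 0 <= (1 + P * ln P) * p q x y by rewrite mulr_ge0//; lra.
by rewrite /f; lra.
Qed.

End one_input.

Lemma mutual_infoE a q : mutual_info mu p a q =
  (kl_div mu (fun y => (input_prob a true * p q true y)%R)
     (fun y => (input_prob a true * output_density p a q y)%R) +
   kl_div mu (fun y => (input_prob a false * p q false y)%R)
     (fun y => (input_prob a false * output_density p a q y)%R))%E.
Proof. by rewrite /mutual_info big_bool. Qed.

Lemma mutual_info_le a q : 0 <= a <= 1 -> 0 <= q <= 1 ->
  (mutual_info mu p a q <= (2 / ln 2)%:E)%E.
Proof.
move=> a01 q01; rewrite mutual_infoE.
apply: (@le_trans _ _ ((ln 2)^-1%:E + (ln 2)^-1%:E)%E).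
  by apply: leeD; exact: kl_input_le.
by rewrite -EFinD lee_fin -mulr2n mulr_natl.
Qed.

Lemma mutual_info_ge0 a q : 0 <= a <= 1 -> 0 <= q <= 1 ->
  (0 <= mutual_info mu p a q)%E.
Proof. by move=> a01 q01; rewrite mutual_infoE adde_ge0// kl_input_ge0. Qed.

Lemma capacity_le q : 0 <= q <= 1 -> (capacity mu p q <= (2 / ln 2)%:E)%E.
Proof.
move=> q01; apply: ge_ereal_sup => _ [a /= ha <-].
by apply: mutual_info_le => //; move: ha; rewrite in_itv.
Qed.

Lemma max_info_ge0 alpha : (0 <= max_info mu p alpha)%E.
Proof.
apply: (@le_trans _ _ (mutual_info mu p 0 (alpha * 0))).
  by rewrite mulr0 mutual_info_ge0.
by apply: ereal_sup_ubound; exists 0 => //=; rewrite in_itv.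
Qed.

(** I(q, alpha q) <= C(alpha q) <= C(0). The case q = 0 is separate because monotonicity is assumed
    between distinct sizes. *)
Lemma max_info_le_capacity0 alpha : 0 < alpha < 1 -> (max_info mu p alpha <= capacity mu p 0)%E.
Proof.
move=> /andP[al0 al1]; apply: ge_ereal_sup => _ [q /= + <-].
rewrite in_itv/= => /andP[q0 q1].
apply: (@le_trans _ _ (capacity mu p (alpha * q))).
  by apply: ereal_sup_ubound; exists q => //=; rewrite in_itv/= q0.
have := q0; rewrite le_eqVlt => /predU1P[<-|qpos]; first by rewrite mulr0.
apply: (capacity_noninc hstd) => //; first by rewrite mulr_gt0.
by apply: mulr_ile1 => //; exact: ltW.
Qed.

Lemma C1_ge0 q : 0 <= q <= 1 -> (0 <= C1 mu p q)%E.
Proof.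
move=> q01.
by apply: (kl_div_ge0 _ _ (p_meas _ q01) (p_meas _ q01) (p_mass _ q01) (p_mass _ q01)) => y;
  exact: p_ge0.
Qed.

(** If C_1 vanished, both inputs would give the same output law almost everywhere, and every mutual
    information would be 0. *)
Lemma C1_gt0_of_capacity q : 0 <= q <= 1 -> (0 < capacity mu p q)%E -> (0 < C1 mu p q)%E.
Proof.
move=> q01 C0; rewrite lt0e C1_ge0// andbT; apply/eqP => D0.
have ae : {ae mu, forall y, p q true y = p q false y}.
  by apply: (kl_div_eq0 _ _ (p_meas _ q01) (p_meas _ q01) (p_mass _ q01) (p_mass _ q01) D0) => y;
  exact: p_ge0.
suff : (capacity mu p q <= 0)%E by rewrite leNgt C0.
apply: ge_ereal_sup => _ [a /= + <-]; rewrite in_itv/= => a01.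
have kl0 x : (kl_div mu (fun y => (input_prob a x * p q x y)%R)
     (fun y => (input_prob a x * output_density p a q y)%R) = 0)%E.
  have [f0 mf fi] := joint_density_props x a01 q01.
  have [g0 mg gi] := product_density_props x a01 q01.
  rewrite -[RHS](integral0 mu setT); apply: ae_eq_integral => //.
    exact: measurable_kl_integrand.
  apply: filterS ae => y E _.
  have -> : output_density p a q y = p q x y.
    by rewrite /output_density big_bool/= E; case: (x) => /=; rewrite ?E; ring.
  case: ifPn => // nz.
  by rewrite (negbTE nz) /log2 divff// ln1 mul0r mulr0.
by rewrite mutual_infoE !kl0 adde0.
Qed.

End channel_tests.

(** * Statistics for detection and for coding, valid for all small query regions *)

Section channel_statistics.
Context (R : realType) d (Y : measurableType d).
Variables (mu : {sigma_finite_measure set Y -> \bar R}) (p : R -> bool -> Y -> R).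
Hypotheses (hp : query_channel mu p) (hstd : standing_assumptions mu p).

Let zero01 : 0 <= (0 : R) <= 1. Proof. by rewrite lexx ler01. Qed.
Let ln20 : 0 < ln 2 :> R. Proof. by rewrite ln_gt0// ltr1n. Qed.
Let p_ge0 := channel_ge0 hp.
Let p_meas := channel_measurable hp.
Let p_mass := channel_mass1 hp.

Lemma expR_scale_bounded (X : Y -> R) b s : (forall y, `|X y| <= b) -> 0 <= s ->
  forall y, 0 <= expR (- s * X y) <= expR (s * b).
Proof.
move=> Xb s0 y; rewrite expR_ge0/= ler_expR mulNr -mulrN ler_wpM2l//.
by have := Xb y; rewrite ler_norml; lra.
Qed.

Lemma expR_bounded (X : Y -> R) b : (forall y, `|X y| <= b) ->
  forall y, 0 <= expR (X y) <= expR b.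
Proof.
by move=> Xb y; rewrite expR_ge0/= ler_expR; have := Xb y; rewrite ler_norml; lra.
Qed.

(** [X] is a truncated ln (P_0(.|1) / P_0(.|0)). The first moment controls false alarms and the
    second one misses, each through a Chernoff bound. *)
Lemma detection_statistic (c : R) : (c%:E < C1 mu p 0)%E ->
  exists (X : Y -> R) (s a0 : R), [/\ measurable_fun setT X, 0 < s, 0 < a0 <= 1 &
    forall q, 0 <= q <= a0 ->
    (\int[mu]_y (p q false y * expR (X y))%:E <= 1)%E /\
    (\int[mu]_y (p q true y * expR (- s * X y))%:E <= (expR (- s * c * ln 2))%:E)%E].
Proof.
move=> /lte_real_between[c' cc' c'C].
have [X [b [mX b0 Xb g1 [s s0 fs]]]] := kl_statistic
  (fun y => p_ge0 true y zero01) (fun y => p_ge0 false y zero01)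
  (p_meas true zero01) (p_meas false zero01)
  (p_mass true zero01) (p_mass false zero01) ltr01 c'C.
have {fs} := fs s; rewrite s0 lexx => /(_ isT) fs.
have meX : measurable_fun setT (fun y => expR (X y)).
  by apply: measurableT_comp => //; exact: measurable_expR.
have [a1 a101 ha1] := channel_near0_le hp hstd meX (expR_bounded Xb) g1.
have [|a2 a201 ha2] := channel_near0_le hp hstd (c := expR (- s * c * ln 2))
   (measurable_expR_scale (- s) mX) (expR_scale_bounded Xb (ltW s0)) (x := true).
  (* 1 - s c' ln 2 < 1 - s c ln 2 <= exp(- s c ln 2): the slack between [c] and [c'] supplies the
     strictness that small q requires. *)
  apply: le_lt_trans fs _; rewrite lte_fin.
  have := expR_ge1Dx (- s * c * ln 2).
  have : s * c * ln 2 < s * c' * ln 2 by rewrite ltr_pM2r// ltr_pM2l.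
  lra.
exists X, s, (Num.min a1 a2); split => //.
  move: a101 a201 => /andP[h1 h2] /andP[h3 h4].
  by rewrite lt_min h1 h3/= ge_min h2.
move=> q; rewrite le_min => /and3P[q0 q1 q2].
by split; [apply: ha1|apply: ha2]; rewrite q0.
Qed.

(** [X x] is a truncated logarithm of P_0(.|x) over the output density for an input law with
    parameter [P] whose information exceeds [c]. The numbers [r x] bound its moment when the letter
    sent is x, and [t x x'] that of the score for x' when x is sent. Averaging [t] over x turns the
    letter into one drawn independently of x', whence the bound 1 by change of measure. *)
Lemma coding_statistic (c : R) : (c%:E < capacity mu p 0)%E -> 0 < c ->
  exists (P : R) (X : bool -> Y -> R) (s a0 : R) (r : bool -> R) (t : bool -> bool -> R),
  [/\ 0 < P < 1, forall x, measurable_fun setT (X x), 0 < s, 0 < a0 <= 1 &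
    [/\ forall x, 0 <= r x, forall x x', 0 <= t x x',
      \sum_(x : bool) input_prob P x * r x <= expR (- s * c * ln 2),
      forall x', \sum_(x : bool) input_prob P x * t x x' <= 1 &
      forall q, 0 <= q <= a0 -> forall x,
        (\int[mu]_y (p q x y * expR (- s * X x y))%:E <= (r x)%:E)%E /\
        forall x', (\int[mu]_y (p q x y * expR (X x' y))%:E <= (t x x')%:E)%E]].
Proof.
move=> cC c0.
have [P P01 cI] : exists2 P, 0 <= P <= 1 & (c%:E < mutual_info mu p P 0)%E.
  have [z [P hP zE] h] := ereal_sup_gt cC.
  by exists P; [move: hP; rewrite /= in_itv|rewrite zE].
(* A constant input carries no information. Both letters having positive probability permits
   division by [input_prob P x], from joint to conditional densities. *)
have Ppos : 0 < P < 1.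
  have [P0 P1] := andP P01; rewrite !lt_neqAle P0 P1 !andbT; apply/andP; split.
  - apply: contraTneq cI => <-; rewrite -leNgt mutual_infoE.
    have -> z h : kl_div mu (fun y => input_prob 0 true * z y) h = 0%E.
      rewrite -[RHS](integral0 mu setT); apply: eq_integral => y _.
      by rewrite /= mul0r eqxx.
    rewrite add0e -[leLHS]/(kl_div _ _ _).
    rewrite (_ : kl_div _ _ _ = 0)%E ?lee_fin ?ltW//.
    rewrite -[RHS](integral0 mu setT); apply: eq_integral => y _.
    rewrite /output_density big_bool/= subr0 !mul1r mul0r add0r.
    by case: ifPn => // nz; rewrite (negbTE nz) /log2 divff// ln1 mul0r mulr0.
  - apply: contraTneq cI => ->; rewrite -leNgt mutual_infoE.
    have -> z h : kl_div mu (fun y => input_prob 1 false * z y) h = 0%E.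
      rewrite -[RHS](integral0 mu setT); apply: eq_integral => y _.
      by rewrite /= subrr mul0r eqxx.
    rewrite adde0.
    rewrite (_ : kl_div _ _ _ = 0)%E ?lee_fin ?ltW//.
    rewrite -[RHS](integral0 mu setT); apply: eq_integral => y _.
    rewrite /output_density big_bool/= subrr !mul1r mul0r addr0.
    by case: ifPn => // nz; rewrite (negbTE nz) /log2 divff// ln1 mul0r mulr0.
have Q0 x : 0 < input_prob P x by case: x => /=; lra.
pose K x := kl_div mu (fun y => input_prob P x * p 0 x y)
                      (fun y => input_prob P x * output_density p P 0 y).
have Kfin x : K x \is a fin_num.
  by rewrite ge0_fin_numE ?kl_input_ge0//; apply: le_lt_trans (kl_input_le _ _ _ _) (ltry _).
(* The surplus of information over [c] is 4 gap: each of the two letters gives up one gap in [cc],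
   and [kap] takes a third. *)
pose gap := (fine (K true) + fine (K false) - c) / 4.
have gap0 : 0 < gap.
  rewrite /gap; move: cI; rewrite mutual_infoE -/(K true) -/(K false).
  by rewrite -(fineK (Kfin true)) -(fineK (Kfin false)) -EFinD lte_fin; lra.
pose cc x := fine (K x) - gap.
have ccK x : ((cc x)%:E < K x)%E by rewrite -[ltRHS]fineK// lte_fin /cc; lra.
have stat x : exists Xs : (Y -> R) * R * R, [/\ measurable_fun setT Xs.1.1,
    forall y, `|Xs.1.1 y| <= Xs.1.2,
    (\int[mu]_y (output_density p P 0 y * expR (Xs.1.1 y))%:E < 1)%E, 0 < Xs.2 &
    forall s, 0 < s <= Xs.2 -> (\int[mu]_y (p 0 x y * expR (- s * Xs.1.1 y))%:E <=
      ((input_prob P x - s * cc x * ln 2) / input_prob P x)%:E)%E].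
  have [f0 mf fi] := joint_density_props hp x P01 zero01.
  have [g0 mg gi] := product_density_props hp x P01 zero01.
  have [X [b [mX b0 Xb g1 [s s0 fs]]]] := kl_statistic f0 g0 mf mg fi gi (Q0 x) (ccK x).
  have meX : measurable_fun setT (fun y => expR (X y)).
    by apply: measurableT_comp => //; exact: measurable_expR.
  exists (X, b, s); split => //=.
    move: g1; under eq_integral do rewrite -mulrA.
    rewrite integral_EFinZl_ge0 ?(ltW (Q0 x))//.
    - rewrite -[X in (_ < X)%E -> _]mule1 lte_pmul2l ?lte_fin//. 
    - by move=> y; rewrite mulr_ge0 ?(output_density_ge0 hp) ?expR_ge0.
    - by apply: measurable_funM => //; exact: (measurable_output_density hp).
  move=> s' hs'; have := fs s' hs'; under eq_integral do rewrite -mulrA.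
  rewrite integral_EFinZl_ge0 ?(ltW (Q0 x))//.
  - by rewrite EFinM lee_pdivlMr// muleC.
  - by move=> y; rewrite mulr_ge0 ?p_ge0 ?expR_ge0.
  - apply: measurable_funM; first exact: p_meas.
    exact: measurable_expR_scale.
have [Xs hXs] := choice stat.
pose X x := (Xs x).1.1; pose b := Num.max (Xs true).1.2 (Xs false).1.2.
have mX x : measurable_fun setT (X x) by have [] := hXs x.
have Xb x y : `|X x y| <= b.
  have [_ /(_ y) h _ _ _] := hXs x; apply: le_trans h _; rewrite /b le_max.
  by case: (x); rewrite lexx ?orbT.
have meX x : measurable_fun setT (fun y => expR (X x y)).
  by apply: measurableT_comp => //; exact: measurable_expR.
pose s := Num.min (Xs true).2 (Xs false).2.
have s0 : 0 < s by rewrite lt_min; have [_ _ _ -> _] := hXs true; have [_ _ _ -> _] := hXs false.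
have rX x : (\int[mu]_y (p 0 x y * expR (- s * X x y))%:E <=
      ((input_prob P x - s * cc x * ln 2) / input_prob P x)%:E)%E.
  have [_ _ _ _] := hXs x; apply; rewrite s0/= /s ge_min.
  by case: (x); rewrite lexx ?orbT.
pose kap := s * gap * ln 2.
have kap0 : 0 < kap.
  by apply: mulr_gt0 => //; exact: mulr_gt0.
(* The term [kap] turns the bound at q = 0 into a strict one, so that it extends to small q. *)
pose r x := (input_prob P x - s * cc x * ln 2) / input_prob P x + kap.
pose T0 x x' := (\int[mu]_y (p 0 x y * expR (X x' y))%:E)%E.
have T00 x x' : (0 <= T0 x x')%E.
  by apply: integral_EFin_ge0 => y; rewrite mulr_ge0 ?p_ge0 ?expR_ge0.
have T0fin x x' : T0 x x' \is a fin_num.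
  rewrite ge0_fin_numE//; apply: (@le_lt_trans _ _ (\int[mu]_y (expR b * p 0 x y)%:E)%E).
    apply: le_integral_EFin => [y|y||].
    - by rewrite mulr_ge0 ?p_ge0 ?expR_ge0.
    - rewrite mulrC ler_wpM2r ?p_ge0// ler_expR.
      by have := Xb x' y; rewrite ler_norml => /andP[].
    - by apply: measurable_funM => //; exact: p_meas.
    - by apply: measurable_funM; [exact: measurable_cst|exact: p_meas].
  rewrite integral_EFinZl_ge0 ?expR_ge0 ?p_mass ?mule1 ?ltry//; last exact: p_meas.
  by move=> y; rewrite p_ge0.
(* The amount by which the averaged moment falls short of 1; added to both entries [t x x'], it
   brings their average to exactly 1. *)
pose kap' x' := 1 - (P * fine (T0 true x') + (1 - P) * fine (T0 false x')).
have kap'0 x' : 0 < kap' x'.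
  have [_ _ + _ _] := hXs x'.
  rewrite (integral_output_density hp P01 zero01 (meX x') (fun y => expR_ge0 (X x' y))).
  rewrite -/(T0 true x') -/(T0 false x') -(fineK (T0fin true x')) -(fineK (T0fin false x')).
  by rewrite -!EFinM -EFinD lte_fin /kap' subr_gt0.
pose t x x' := fine (T0 x x') + kap' x'.
have near x : exists a : R, 0 < a <= 1 /\ forall q, 0 <= q <= a ->
    (\int[mu]_y (p q x y * expR (- s * X x y))%:E <= (r x)%:E)%E /\
    forall x', (\int[mu]_y (p q x y * expR (X x' y))%:E <= (t x x')%:E)%E.
  have [|a1 a101 ha1] := channel_near0_le hp hstd (c := r x)
      (measurable_expR_scale (- s) (mX x)) (expR_scale_bounded (Xb x) (ltW s0)) (x := x).
    by apply: le_lt_trans (rX x) _; rewrite lte_fin /r ltrDl.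
  have T0t x' : (T0 x x' < (t x x')%:E)%E by rewrite -[ltLHS]fineK// lte_fin /t ltrDl.
  have [a2 a201 ha2] := channel_near0_le hp hstd (meX true) (expR_bounded (Xb true)) (T0t true).
  have [a3 a301 ha3] := channel_near0_le hp hstd (meX false) (expR_bounded (Xb false)) (T0t false).
  exists (Num.min a1 (Num.min a2 a3)); split.
    move: a101 a201 a301 => /andP[h1 h2] /andP[h3 h4] /andP[h5 h6].
    by rewrite !lt_min h1 h3 h5/= !ge_min h2.
  move=> q; rewrite !le_min => /and4P[q0 q1 q2 q3].
  by split => [|[]]; [apply: ha1|apply: ha2|apply: ha3]; rewrite q0.
have [a ha] := choice near.
exists P, X, s, (Num.min (a true) (a false)), r, t; split => //.
  have [/andP[h1 h2] _] := ha true; have [/andP[h3 h4] _] := ha false.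
  by rewrite lt_min h1 h3/= ge_min h2.
split.
(* [r x] is nonnegative because it bounds a nonnegative integral, namely the one at q = 0. *)
- move=> x; rewrite -lee_fin; have [_ /(_ 0)] := ha x.
  have [/andP[h1 h2] _] := ha x; rewrite lexx ltW// => /(_ isT)[+ _].
  apply: le_trans; apply: integral_EFin_ge0 => y.
  by rewrite mulr_ge0 ?p_ge0 ?expR_ge0.
- by move=> x x'; rewrite /t addr_ge0 ?fine_ge0// ltW.
- rewrite big_bool /r !mulrDr ![_ * (_ / _)]mulrC !divfK ?gt_eqF ?Q0//=.
  have := expR_ge1Dx (- s * c * ln 2).
  have -> : c = cc true + cc false - 2 * gap by rewrite /cc /gap; field.
  by have := kap0; rewrite /kap /cc; lra.
- by move=> x'; rewrite big_bool /t/= /kap'; lra.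
- move=> q; rewrite le_min => /and3P[q0 q1 q2] x; have [_ h] := ha x.
  by apply: h; rewrite q0/=; case: (x).
Qed.

End channel_statistics.

(** * Runs of a search scheme *)

Section weighted_integral.
Import HBNNSimple.
Context d (Om : measurableType d) d' (T : measurableType d') (R : realType).
Variables (P : {measure set Om -> \bar R}) (W : Om -> R) (X : Om -> T).
Hypotheses (W0 : forall om, 0 <= W om) (mW : measurable_fun setT W).
Hypothesis mX : measurable_fun setT X.

Let mWu (u : T -> R) : measurable_fun setT u ->
  measurable_fun setT (fun om => (W om * u (X om))%:E).
Proof.
move=> mu; apply/measurable_EFinP; apply: measurable_funM => //.
exact: measurableT_comp.
Qed.

Lemma weighted_integral_nnsfun (phi : {nnsfun T >-> R}) :
  (\int[P]_om (W om * phi (X om))%:E =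
   \sum_(r \in range phi) (r%:E * \int[P]_om (W om * \1_(phi @^-1` [set r]) (X om))%:E))%E.
Proof.
transitivity (\int[P]_om \sum_(r \in range phi)
    (r * (W om * \1_(phi @^-1` [set r]) (X om)))%:E)%E.
  apply: eq_integral => om _; rewrite fsumEFin// [phi (X om)]fimfunE; congr EFin.
  by rewrite mulr_fsumr//; apply: eq_fsbigr => r _; rewrite mulrCA.
have nn r om : 0 <= r * (W om * \1_(phi @^-1` [set r]) (X om)).
  rewrite mulrCA mulr_ge0// indicE; case: (boolP (_ \in _)); last by rewrite mulr0.
  by rewrite inE /= => <-; rewrite mulr1.
have m1 r : measurable_fun setT (fun om => W om * \1_(phi @^-1` [set r]) (X om)).
  by apply/measurable_EFinP; apply: mWu; exact: measurable_indic.
rewrite ge0_integral_fsum//.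
- apply: eq_fsbigr => r; rewrite inE => -[y _ <-].
  rewrite integral_EFinZl_ge0// => om.
  by rewrite mulr_ge0// indicE.
- move=> r; apply/measurable_EFinP; apply: measurable_funM => //.
- by move=> r om _; rewrite lee_fin.
Qed.

Lemma weighted_integral_lim (u : T -> R) (u0 : forall y, 0 <= u y)
    (mu : measurable_fun setT (EFin \o u)) :
  (\int[P]_om (W om * u (X om))%:E =
   limn (fun n => \int[P]_om (W om * nnsfun_approx measurableT mu n (X om))%:E))%E.
Proof.
rewrite -monotone_convergence//.
- apply: eq_integral => om _; apply/esym/cvg_lim => //.
  under eq_fun do rewrite EFinM; rewrite EFinM.
  apply: cvgeZl => //.
  by apply: (cvg_nnsfun_approx measurableT mu) => // y _; rewrite lee_fin.
- by move=> n; apply: mWu.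
- by move=> n om _; rewrite lee_fin mulr_ge0.
- move=> om _ a b ab; rewrite lee_fin ler_wpM2l//.
  by have /lefP := nd_nnsfun_approx measurableT mu ab; apply.
Qed.

End weighted_integral.

Section eq_weighted_integral.
Import HBNNSimple.

(** The images under [X1] and [X2] of the two weighted measures agree on measurable sets, hence on
    nonnegative functions, by increasing limits of simple functions. The law of a run is prescribed
    on sets, and this carries it over to statistics. *)
Lemma eq_weighted_integral d1 (O1 : measurableType d1) d2 (O2 : measurableType d2)
    d' (T : measurableType d') (R : realType)
    (P1 : {measure set O1 -> \bar R}) (W1 : O1 -> R) (X1 : O1 -> T)
    (P2 : {measure set O2 -> \bar R}) (W2 : O2 -> R) (X2 : O2 -> T) (u : T -> R) :
  (forall om, 0 <= W1 om) -> measurable_fun setT W1 -> measurable_fun setT X1 ->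
  (forall om, 0 <= W2 om) -> measurable_fun setT W2 -> measurable_fun setT X2 ->
  (forall B, measurable B -> \int[P1]_om (W1 om * \1_B (X1 om))%:E =
                             \int[P2]_om (W2 om * \1_B (X2 om))%:E)%E ->
  measurable_fun setT u -> (forall y, 0 <= u y) ->
  (\int[P1]_om (W1 om * u (X1 om))%:E = \int[P2]_om (W2 om * u (X2 om))%:E)%E.
Proof.
move=> W10 mW1 mX1 W20 mW2 mX2 E mu u0.
have mu' : measurable_fun setT (EFin \o u) by exact/measurable_EFinP.
rewrite (weighted_integral_lim P1 W10 mW1 mX1 u0 mu').
rewrite (weighted_integral_lim P2 W20 mW2 mX2 u0 mu').
congr (limn _); apply/funext => n.
rewrite !weighted_integral_nnsfun//; apply: eq_fsbigr => r _.
congr (_ * _)%E; apply: E; rewrite -[X in measurable X]setTI; exact: measurable_funP1.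
Qed.

End eq_weighted_integral.

(** * Data determined by finitely many observations *)

Section adapted.
Context d (Y : measurableType d).

Definition observed n (h : n.-tuple Y) : nat -> Y := nth point h.

(* A datum computed from n observations is a function of the whole sequence of
   observations that depends on its first n terms only; [observed] completes a finite
   history with an arbitrary value. *)
Definition adapted d' (T : measurableType d') (n : nat) (phi : (nat -> Y) -> T) : Prop :=
  (forall y y', (forall i, (i < n)%N -> y i = y' i) -> phi y = phi y') /\
  (forall m, measurable_fun setT (fun h : m.-tuple Y => phi (observed h))).

Lemma adapted_widen d' (T : measurableType d') n m (phi : (nat -> Y) -> T) : (n <= m)%N ->
  adapted n phi -> adapted m phi.
Proof.
move=> nm [h1 h2]; split => // y y' h; apply: h1 => i hi; apply: h.
exact: leq_trans hi nm.
Qed.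

Lemma adapted_cst d' (T : measurableType d') n (c : T) : adapted n (fun=> c).
Proof. by split => // m; exact: measurable_cst. Qed.

Lemma measurable_observed m i :
  measurable_fun setT (fun h : m.-tuple Y => observed h i).
Proof.
have [im|im] := ltnP i m.
  rewrite (_ : (fun _ => _) = (fun h => tnth h (Ordinal im))).
    exact: measurable_tnth.
  by apply/funext => h; rewrite /observed (tnth_nth point).
rewrite (_ : (fun _ => _) = (fun=> point)); first exact: measurable_cst.
by apply/funext => h; rewrite /observed nth_default// size_tuple.
Qed.

Lemma adapted_coord d' (T : measurableType d') n i (f : Y -> T) : (i < n)%N ->
  measurable_fun setT f -> adapted n (fun y => f (y i)).
Proof.
move=> ni mf; split => [y y' ->//|m].
by apply: measurableT_comp => //; exact: measurable_observed.
Qed.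

Lemma adapted_comp d1 (T1 : measurableType d1) d2 (T2 : measurableType d2) n
    (phi : (nat -> Y) -> T1) (f : T1 -> T2) :
  measurable_fun setT f -> adapted n phi -> adapted n (f \o phi).
Proof.
move=> mf [h1 h2]; split => [y y' /h1 /= ->//|m].
exact: (measurableT_comp mf (h2 m)).
Qed.

Lemma adapted_mulr (R : realType) n (phi psi : (nat -> Y) -> R) :
  adapted n phi -> adapted n psi -> adapted n (fun y => phi y * psi y).
Proof.
move=> [h1 h2] [h3 h4]; split => [y y' h|m].
  by rewrite (h1 _ _ h) (h3 _ _ h).
exact: (measurable_funM (h2 m) (h4 m)).
Qed.

Lemma adapted_addr (R : realType) n (phi psi : (nat -> Y) -> R) :
  adapted n phi -> adapted n psi -> adapted n (fun y => phi y + psi y).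
Proof.
move=> [h1 h2] [h3 h4]; split => [y y' h|m].
  by rewrite (h1 _ _ h) (h3 _ _ h).
exact: (measurable_funD (h2 m) (h4 m)).
Qed.

Lemma adapted_sum (R : realType) n m (phi : nat -> (nat -> Y) -> R) :
  (forall t, (t < m)%N -> adapted n (phi t)) ->
  adapted n (fun y => \sum_(t < m) phi t y).
Proof.
elim: m => [|m IH] h.
  by under eq_fun do rewrite big_ord0; exact: adapted_cst.
under eq_fun do rewrite big_ord_recr/=.
apply: adapted_addr; last exact: h.
by apply: IH => t tm; apply: h; rewrite ltnS ltnW.
Qed.

Lemma adapted_ge (R : realType) n (phi : (nat -> Y) -> R) c :
  adapted n phi -> adapted n (fun y => c <= phi y).
Proof.
move=> [h1 h2]; split => [y y' /h1->//|m].
exact: (measurable_fun_ler (measurable_cst _) (h2 m)).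
Qed.

(** The values are countable, so a preimage is a countable union over the pairs of values, whatever
    the function [F]. *)
Lemma adapted_nat2 n (f g : (nat -> Y) -> nat) d' (T : measurableType d') (F : nat -> nat -> T) :
  adapted n f -> adapted n g -> adapted n (fun y => F (f y) (g y)).
Proof.
move=> [f1 f2] [g1 g2]; split => [y y' h|m]; first by rewrite (f1 _ _ h) (g1 _ _ h).
move=> _ B mB; rewrite setTI.
rewrite (_ : _ @^-1` B = \bigcup_i \bigcup_j
  (if F i j \in B then (fun h : m.-tuple Y => f (observed h)) @^-1` [set i] `&`
     (fun h : m.-tuple Y => g (observed h)) @^-1` [set j] else set0)).
  apply: bigcup_measurable => i _; apply: bigcup_measurable => j _.
  case: ifP => // _.
  by apply: measurableI; rewrite -[X in measurable X]setTI; [exact: f2|exact: g2].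
apply/seteqP; split => h /=.
  move=> Bh; exists (f (observed h)) => //; exists (g (observed h)) => //.
  by rewrite mem_set.
by move=> [i _ [j _]]; case: ifPn => //; rewrite inE => FB [/= -> ->].
Qed.

Lemma adapted_nat n (f : (nat -> Y) -> nat) d' (T : measurableType d') (F : nat -> T) :
  adapted n f -> adapted n (fun y => F (f y)).
Proof. by move=> hf; exact: (@adapted_nat2 n f f _ _ (fun i _ => F i)). Qed.

Lemma adapted_bool2 n (f g : (nat -> Y) -> bool) d' (T : measurableType d')
    (F : bool -> bool -> T) :
  adapted n f -> adapted n g -> adapted n (fun y => F (f y) (g y)).
Proof.
have natb (h : (nat -> Y) -> bool) : adapted n h -> adapted n (fun y => nat_of_bool (h y)).
  by apply: adapted_comp => _ B _; rewrite setTI.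
move=> /natb hf /natb hg.
rewrite (_ : (fun y => _) = (fun y => F (nat_of_bool (f y) == 1%N) (nat_of_bool (g y) == 1%N))).
  exact: (@adapted_nat2 n _ _ _ _ (fun i j => F (i == 1%N) (j == 1%N)) hf hg).
by apply/funext => y; case: (f y); case: (g y).
Qed.

Lemma adapted_find n (p : nat -> (nat -> Y) -> bool) (s : seq nat) :
  (forall j, j \in s -> adapted n (p j)) ->
  adapted n (fun y => find (p ^~ y) s).
Proof.
elim: s => [|j s IH] h /=; first exact: adapted_cst.
have hj : adapted n (fun y => nat_of_bool (p j y)).
  have := h j (mem_head _ _); apply: adapted_comp => _ B _; rewrite setTI//.
have hs : adapted n (fun y => find (p ^~ y) s).
  by apply: IH => i si; apply: h; rewrite in_cons si orbT.
rewrite (_ : (fun y => _) =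
  (fun y => if nat_of_bool (p j y) == 1%N then 0%N else (find (p ^~ y) s).+1)).
  exact: (@adapted_nat2 n _ _ _ _ (fun i k => if i == 1%N then 0%N else k.+1) hj hs).
by apply/funext => y; case: (p j y).
Qed.

End adapted.

(** * Integrating out the observations of a run *)

Section run_analysis.
Context d (Y : measurableType d) (R : realType) (s : scheme Y R).
Context d' (Om : measurableType d') (P : probability Om R).
Variables (V : Om -> rnd s) (Yobs : nat -> Om -> Y).
Variables (mu : {sigma_finite_measure set Y -> \bar R}) (p : R -> bool -> Y -> R).
Hypothesis hp : query_channel mu p.
Variable w : R.
Hypothesis hrun : search_run V Yobs mu p w P.

Definition Yseq (om : Om) : nat -> Y := fun i => Yobs i om.

Let tup n (y : nat -> Y) : n.-tuple Y := [tuple y i | i < n].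

Let observed_tup n y i : (i < n)%N -> observed (tup n y) i = y i.
Proof. by move=> ni; rewrite /observed -[i]/(nat_of_ord (Ordinal ni)) -tnth_nth tnth_mktuple. Qed.

Let adapted_tup d1 (T : measurableType d1) n (phi : (nat -> Y) -> T) y : adapted n phi ->
  phi (observed (tup n y)) = phi y.
Proof. by move=> [h _]; apply: h => i ni; rewrite observed_tup. Qed.

Lemma adapted_history d1 (T : measurableType d1) n (phi : (nat -> Y) -> T) om : adapted n phi ->
  phi (observed (history V Yobs n om).2) = phi (Yseq om).
Proof. by move=> /(adapted_tup (Yseq om)). Qed.

Let measurable_tup n : measurable_fun setT (fun om => tup n (Yseq om)).
Proof.
apply/measurable_fun_tnthP => i.
rewrite (_ : _ \o _ = Yobs i); first exact: run_obs_measurable hrun _.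
by apply/funext => om; rewrite /= tnth_mktuple.
Qed.

Lemma measurable_adapted d1 (T : measurableType d1) n (phi : (nat -> Y) -> T) :
  adapted n phi -> measurable_fun setT (fun om => phi (Yseq om)).
Proof.
move=> hphi.
rewrite (_ : (fun _ => _) = (fun h => phi (observed h)) \o (fun om => tup n (Yseq om))).
  by apply: measurableT_comp; [exact: (proj2 hphi)|exact: measurable_tup].
by apply/funext => om /=; rewrite adapted_tup.
Qed.

Definition event (a : (nat -> Y) -> bool) : set Om := [set om | a (Yseq om)].

Lemma measurable_event n (a : (nat -> Y) -> bool) : adapted n a -> measurable (event a).
Proof.
move=> /measurable_adapted ma; rewrite -[event a]setTI.
by apply: (ma measurableT [set true]).
Qed.

Lemma integral_event n (a : (nat -> Y) -> bool) : adapted n a ->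
  (\int[P]_om ((a (Yseq om))%:R)%:E = P (event a))%E.
Proof.
move=> ha; rewrite -[event a]setIT -integral_indic//; last exact: measurable_event ha.
by apply: eq_integral => om _; rewrite indicE mem_setE.
Qed.

Let measurable_adapted_natr n (a : (nat -> Y) -> bool) : adapted n a ->
  measurable_fun setT (fun om => (a (Yseq om))%:R : R).
Proof.
move=> ha; rewrite (_ : (fun _ => _) = \1_(event a)).
  by apply: measurable_indic; exact: measurable_event ha.
by apply/funext => om; rewrite indicE mem_setE.
Qed.

Section one_step.
Variables (n : nat) (a : (nat -> Y) -> bool) (q : R) (b : bool).
Hypotheses (ha : adapted n a) (q01 : 0 <= q <= 1).
Hypothesis hqb : forall om, a (Yseq om) ->
  query_size V Yobs n om = q /\ (w \in query_set V Yobs n om) = b.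

(** On [a] the next query has a known size and a known answer, so the inner integral in the law of
    the run is constant and factors out. *)
Let run_event (a' : (nat -> Y) -> bool) B : adapted n a' ->
  (forall y, a' y -> a y) -> measurable B ->
  (P (event a' `&` (Yobs n @^-1` B)) =
   P (event a') * \int[mu]_(y in B) (p q b y)%:E)%E.
Proof.
move=> ha' a'a mB.
have E : event a' = history V Yobs n @^-1` [set h | a' (observed h.2)].
  by apply/seteqP; split => om; rewrite /= adapted_history.
have mA : measurable [set h : rnd s * n.-tuple Y | a' (observed h.2)].
  rewrite -[X in measurable X]setTI.
  have : measurable_fun setT (fun h : rnd s * n.-tuple Y => a' (observed h.2)).
    by apply: (@measurableT_comp _ _ _ _ _ _ (fun h => a' (observed h))) => //; exact: (proj2 ha').
  by move=> mA; apply: (mA measurableT [set true]).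
rewrite E (run_obs_law hrun)// -E.
rewrite (eq_integral (cst (\int[mu]_(y in B) (p q b y)%:E)%E)); last first.
  by move=> om; rewrite inE => /a'a /hqb[-> ->].
rewrite integral_cst; last exact: measurable_event ha'.
by rewrite muleC.
Qed.

Variables (u : Y -> R) (kappa : R).
Hypotheses (u0 : forall y, 0 <= u y) (mu_ : measurable_fun setT u).
Hypothesis hk : (\int[mu]_y (p q b y * u y)%:E = kappa%:E)%E.

Let p0 y : 0 <= p q b y. Proof. exact: (channel_ge0 hp). Qed.
Let mp : measurable_fun setT (p q b). Proof. exact: (channel_measurable hp). Qed.

Let run_event_integral (a' : (nat -> Y) -> bool) : adapted n a' -> (forall y, a' y -> a y) ->
  (\int[P]_om ((a' (Yseq om))%:R * u (Yobs n om))%:E = P (event a') * kappa%:E)%E.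
Proof.
move=> ha' a'a.
have Pfin : P (event a') \is a fin_num by apply: fin_num_measure; exact: measurable_event ha'.
pose c := fine (P (event a')).
have c0 : 0 <= c by rewrite fine_ge0.
transitivity (\int[mu]_y (c * p q b y * u (id y))%:E)%E.
  apply: eq_weighted_integral => //.
  - exact: measurable_adapted_natr ha'.
  - exact: run_obs_measurable hrun _.
  - by move=> y; rewrite mulr_ge0.
  - by apply: measurable_funM => //; exact: measurable_cst.
  - move=> B mB; transitivity (P (event a' `&` Yobs n @^-1` B)).
      rewrite -[X in _ = P X]setIT -integral_indic//.
        by apply: eq_integral => om _; rewrite !indicE in_setI -natrM mulnb mem_setE.
      apply: measurableI; first exact: measurable_event ha'.
      by rewrite -[X in measurable X]setTI; exact: (run_obs_measurable hrun).
    rewrite run_event// -(fineK Pfin) -/c.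
    under [RHS]eq_integral do rewrite -mulrA.
    rewrite integral_EFinZl_ge0//; last 2 first.
    - by move=> y; rewrite mulr_ge0// indicE.
    - by apply: measurable_funM => //; exact: measurable_indic.
    congr (_ * _)%E; rewrite [LHS]integral_mkcond; apply: eq_integral => y _.
    by rewrite /patch indicE; case: ifP => _; rewrite ?mulr1 ?mulr0.
under eq_integral do rewrite -mulrA.
rewrite integral_EFinZl_ge0//.
- by rewrite hk /c fineK.
- by move=> y; rewrite mulr_ge0.
- exact: measurable_funM.
Qed.

(** Replaces the statistic of the next observation by its mean [kappa], in the presence of an
    arbitrary statistic [phi] of the past. This is the conditional expectation given the past,
    restricted to an event on which the channel is known. *)
Lemma run_step (phi : (nat -> Y) -> R) : adapted n phi -> (forall y, 0 <= phi y) ->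
  (\int[P]_om ((a (Yseq om))%:R * u (Yobs n om) * phi (Yseq om))%:E =
   \int[P]_om (kappa * (a (Yseq om))%:R * phi (Yseq om))%:E)%E.
Proof.
move=> hphi phi0.
have k0 : 0 <= kappa.
  by rewrite -lee_fin -hk; apply: integral_EFin_ge0 => y; rewrite mulr_ge0.
have E om : phi (Yseq om) = (fun h : n.-tuple Y => phi (observed h)) (tup n (Yseq om)).
  by rewrite /= adapted_tup.
under eq_integral do rewrite E; under [RHS]eq_integral do rewrite E.
apply: (@eq_weighted_integral _ _ _ _ _ _ _ P (fun om => (a (Yseq om))%:R * u (Yobs n om))
  (fun om => tup n (Yseq om)) P (fun om => kappa * (a (Yseq om))%:R)
  (fun om => tup n (Yseq om)) (fun h => phi (observed h))) => //.
- by move=> om; rewrite mulr_ge0.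
- apply: measurable_funM; first exact: measurable_adapted_natr ha.
  by apply: measurableT_comp => //; exact: run_obs_measurable hrun _.
- exact: measurable_tup.
- by move=> om; rewrite mulr_ge0.
- apply: measurable_funM; first exact: measurable_cst.
  exact: measurable_adapted_natr ha.
- exact: measurable_tup.
(* For [phi] an indicator of past observations, the indicator is absorbed into the event, which
   remains adapted and contained in [a]. *)
- move=> B mB; pose a' y := a y && (tup n y \in B).
  have ha' : adapted n a'.
    apply: (@adapted_bool2 _ Y n a (fun y => tup n y \in B) _ bool andb) => //; split.
      move=> y y' h; congr (_ \in B); apply: eq_from_tnth => i.
      by rewrite !tnth_mktuple h.
    move=> m; have mt : measurable_fun setT (fun h : m.-tuple Y => tup n (observed h)).
      apply/measurable_fun_tnthP => i.
      rewrite (_ : _ \o _ = (fun h : m.-tuple Y => observed h i)); first exact: measurable_observed.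
      by apply/funext => h; rewrite /= tnth_mktuple.
    apply: (measurable_fun_bool true); rewrite setTI.
    rewrite (_ : _ @^-1` _ = (fun h : m.-tuple Y => tup n (observed h)) @^-1` B).
      by rewrite -[X in measurable X]setTI; exact: mt.
    by apply/seteqP; split => h /=; [exact: set_mem|exact: mem_set].
  have a'E om : (a' (Yseq om))%:R = (a (Yseq om))%:R * \1_B (tup n (Yseq om)) :> R.
    by rewrite indicE -natrM mulnb.
  transitivity (\int[P]_om ((a' (Yseq om))%:R * u (Yobs n om))%:E)%E.
    by apply: eq_integral => om _; rewrite a'E mulrAC.
  rewrite run_event_integral//; last by move=> y /andP[].
  under eq_integral do rewrite -mulrA -a'E.
  rewrite integral_EFinZl_ge0//; last exact: measurable_adapted_natr ha'.
  by rewrite (integral_event ha') muleC.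
- exact: (proj2 hphi).
Qed.

End one_step.

(** On [a] all queries of the block have prescribed sizes and answers, so the observations behave as
    independent ones; they are integrated out from the last to the first. *)
Lemma run_block n0 (a : (nat -> Y) -> bool) m (q : nat -> R) (b : nat -> bool)
    (u : nat -> Y -> R) (kappa : nat -> R) :
  adapted n0 a -> (forall t, 0 <= q t <= 1) ->
  (forall t om, (t < m)%N -> a (Yseq om) ->
    query_size V Yobs (n0 + t) om = q t /\ (w \in query_set V Yobs (n0 + t) om) = b t) ->
  (forall t y, 0 <= u t y) -> (forall t, measurable_fun setT (u t)) ->
  (forall t, (t < m)%N -> (\int[mu]_y (p (q t) (b t) y * u t y)%:E <= (kappa t)%:E)%E) ->
  (\int[P]_om ((a (Yseq om))%:R * \prod_(t < m) u t (Yobs (n0 + t) om))%:E <=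
   P (event a) * (\prod_(t < m) kappa t)%:E)%E.
Proof.
move=> ha q01; elim: m => [|m IH] hqb u0 mu_ hk.
  under eq_integral do rewrite big_ord0 mulr1.
  by rewrite (integral_event ha) big_ord0 mule1.
have pu0 t : (0 <= \int[mu]_y (p (q t) (b t) y * u t y)%:E)%E.
  by apply: integral_EFin_ge0 => y; rewrite mulr_ge0// (channel_ge0 hp).
have k0 t : (t < m.+1)%N -> 0 <= kappa t.
  by move=> /hk; rewrite -lee_fin; exact: le_trans.
(* [run_step] is an equality for the exact moment, which is weakened to [kappa m] only at the
   end. *)
pose k := fine (\int[mu]_y (p (q m) (b m) y * u m y)%:E)%E.
have kE : (\int[mu]_y (p (q m) (b m) y * u m y)%:E = k%:E)%E.
  rewrite fineK// ge0_fin_numE//; apply: le_lt_trans (hk m (ltnSn m)) (ltry _).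
have k00 : 0 <= k by rewrite fine_ge0.
have kk : k <= kappa m by rewrite -lee_fin -kE hk.
pose phi (y : nat -> Y) := \prod_(t < m) u t (y (n0 + t)%N).
have phi0 y : 0 <= phi y by apply: prodr_ge0.
have hphi : adapted (n0 + m) phi.
  rewrite /phi; elim: (m) => [|m' IH'].
    by under eq_fun do rewrite big_ord0; exact: adapted_cst.
  under eq_fun do rewrite big_ord_recr/=.
  apply: adapted_mulr; first by apply: adapted_widen IH'; rewrite addnS.
  by apply: adapted_coord; rewrite ?addnS.
have ha' : adapted (n0 + m) a by apply: adapted_widen ha; exact: leq_addr.
have := run_step ha' (q01 m) (fun om => @hqb m om (ltnSn m)) (u0 m) (mu_ m) kE hphi phi0.
rewrite /phi /= => E.
rewrite (eq_integral (fun om => ((a (Yseq om))%:R * u m (Yobs (n0 + m) om) *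
           \prod_(t < m) u t (Yseq om (n0 + t)%N))%:E)%E); last first.
  by move=> om _; rewrite big_ord_recr/= mulrAC mulrA mulrAC -mulrA mulrCA mulrA mulrAC.
rewrite E; under eq_integral do rewrite -mulrA.
rewrite integral_EFinZl_ge0//; last 2 first.
- by move=> om; rewrite mulr_ge0//; exact: (phi0 (Yseq om)).
- apply: measurable_funM; first exact: measurable_adapted_natr ha.
  exact: (measurable_adapted hphi).
rewrite big_ord_recr/= mulrC EFinM muleCA.
apply: lee_pmul; rewrite ?lee_fin//.
  apply: integral_EFin_ge0 => om; rewrite mulr_ge0//; exact: (phi0 (Yseq om)).
apply: IH => //.
- by move=> t om tm; apply: hqb; exact: ltnW.
- by move=> t tm; apply: hk; exact: ltnW.
Qed.

(** Chernoff bound: the indicator of a score of at least [L] is at most exp(-L) times the product of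
    the exponentials of the terms. *)
Lemma run_score_ge n0 (a : (nat -> Y) -> bool) m (q : nat -> R) (b : nat -> bool)
    (X : nat -> Y -> R) (kappa : nat -> R) (L : R) :
  adapted n0 a -> (forall t, 0 <= q t <= 1) ->
  (forall t om, (t < m)%N -> a (Yseq om) ->
    query_size V Yobs (n0 + t) om = q t /\ (w \in query_set V Yobs (n0 + t) om) = b t) ->
  (forall t, measurable_fun setT (X t)) ->
  (forall t, (t < m)%N -> (\int[mu]_y (p (q t) (b t) y * expR (X t y))%:E <= (kappa t)%:E)%E) ->
  (P (event (fun y => a y && (L <= \sum_(t < m) X t (y (n0 + t)%N)))%R) <=
   P (event a) * (expR (- L) * \prod_(t < m) kappa t)%:E)%E.
Proof.
move=> ha q01 hqb mX hk.
have meX t : measurable_fun setT (fun y => expR (X t y)).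
  by apply: measurableT_comp => //; exact: measurable_expR.
have := @run_block n0 a m q b (fun t y => expR (X t y)) kappa ha q01 hqb
  (fun t y => expR_ge0 _) meX hk.
have hS : adapted (n0 + m) (fun y : nat -> Y => \sum_(t < m) X t (y (n0 + t)%N)).
  apply: (@adapted_sum _ _ _ _ m (fun t y => X t (y (n0 + t)%N))) => t tm.
  by apply: adapted_coord; rewrite ?ltn_add2l.
have ha' : adapted (n0 + m) a by apply: adapted_widen ha; exact: leq_addr.
have hA : adapted (n0 + m) (fun y => a y && (L <= \sum_(t < m) X t (y (n0 + t)%N))).
  exact: (@adapted_bool2 _ Y _ a _ _ bool andb ha' (adapted_ge L hS)).
rewrite -(integral_event hA) => H.
apply: (@le_trans _ _ (\int[P]_om (expR (- L) * ((a (Yseq om))%:R *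
   \prod_(t < m) expR (X t (Yobs (n0 + t)%N om))))%:E)%E).
  apply: le_integral_EFin => [om|om||].
  - by [].
  - case: (a (Yseq om)); last by rewrite /= mul0r mulr0.
    rewrite /= mul1r -expR_sum -expRD.
    case: (leP L _) => h /=; last exact: expR_ge0.
    by rewrite -expR0 ler_expR addrC subr_ge0.
  - exact: measurable_adapted_natr hA.
  - apply: measurable_funM; first exact: measurable_cst.
    apply: measurable_funM; first exact: measurable_adapted_natr ha.
    under eq_fun do rewrite -expR_sum.
    apply: measurableT_comp; first exact: measurable_expR.
    exact: (measurable_adapted hS).
rewrite integral_EFinZl_ge0 ?expR_ge0//.
- by rewrite EFinM muleCA lee_pmul2l// lte_fin expR_gt0.
- by move=> om; rewrite mulr_ge0// prodr_ge0// => t _; exact: expR_ge0.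
- apply: measurable_funM; first exact: measurable_adapted_natr ha.
  under eq_fun do rewrite -expR_sum.
  apply: measurableT_comp; first exact: measurable_expR.
  exact: (measurable_adapted hS).
Qed.

End run_analysis.

(** * Greedy codes *)

Section feinstein.
Context (R : realType).
Variables (P : R) (r : bool -> R) (t : bool -> bool -> R) (rho al be : R).
Hypotheses (P01 : 0 <= P <= 1) (r0 : forall x, 0 <= r x) (t0 : forall x x', 0 <= t x x').
Hypotheses (rP : \sum_(x : bool) input_prob P x * r x <= rho).
Hypotheses (tP : forall x', \sum_(x : bool) input_prob P x * t x x' <= 1).
Hypotheses (al0 : 0 <= al) (be0 : 0 <= be).

Let in0 x : 0 <= input_prob P x :> R.
Proof. by case/andP: P01 => h1 h2; case: x => //=; rewrite subr_ge0. Qed.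

(* The bound is the mean of the left-hand side when the letters of x are independent
   Bernoulli(P) variables. *)
Lemma feinstein_step n k (code : nat -> nat -> bool) :
  exists x : nat -> bool,
    al * \prod_(u < n) r (x u) + be * (\sum_(j < k) \prod_(u < n) t (x u) (code j u)) <=
    al * rho ^+ n + be * k%:R.
Proof.
(* Words of length n form a finite type, over which the random-coding average is a finite sum;
   beyond n a word is filled with [false]. *)
pose ext (f : {ffun 'I_n -> bool}) (u : nat) : bool := oapp f false (insub u).
have extE f (u : 'I_n) : ext f u = f u by rewrite /ext valK.
pose B := al * rho ^+ n + be * k%:R.
pose val (x : nat -> bool) := al * \prod_(u < n) r (x u) +
  be * (\sum_(j < k) \prod_(u < n) t (x u) (code j u)).
pose wt (f : {ffun 'I_n -> bool}) := \prod_(u < n) input_prob P (f u).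
have wt0 f : 0 <= wt f by apply: prodr_ge0.
have avg (F : 'I_n -> bool -> R) :
    \sum_f wt f * \prod_(u < n) F u (f u) = \prod_(u < n) \sum_(x : bool) input_prob P x * F u x.
  rewrite bigA_distr_bigA; apply: eq_bigr => f _.
  by rewrite /wt -big_split.
have wt1 : \sum_f wt f = 1.
  have := avg (fun _ _ => 1); under eq_bigr do rewrite big1_eq mulr1.
  move=> ->; apply: big1 => u _; rewrite big_bool/= !mulr1; ring.
have : \sum_f wt f * (val (ext f) - B) <= 0.
  under eq_bigr do rewrite mulrBr.
  rewrite sumrB -[X in _ - X]mulr_suml wt1 mul1r subr_le0.
  rewrite /val; under eq_bigr do rewrite mulrDr.
  rewrite big_split/= /B; apply: lerD.
    under eq_bigr do rewrite mulrCA.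
    rewrite -mulr_sumr ler_wpM2l//.
    have := avg (fun _ => r) => E.
    under eq_bigr => f _ do under eq_bigr do rewrite extE.
    rewrite E prodr_const card_ord lerXn2r ?nnegrE//.
      by apply: sumr_ge0 => x _; rewrite mulr_ge0.
    by apply: le_trans rP; apply: sumr_ge0 => x _; rewrite mulr_ge0.
  under eq_bigr do rewrite mulrCA.
  rewrite -mulr_sumr ler_wpM2l//.
  under eq_bigr do rewrite mulr_sumr.
  rewrite exchange_big/= -[k in leRHS]card_ord -sum1_card natr_sum.
  apply: ler_sum => j _.
  under eq_bigr => f _ do under eq_bigr do rewrite extE.
  have -> := avg (fun u x => t x (code j u)).
  apply: prodr_ile1 => u _; rewrite tP andbT.
  by apply: sumr_ge0 => x _; rewrite mulr_ge0.
(* If every word exceeded the mean, a nonpositive sum with nonnegative terms would force all weights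
   to vanish, although they sum to 1. *)
move=> S; apply: contrapT => H.
have pos f : 0 < val (ext f) - B.
  rewrite subr_gt0 ltNge; apply/negP => h; apply: H; by exists (ext f).
have S0 : \sum_f wt f * (val (ext f) - B) == 0.
  by rewrite eq_le S/= sumr_ge0// => f _; rewrite mulr_ge0// ltW.
move: S0; rewrite psumr_eq0; last by move=> f _; rewrite mulr_ge0// ltW.
move=> /allP z; have : \sum_f wt f = 0.
  apply: big1 => f _; have := z f (mem_index_enum _).
  by rewrite /= mulf_eq0 (gt_eqF (pos f)) orbF => /eqP.
by rewrite wt1 => /eqP; rewrite oner_eq0.
Qed.

(** The decoder returns the first index whose score passes, so a codeword competes only with the
    earlier ones, and adding a word does not affect the bounds already secured. *)
Lemma feinstein_code n M e : al * rho ^+ n + be * M%:R <= e ->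
  exists code : nat -> nat -> bool, forall i, (i < M)%N ->
    al * \prod_(u < n) r (code i u) +
    be * (\sum_(j < i) \prod_(u < n) t (code i u) (code j u)) <= e.
Proof.
move=> he.
suff : forall k, (k <= M)%N -> exists code : nat -> nat -> bool, forall i, (i < k)%N ->
    al * \prod_(u < n) r (code i u) +
    be * (\sum_(j < i) \prod_(u < n) t (code i u) (code j u)) <= e.
  by apply.
elim=> [_|k IH kM]; first by exists (fun _ _ => false).
have [code hcode] := IH (ltnW kM).
have [x hx] := feinstein_step n k code.
exists (fun i => if i == k then x else code i) => i; rewrite ltnS leq_eqVlt => /predU1P[->|ik].
  rewrite eqxx; under [X in be * X]eq_bigr => j _ do rewrite (ltn_eqF (ltn_ord j)).
  apply: le_trans hx (le_trans _ he); rewrite lerD2l ler_wpM2l// ler_nat.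
  exact: ltnW.
rewrite ltn_eqF//.
under [X in be * X]eq_bigr => j _ do rewrite (ltn_eqF (ltn_trans (ltn_ord j) ik)).
exact: hcode.
Qed.

End feinstein.

(** * Uniform partitions of the unit interval *)

Section bins.
Context (R : realType).

Definition bin (N : nat) (x : R) : nat := Num.truncn (x * N%:R).

Lemma bin_lt N x : (0 < N)%N -> 0 <= x < 1 -> (bin N x < N)%N.
Proof.
move=> N0 /andP[x0 x1]; rewrite /bin truncn_lt_nat ?mulr_ge0//.
by rewrite gtr_pMl// ltr0n.
Qed.

Lemma bin_eq N j x : (0 < N)%N -> 0 <= x ->
  (bin N x == j) = (j%:R / N%:R <= x < j.+1%:R / N%:R).
Proof.
move=> N0 x0; rewrite /bin truncn_eq ?mulr_ge0//.
by rewrite ler_pdivrMr ?ltr0n// ltr_pdivlMr ?ltr0n.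
Qed.

Lemma bin_dist N x : (0 < N)%N -> 0 <= x -> `|(bin N x)%:R / N%:R - x| <= N%:R^-1.
Proof.
move=> N0 x0; have := @bin_eq N (bin N x) x N0 x0; rewrite eqxx => /esym/andP[h1 h2].
rewrite distrC ger0_norm ?subr_ge0// lerBlDr.
by move: h2; rewrite -natr1 mulrDl mul1r addrC => /ltW.
Qed.

(** A query is a boolean pattern on the bins, so that its size becomes a count and membership of the
    target a boolean evaluation. *)
Definition bins (N : nat) (f : nat -> bool) : set R :=
  [set x | (0 <= x < 1) && f (bin N x)].

Let cell N (j : nat) : set R := `[j%:R / N%:R, j.+1%:R / N%:R[%classic.

Let binsE N f : (0 < N)%N -> bins N f =
  \big[setU/set0]_(j < N) (if f j then cell N j else set0).
Proof.
move=> N0; rewrite -(bigcup_mkord N (fun j => if f j then cell N j else set0)).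
apply/seteqP; split => x /=.
  move=> /andP[x01 fx]; exists (bin N x); first by rewrite /= bin_lt.
  rewrite fx /cell /= in_itv/= -bin_eq//; by case/andP: x01.
move=> [j /= jN]; case: ifPn => // fj; rewrite /cell /= in_itv/= => /[dup] jx /andP[h1 h2].
have x0 : 0 <= x by apply: le_trans h1; rewrite divr_ge0.
rewrite /bins /=; have -> : x < 1.
  by apply: (lt_le_trans h2); rewrite ler_pdivrMr ?ltr0n// mul1r ler_nat.
by move: jx; rewrite -bin_eq// => /eqP ->; rewrite x0.
Qed.

Lemma measurable_bins N f : (0 < N)%N -> measurable (bins N f).
Proof.
move=> N0; rewrite binsE//; apply: bigsetU_measurable => j _.
by case: ifP => _ //; exact: measurable_itv.
Qed.

Lemma lebesgue_measure_bins N f : (0 < N)%N ->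
  lebesgue_measure (bins N f) = ((\sum_(j < N) f j)%:R / N%:R)%:E.
Proof.
move=> N0; rewrite binsE// measure_bigsetU_ord.
- rewrite natr_sum mulr_suml -sumEFin; apply: eq_bigr => j _.
  case: ifP => _; last by rewrite measure0 mul0r.
  rewrite -[LHS]/(lebesgue_measure (cell N j)) /cell lebesgue_measure_itv/= lte_fin.
  have -> : j%:R / N%:R < j.+1%:R / N%:R :> R.
    by rewrite ltr_pM2r ?invr_gt0 ?ltr0n// ltr_nat.
  by rewrite -EFinB -mulrBl -natr1 addrAC subrr add0r.
- by move=> j; case: ifP => _ //; exact: measurable_itv.
- apply/trivIsetP => i j _ _ ij; apply/seteqP; split => // x [].
  case: ifP => // _ + ; case: ifP => // _.
  rewrite /cell /= !in_itv/= => jx ix.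
  have x0 : 0 <= x by case/andP: ix => h _; apply: le_trans h; rewrite divr_ge0.
  move: jx ix; rewrite -!bin_eq// => /eqP jE /eqP iE.
  by move/eqP: ij; apply; apply: ord_inj; rewrite -iE -jE.
Qed.

End bins.

(** * The three-phase scheme *)

(** A fine bin b has coarse bin b / M and position b mod M inside it; counting fine bins is a double
    count over these two coordinates. *)
Lemma sum_ord_divn_modn m M (F : nat -> nat -> nat) : (0 < M)%N ->
  (\sum_(b < m * M) F (b %/ M) (b %% M) = \sum_(i < m) \sum_(l < M) F i l)%N.
Proof.
move=> M0; elim: m => [|m IH]; first by rewrite !big_ord0.
rewrite big_ord_recr/= -IH mulSn addnC big_split_ord/=; congr addn.
apply: eq_bigr => l _; rewrite divnMDl// modnMDl modn_small// divn_small//.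
by rewrite addn0.
Qed.

Lemma sum_ord_eq m j (a : nat) : (\sum_(i < m) (i == j :> nat) * a = (j < m) * a)%N.
Proof.
rewrite -big_distrl/=; congr muln.
have [jm|mj] := ltnP j m.
  rewrite (bigD1 (Ordinal jm))//= eqxx big1 ?addn0// => i.
  by rewrite -val_eqE/= => /negbTE ->.
by rewrite big1// => i _; rewrite ltn_eqF// (leq_trans (ltn_ord i)).
Qed.

Lemma find_iota (p : nat -> bool) M i : (i < M)%N -> p i ->
  (forall j, (j < i)%N -> ~~ p j) -> find p (iota 0 M) = i.
Proof.
move=> iM pi lt_i; have hs : has p (iota 0 M).
  by apply/hasP; exists i; rewrite ?mem_iota.
have fM : (find p (iota 0 M) < M)%N by rewrite -[ltnRHS](size_iota 0) -has_find.
apply/eqP; rewrite eqn_leq; apply/andP; split; rewrite leqNgt; apply/negP => h.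
  by have := before_find 0%N h; rewrite nth_iota// pi.
by have := nth_find 0%N hs; rewrite nth_iota// add0n (negbTE (lt_i _ h)).
Qed.

Section three_phase_scheme.
Context d (Y : measurableType d) (R : realType).
Variables (M1 M K n2 n3 : nat) (X1 : Y -> R) (X2 : bool -> Y -> R) (L1 L2 L3 : R).
Variable code : nat -> nat -> bool.
Hypotheses (mX1 : measurable_fun setT X1) (mX2 : forall x, measurable_fun setT (X2 x)).
Hypotheses (M1_gt1 : (1 < M1)%N) (M0 : (0 < M)%N).

Let N := (M1 * M)%N.
Let N0 : (0 < N)%N. Proof. by rewrite muln_gt0 M0 (ltnW M1_gt1). Qed.
Let n1 := (M1 * K)%N.
(** The check phase has [n3.+1] queries, so that an episode is never empty. *)
Definition episode_length := (M1 * K + n2 + n3.+1)%N.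
Local Notation T := episode_length.

Definition coarse_score o j (y : nat -> Y) := \sum_(t < K) X1 (y (o + j * K + t)%N).
(** When no test passes, [find] returns [M1] here and [M] in [fine_bin]. The candidate may then lie
    outside the partition or in an unrelated bin; such a candidate is simply one more wrong one for
    the check phase. *)
Definition coarse_bin o y := find (fun j => L1 <= coarse_score o j y) (iota 0 M1).
Definition fine_score o i (y : nat -> Y) := \sum_(t < n2) X2 (code i t) (y (o + n1 + t)%N).
Definition fine_bin o y := find (fun i => L2 <= fine_score o i y) (iota 0 M).
Definition candidate o y := (coarse_bin o y * M + fine_bin o y)%N.
Definition check_score o (y : nat -> Y) := \sum_(t < n3.+1) X1 (y (o + n1 + n2 + t)%N).
Definition accepted o y := L3 <= check_score o y.

Definition coarse_pattern t b := (b %/ M == t %/ K)%N.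
(* The query inside coarse bin j is padded with the complementary pattern in the
   next coarse bin, so that its total size is that of a coarse bin. *)
Definition fine_pattern j t b :=
  ((b %/ M == j) && code (b %% M) t || (b %/ M == j.+1 %% M1) && ~~ code (b %% M) t)%N.

(** The bins [j] and [i] are computed even from an incomplete history, but each phase reads only
    those already settled: none in the coarse phase, [j] in the fine phase, both in the check
    phase. *)
Definition query_pattern n j i : nat -> bool :=
  let t := (n %% T)%N in
  if (t < n1)%N then coarse_pattern t
  else if (t < n1 + n2)%N then fine_pattern j (t - n1)
  else pred1 (j * M + i)%N.

Definition episode_start n := (n %/ T * T)%N.

Definition three_phase_query n (h : unit * n.-tuple Y) : set R :=
  bins N (query_pattern n (coarse_bin (episode_start n) (observed h.2))
                          (fine_bin (episode_start n) (observed h.2))).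

(** Stopping is possible at the end of an episode only, and [n - T] is where that episode began;
    [0 < n] excludes time 0, which [T] divides. *)
Definition three_phase_stop n : set (unit * n.-tuple Y) :=
  [set h | [&& (0 < n)%N, (T %| n)%N & accepted (n - T) (observed h.2)]].

Definition three_phase_estimate n (h : unit * n.-tuple Y) : R :=
  (candidate (n - T) (observed h.2))%:R / N%:R.

Let coarse_len j : (j < M1)%N -> (j * K + K <= n1)%N.
Proof. by move=> jM; rewrite addnC -mulSn leq_mul2r jM orbT. Qed.

Lemma adapted_coarse_bin o : adapted (o + n1) (coarse_bin o).
Proof.
apply: (@adapted_find _ Y _ (fun j y => L1 <= coarse_score o j y)) => j.
rewrite mem_iota/= add0n => jM; apply: adapted_ge.
apply: (@adapted_sum _ _ _ _ K (fun t y => X1 (y (o + j * K + t)%N))) => t tK.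
apply: adapted_coord => //; rewrite -addnA ltn_add2l.
by apply: leq_trans (coarse_len jM); rewrite ltn_add2l.
Qed.

Lemma adapted_fine_bin o : adapted (o + n1 + n2) (fine_bin o).
Proof.
apply: (@adapted_find _ Y _ (fun i y => L2 <= fine_score o i y)) => i _.
apply: adapted_ge.
apply: (@adapted_sum _ _ _ _ n2 (fun t y => X2 (code i t) (y (o + n1 + t)%N))) => t tn.
by apply: adapted_coord; rewrite ?ltn_add2l.
Qed.

Lemma adapted_candidate o : adapted (o + n1 + n2) (candidate o).
Proof.
apply: (@adapted_nat2 _ Y _ (coarse_bin o) (fine_bin o) _ nat (fun j i => j * M + i)%N).
  by apply: adapted_widen (adapted_coarse_bin o); exact: leq_addr.
exact: adapted_fine_bin.
Qed.

Lemma adapted_accepted o : adapted (o + T) (accepted o).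
Proof.
apply: adapted_ge; rewrite /T !addnA.
apply: (@adapted_sum _ _ _ _ n3.+1 (fun t y => X1 (y (o + n1 + n2 + t)%N))) => t tn.
by apply: adapted_coord; rewrite ?ltn_add2l.
Qed.

Lemma three_phase_query_sub n h : @three_phase_query n h `<=` `[0%R, 1%R[.
Proof. by move=> x /andP[x01 _]; rewrite /= in_itv. Qed.

Let measurable_observed_snd d' (U : measurableType d') m k (phi : (nat -> Y) -> U) :
  adapted k phi -> measurable_fun setT (fun h : unit * m.-tuple Y => phi (observed h.2)).
Proof.
move=> hphi.
apply: (@measurableT_comp _ _ _ _ _ _ (fun h : m.-tuple Y => phi (observed h))) => //.
exact: (proj2 hphi).
Qed.

(** The pair of bins found takes countably many values, and on each of them the set is a measurable
    rectangle. *)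
Lemma three_phase_query_measurable n :
  measurable [set z : (unit * n.-tuple Y) * measurableTypeR R | @three_phase_query n z.1 z.2].
Proof.
set o := episode_start n.
rewrite (_ : [set _ | _] = \bigcup_j \bigcup_i
   (((fun h : unit * n.-tuple Y => coarse_bin o (observed h.2)) @^-1` [set j] `&`
     (fun h : unit * n.-tuple Y => fine_bin o (observed h.2)) @^-1` [set i]) `*`
    (bins N (query_pattern n j i) : set R))); last first.
  apply/seteqP; split => -[h x] /=.
    by move=> hx; exists (coarse_bin o (observed h.2)) => //; exists (fine_bin o (observed h.2)).
  by move=> [j _ [i _ [/= [<- <-]]]].
apply: bigcup_measurable => j _; apply: bigcup_measurable => i _.
apply: measurableX; last exact: measurable_bins.
apply: measurableI; rewrite -[X in measurable X]setTI.
  exact: (measurable_observed_snd (adapted_coarse_bin o)).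
exact: (measurable_observed_snd (adapted_fine_bin o)).
Qed.

Lemma three_phase_stop_measurable n : measurable (@three_phase_stop n).
Proof.
have [hn|hn] := boolP ((0 < n)%N && (T %| n)%N); last first.
  rewrite (_ : @three_phase_stop n = set0)//.
  by apply/seteqP; split => // h; rewrite /three_phase_stop /= andbA (negbTE hn).
rewrite (_ : @three_phase_stop n =
    setT `&` (fun h : unit * n.-tuple Y => accepted (n - T) (observed h.2)) @^-1` [set true]).
  exact: (measurable_observed_snd (adapted_accepted (n - T))).
by rewrite setTI; apply/seteqP; rewrite /three_phase_stop; split => h; rewrite /= andbA hn.
Qed.

Lemma three_phase_estimate_measurable n : measurable_fun setT (@three_phase_estimate n).
Proof.
have := @adapted_nat _ Y _ _ _ _ (fun c => c%:R / N%:R : R) (adapted_candidate (n - T)).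
by move=> /measurable_observed_snd; apply.
Qed.

Definition three_phase_scheme : scheme Y R :=
  @Scheme _ Y R _ unit (\d_ tt) three_phase_query three_phase_stop three_phase_estimate
    three_phase_query_sub three_phase_query_measurable three_phase_stop_measurable
    three_phase_estimate_measurable.

Lemma coarse_pattern_size t : (t < n1)%N -> (\sum_(b < N) coarse_pattern t b = M)%N.
Proof.
move=> tn; rewrite (sum_ord_divn_modn _ (fun i _ => nat_of_bool (i == t %/ K)%N))//.
under eq_bigr do rewrite sum_nat_const card_ord mulnC.
rewrite sum_ord_eq; have -> : (t %/ K < M1)%N; last by rewrite mul1n.
have K0 : (0 < K)%N by rewrite lt0n; apply: contraTneq tn => K0; rewrite /n1 K0 muln0.
by rewrite ltn_divLR.
Qed.

(** Each position l is counted exactly once, in bin [j] or in the next one according to its code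
    letter; [M1 > 1] keeps these two bins distinct. *)
Lemma fine_pattern_size j t : (j < M1)%N -> (\sum_(b < N) fine_pattern j t b = M)%N.
Proof.
move=> jM; have jj : (j.+1 %% M1 != j)%N.
  have [jE|jM1] := eqVneq j.+1 M1.
    by rewrite jE modnn; apply/eqP; lia.
  by rewrite modn_small; [rewrite gtn_eqF|rewrite ltn_neqAle jM1].
have jM' : (j.+1 %% M1 < M1)%N by rewrite ltn_mod ltnW.
rewrite (sum_ord_divn_modn _ (fun i l => nat_of_bool
  ((i == j) && code l t || (i == j.+1 %% M1) && ~~ code l t)%N))//.
rewrite (eq_bigr (fun i : 'I_M1 => (i == j :> nat) * (\sum_(l < M) code l t) +
   (i == j.+1 %% M1 :> nat) * (\sum_(l < M) ~~ code l t))%N); last first.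
  move=> i _; rewrite !big_distrr -big_split/=; apply: eq_bigr => l _.
  have [->|ij] := eqVneq (i : nat) j.
    by rewrite eq_sym (negbTE jj)/= orbF mul1n mul0n addn0.
  by rewrite /= mul0n add0n mulnb.
rewrite big_split/= !sum_ord_eq jM jM' !mul1n -big_split/=.
rewrite (eq_bigr (fun=> 1%N)); first by rewrite sum_nat_const card_ord muln1.
by move=> l _; case: (code l t).
Qed.

Lemma mem_bins (w : R) f : 0 <= w < 1 -> (w \in bins N f) = f (bin N w).
Proof. by move=> w01; apply/idP/idP; rewrite inE /bins/= w01. Qed.

End three_phase_scheme.

Section adapted_bool.
Context d (Y : measurableType d).
Implicit Types a b : (nat -> Y) -> bool.

Lemma adapted_and n a b : adapted n a -> adapted n b -> adapted n (fun y => a y && b y).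
Proof. exact: (@adapted_bool2 _ Y n a b _ bool andb). Qed.

Lemma adapted_not n a : adapted n a -> adapted n (fun y => ~~ a y).
Proof. by move=> ha; exact: (@adapted_bool2 _ Y n a a _ bool (fun x _ => ~~ x) ha ha). Qed.

End adapted_bool.

(** * Union and Chernoff bounds for events of a run *)

Section run_events.
Context d (Y : measurableType d) (R : realType) (s : scheme Y R).
Context d' (Om : measurableType d') (P : probability Om R).
Variables (V : Om -> rnd s) (Yobs : nat -> Om -> Y).
Variables (mu : {sigma_finite_measure set Y -> \bar R}) (p : R -> bool -> Y -> R).
Hypothesis hp : query_channel mu p.
Variable w : R.
Hypothesis hrun : search_run V Yobs mu p w P.
Implicit Types a b : (nat -> Y) -> bool.

Lemma le_event n m a b : adapted n a -> adapted m b -> (forall y, a y -> b y) ->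
  (P (event Yobs a) <= P (event Yobs b))%E.
Proof.
move=> /(measurable_event hrun) ma /(measurable_event hrun) mb ab.
by apply: le_measure; rewrite ?inE// => om; exact: ab.
Qed.

Lemma event_split n a b : adapted n a -> adapted n b ->
  (P (event Yobs a) = P (event Yobs (fun y => a y && b y)) +
                      P (event Yobs (fun y => a y && ~~ b y)))%E.
Proof.
move=> ha hb.
rewrite -measureU; last 3 first.
- by apply: (measurable_event hrun); exact: adapted_and ha hb.
- by apply: (measurable_event hrun); exact: adapted_and ha (adapted_not hb).
- by apply/seteqP; split => // om [/= /andP[_ h] /andP[_]]; rewrite /event/= h.
congr (P _); apply/seteqP; split => om; rewrite /event/=.
  by move=> ->; case: (b _); [left|right].
by move=> [] /andP[].
Qed.

Lemma event_partition n a (f : (nat -> Y) -> nat) C : adapted n a -> adapted n f ->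
  (forall y, (f y < C)%N) ->
  (P (event Yobs a) = \sum_(c < C) P (event Yobs (fun y => a y && (f y == c))))%E.
Proof.
move=> ha hf fC; rewrite -measure_bigsetU_ord.
- congr (P _); rewrite -(bigcup_mkord C (fun c => event Yobs (fun y => a y && (f y == c)))).
  apply/seteqP; split => om; rewrite /event/=.
    by move=> aom; exists (f (Yseq Yobs om)); rewrite /= ?aom ?eqxx.
  by move=> [i _ /=] /andP[].
- move=> i; apply: (measurable_event hrun (n := n)).
  apply: adapted_and => //.
  exact: (@adapted_nat _ Y n f _ bool (fun k => k == i)).
- apply/trivIsetP => i j _ _ ij; apply/seteqP; split => // om; rewrite /event/=.
  move=> [/andP[_ /eqP fi] /andP[_ /eqP fj]].
  by move/eqP: ij; apply; apply: ord_inj; rewrite -fi -fj.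
Qed.

(** The first passing index differs from i only if test i fails or an earlier test passes. *)
Lemma event_find_error n a (q : nat -> (nat -> Y) -> bool) M i :
  (i < M)%N -> adapted n a -> (forall j, (j < M)%N -> adapted n (q j)) ->
  (P (event Yobs (fun y => a y && (find (q ^~ y) (iota 0 M) != i))) <=
   P (event Yobs (fun y => a y && ~~ q i y)) +
   \sum_(j < i) P (event Yobs (fun y => a y && q j y)))%E.
Proof.
move=> iM ha hq.
have m1 : measurable (event Yobs (fun y => a y && ~~ q i y)).
  by apply: (measurable_event hrun); apply: adapted_and ha _; apply: adapted_not; exact: hq.
have m2 (j : nat) : (j < M)%N -> measurable (event Yobs (fun y => a y && q j y)).
  by move=> jM; apply: (measurable_event hrun); apply: adapted_and ha _; exact: hq.
have m3 : measurable (event Yobs (fun y => a y && (find (q ^~ y) (iota 0 M) != i))).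
  apply: (measurable_event hrun (n := n)); apply: adapted_and => //.
  apply: (@adapted_nat _ Y n _ _ bool (fun k => k != i)).
  by apply: adapted_find => j; rewrite mem_iota/=; exact: hq.
have ji (j : nat) : (j < i)%N -> (j < M)%N by move=> h; exact: ltn_trans iM.
pose U := \big[setU/set0]_(j < i) event Yobs (fun y => a y && q j y).
have mU : measurable U by apply: bigsetU_measurable => j _; apply: m2; exact: ji.
apply: (@le_trans _ _ (P (event Yobs (fun y => a y && ~~ q i y) `|` U))).
  apply: le_measure; rewrite ?inE//; first exact: measurableU.
  move=> om; rewrite /event/= => /andP[aom hf]; apply: contrapT => H.
  move/eqP: hf; apply; apply: find_iota => //.
    by apply: contrapT => /negP h; apply: H; left; rewrite /= aom.
  move=> j jlt; apply/negP => h; apply: H; right.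
  rewrite /U -(bigcup_mkord i (fun j => event Yobs (fun y => a y && q j y))).
  by exists j => //=; rewrite /event/= aom.
apply: le_trans (measureU2 _ _ _) _ => //.
apply: leeD => //.
apply: (@le_mu_bigsetU _ _ _ P (fun j => event Yobs (fun y => a y && q j y))) => j /ji.
exact: m2.
Qed.

(** The Chernoff bound for the lower tail: [run_score_ge] for the statistic multiplied by [- sg]. *)
Lemma run_score_lt n0 a m (q : nat -> R) (b : nat -> bool) (X : nat -> Y -> R)
    (kappa : nat -> R) (L sg : R) : 0 < sg ->
  adapted n0 a -> (forall t, 0 <= q t <= 1) ->
  (forall t om, (t < m)%N -> a (Yseq Yobs om) ->
    query_size V Yobs (n0 + t) om = q t /\ (w \in query_set V Yobs (n0 + t) om) = b t) ->
  (forall t, measurable_fun setT (X t)) ->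
  (forall t, (t < m)%N ->
    (\int[mu]_y (p (q t) (b t) y * expR (- sg * X t y))%:E <= (kappa t)%:E)%E) ->
  (P (event Yobs (fun y => a y && ~~ (L <= \sum_(t < m) X t (y (n0 + t)%N)))%R) <=
   P (event Yobs a) * (expR (sg * L) * \prod_(t < m) kappa t)%:E)%E.
Proof.
move=> sg0 ha q01 hqb mX hk.
have mX' t : measurable_fun setT (fun y => - sg * X t y).
  by apply: measurable_funM => //; exact: measurable_cst.
have := @run_score_ge _ _ _ _ _ _ _ _ _ _ _ hp _ hrun n0 a m q b (fun t y => - sg * X t y)
  kappa (- (sg * L)) ha q01 hqb mX' hk.
rewrite opprK; apply: le_trans.
have hS (Z : nat -> Y -> R) : (forall t, measurable_fun setT (Z t)) ->
    adapted (n0 + m) (fun y : nat -> Y => \sum_(t < m) Z t (y (n0 + t)%N)).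
  move=> mZ; apply: (@adapted_sum _ _ _ _ m (fun t y => Z t (y (n0 + t)%N))) => t tm.
  by apply: adapted_coord; rewrite ?ltn_add2l.
have ha' : adapted (n0 + m) a by apply: adapted_widen ha; exact: leq_addr.
apply: (@le_event (n0 + m) (n0 + m)).
- by apply: adapted_and => //; apply: adapted_not; apply: adapted_ge; exact: hS.
- by apply: adapted_and => //; apply: adapted_ge; exact: (hS _ mX').
- move=> y /andP[-> /=]; rewrite -ltNge => h.
  by rewrite -mulr_sumr -mulNr; apply: ler_wnM2l; [rewrite oppr_le0 ltW|exact: ltW].
Qed.

End run_events.

(** * Error probabilities within one episode, relative to its past *)

Section episode.
Context d (Y : measurableType d) (R : realType).
Variables (mu : {sigma_finite_measure set Y -> \bar R}) (p : R -> bool -> Y -> R).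
Hypothesis hp : query_channel mu p.
Variables (M1 M K n2 n3 : nat) (X1 : Y -> R) (X2 : bool -> Y -> R) (L1 L2 L3 : R).
Variable code : nat -> nat -> bool.
Hypotheses (mX1 : measurable_fun setT X1) (mX2 : forall x, measurable_fun setT (X2 x)).
Hypotheses (M1_gt1 : (1 < M1)%N) (M0 : (0 < M)%N).

Let s := three_phase_scheme K n2 n3 L1 L2 L3 code mX1 mX2 M1_gt1 M0.

Context d' (Om : measurableType d') (P : probability Om R).
Variables (V : Om -> rnd s) (Yobs : nat -> Om -> Y) (w : R).
Hypothesis w01 : 0 <= w < 1.
Hypothesis hrun : search_run V Yobs mu p w P.

Variables (a0 s1 s2 rho1 e1 e2 e3 : R) (r : bool -> R) (t : bool -> bool -> R).
Hypotheses (a01 : 0 < a0 <= 1) (ha0 : M1%:R^-1 <= a0) (s10 : 0 < s1) (s20 : 0 < s2).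
Hypothesis H1 : forall q, 0 <= q <= a0 ->
    (\int[mu]_y (p q false y * expR (X1 y))%:E <= 1)%E /\
    (\int[mu]_y (p q true y * expR (- s1 * X1 y))%:E <= rho1%:E)%E.
Hypothesis H2 : forall q, 0 <= q <= a0 -> forall x,
    (\int[mu]_y (p q x y * expR (- s2 * X2 x y))%:E <= (r x)%:E)%E /\
    forall x', (\int[mu]_y (p q x y * expR (X2 x' y))%:E <= (t x x')%:E)%E.
Hypothesis h1 : expR (s1 * L1) * rho1 ^+ K + expR (- L1) * M1%:R <= e1.
Hypothesis h2 : forall i, (i < M)%N ->
    expR (s2 * L2) * \prod_(u < n2) r (code i u) +
    expR (- L2) * (\sum_(j < i) \prod_(u < n2) t (code i u) (code j u)) <= e2.
Hypotheses (e10 : 0 <= e1) (e20 : 0 <= e2) (e30 : 0 <= e3).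
Hypothesis h3 : expR (s1 * L3) * rho1 ^+ n3.+1 <= e3.

Let N := (M1 * M)%N.
Let N0 : (0 < N)%N. Proof. by rewrite muln_gt0 M0 (ltnW M1_gt1). Qed.
Let n1 := (M1 * K)%N.
Let T := episode_length M1 K n2 n3.
Let b0 := bin N w.
Let i1 := (b0 %/ M)%N.
Let i2 := (b0 %% M)%N.
Let coarse := coarse_bin M1 K X1 L1.
Let fine := fine_bin M1 M K n2 X2 L2 code.
Let cand := candidate M1 M K n2 X1 X2 L1 L2 code.
Let acc := accepted M1 K n2 n3 X1 L3.
Local Notation Pe a := (P (event Yobs a)).

Let b0N : (b0 < N)%N. Proof. exact: bin_lt. Qed.
Let i1M : (i1 < M1)%N. Proof. by rewrite /i1 ltn_divLR. Qed.
Let i2M : (i2 < M)%N. Proof. by rewrite ltn_mod. Qed.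

Let n1T : (n1 + n2 + n3.+1)%N = T. Proof. by []. Qed.
Let T0 : (0 < T)%N. Proof. by rewrite -n1T addnS. Qed.

Let T_mod k u : (u < T)%N -> ((k * T + u) %% T)%N = u.
Proof. by move=> uT; rewrite modnMDl modn_small. Qed.

Let T_start k u : (u < T)%N -> episode_start M1 K n2 n3 (k * T + u) = (k * T)%N.
Proof. by move=> uT; rewrite /episode_start -/T divnMDl// divn_small// addn0. Qed.

Let querysetE n om : query_set V Yobs n om =
  bins N (query_pattern M1 M K n2 n3 code n
    (coarse (episode_start M1 K n2 n3 n) (observed (history V Yobs n om).2))
    (fine (episode_start M1 K n2 n3 n) (observed (history V Yobs n om).2))).
Proof. by []. Qed.

Let query_size_bins n om f : query_set V Yobs n om = bins N f ->
  query_size V Yobs n om = (\sum_(b < N) f b)%:R / N%:R.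
Proof. by move=> E; rewrite /query_size E lebesgue_measure_bins. Qed.

Let query_coarse k u om : (u < n1)%N ->
  query_set V Yobs (k * T + u) om = bins N (coarse_pattern M K u).
Proof.
move=> un; have uT : (u < T)%N by rewrite -n1T; move: un; clear; lia.
by rewrite querysetE /query_pattern T_mod// -/n1 un.
Qed.

Let hcoarse o : adapted (o + n1) (coarse o). Proof. exact: adapted_coarse_bin. Qed.
Let hfine o : adapted (o + n1 + n2) (fine o). Proof. exact: adapted_fine_bin. Qed.
Let hcand o : adapted (o + n1 + n2) (cand o). Proof. exact: adapted_candidate. Qed.
Let hacc o : adapted (o + T) (acc o). Proof. exact: adapted_accepted. Qed.

Let query_fine k u om : (u < n2)%N -> query_set V Yobs (k * T + n1 + u) om =
  bins N (fine_pattern M1 M code (coarse (k * T) (Yseq Yobs om)) u).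
Proof.
move=> un; have uT : (n1 + u < T)%N by rewrite -n1T; move: un; clear; lia.
rewrite querysetE /query_pattern -addnA T_mod// T_start// -/n1 ltnNge leq_addr/=.
rewrite ltn_add2l un addKn.
have ha : adapted (k * T + (n1 + u)) (coarse (k * T)).
  by apply: adapted_widen (hcoarse (k * T)); rewrite addnA leq_addr.
by rewrite (adapted_history V Yobs om ha).
Qed.

Let query_check k u om : (u < n3.+1)%N -> query_set V Yobs (k * T + n1 + n2 + u) om =
  bins N (pred1 (cand (k * T) (Yseq Yobs om))).
Proof.
move=> un; have uT : (n1 + n2 + u < T)%N by rewrite -n1T; move: un; clear; lia.
rewrite querysetE /query_pattern -!addnA [(n1 + (n2 + u))%N]addnA T_mod// T_start//.
rewrite -/n1 ltnNge -addnA leq_addr/= [X in (X < _)%N]addnA ltnNge leq_addr/=.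
have ha1 : adapted (k * T + (n1 + (n2 + u))) (coarse (k * T)).
  by apply: adapted_widen (hcoarse (k * T)); clear; lia.
have ha2 : adapted (k * T + (n1 + (n2 + u))) (fine (k * T)).
  by apply: adapted_widen (hfine (k * T)); clear; lia.
by rewrite (adapted_history V Yobs om ha1) (adapted_history V Yobs om ha2).
Qed.

Let qc : R := M%:R / N%:R.
Let qf : R := N%:R^-1.
Let a01' : a0 <= 1. Proof. by case/andP: a01. Qed.

Let qcE : qc = M1%:R^-1.
Proof.
rewrite /qc /N natrM invfM mulrCA divff ?mulr1//.
by rewrite pnatr_eq0 -lt0n.
Qed.

Let qc_a0 : 0 <= qc <= a0. Proof. by rewrite qcE ha0 andbT invr_ge0. Qed.
Let qf_a0 : 0 <= qf <= a0.
Proof.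
rewrite invr_ge0 ler0n/=; apply: le_trans ha0.
rewrite lef_pV2 ?posrE ?ltr0n//; last exact: ltnW.
by rewrite ler_nat leq_pmulr.
Qed.
Let zero_a0 : 0 <= (0 : R) <= a0. Proof. by rewrite lexx ltW//; case/andP: a01. Qed.
Let a0_01 q : 0 <= q <= a0 -> 0 <= q <= 1.
Proof. by case/andP => -> /le_trans; apply. Qed.

Let Pfin n a : adapted n a -> Pe a \is a fin_num.
Proof. by move=> ha; apply: fin_num_measure; exact: (measurable_event hrun ha). Qed.

(** The bin of the target is missed, or one of the fewer than [M1] bins before it raises a false
    alarm; [h1] collects both contributions. *)
Lemma coarse_error k (a : (nat -> Y) -> bool) : adapted (k * T) a ->
  (Pe (fun y => a y && (coarse (k * T) y != i1)) <= Pe a * e1%:E)%E.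
Proof.
move=> ha.
have had j : (j < M1)%N -> adapted (k * T + n1) (fun y => L1 <= coarse_score K X1 (k * T) j y).
  move=> jM; apply: adapted_ge.
  apply: (@adapted_sum _ _ _ _ K (fun u y => X1 (y (k * T + j * K + u)%N))) => u uK.
  apply: adapted_coord => //; rewrite -addnA ltn_add2l /n1.
  by apply: (@leq_trans (j.+1 * K)); [rewrite mulSn addnC ltn_add2r|rewrite leq_mul2r jM orbT].
have ha1 : adapted (k * T + n1) a by apply: adapted_widen ha; exact: leq_addr.
apply: le_trans (event_find_error hrun i1M ha1 had) _.
have qb j u om : (j < M1)%N -> (u < K)%N -> a (Yseq Yobs om) ->
    query_size V Yobs (k * T + j * K + u) om = qc /\
    (w \in query_set V Yobs (k * T + j * K + u) om) = (i1 == j).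
  move=> jM uK _; have un : (j * K + u < n1)%N.
    by apply: (@leq_trans (j.+1 * K)); [rewrite mulSn addnC ltn_add2r|rewrite leq_mul2r jM orbT].
  have E := query_coarse k om un; rewrite -addnA; split.
    by rewrite (query_size_bins E) coarse_pattern_size.
  rewrite E mem_bins// /coarse_pattern -/N -/b0 -/i1.
  have K0 : (0 < K)%N by apply: leq_trans uK.
  by rewrite divnMDl// divn_small// addn0.
have haj j : adapted (k * T + j * K) a by apply: adapted_widen ha; exact: leq_addr.
have lo : (Pe (fun y => a y && ~~ (L1 <= coarse_score K X1 (k * T) i1 y)%R) <=
    Pe a * (expR (s1 * L1) * rho1 ^+ K)%:E)%E.
  have := @run_score_lt _ _ _ _ _ _ _ _ _ _ _ hp _ hrun (k * T + i1 * K) a K (fun=> qc)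
    (fun=> true) (fun=> X1) (fun=> rho1) L1 s1 s10 (haj i1) (fun=> a0_01 qc_a0) _ (fun=> mX1)
    (fun _ _ => (H1 qc_a0).2).
  rewrite prodr_const card_ord; apply => u om uK aom.
  by have [-> ->] := qb _ _ _ i1M uK aom; rewrite eqxx.
have hi j : (j < i1)%N -> (Pe (fun y => a y && (L1 <= coarse_score K X1 (k * T) j y)%R) <=
    Pe a * (expR (- L1))%:E)%E.
  move=> ji; have := @run_score_ge _ _ _ _ _ _ _ _ _ _ _ hp _ hrun (k * T + j * K) a K (fun=> qc)
    (fun=> false) (fun=> X1) (fun=> 1) L1 (haj j) (fun=> a0_01 qc_a0) _ (fun=> mX1)
    (fun _ _ => (H1 qc_a0).1).
  rewrite big1_eq mulr1; apply => u om uK aom.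
  have [-> ->] := qb _ _ _ (ltn_trans ji i1M) uK aom; split => //.
  by rewrite gtn_eqF.
have Pa := Pfin ha.
apply: (@le_trans _ _ (Pe a * (expR (s1 * L1) * rho1 ^+ K)%:E +
   \sum_(j < i1) (Pe a * (expR (- L1))%:E))%E).
  by apply: leeD => //; apply: lee_sum => j _; exact: hi.
rewrite -(fineK Pa) -!EFinM sumEFin -EFinD lee_fin sumr_const card_ord -mulr_natr -mulrA -mulrDr.
rewrite ler_wpM2l ?fine_ge0//; apply: le_trans h1.
by rewrite lerD2l ler_wpM2l ?expR_ge0// ler_nat ltnW.
Qed.

(** Once the coarse bin is right, the padding lies in a different coarse bin and cannot contain the
    target, so the answers spell codeword [i2] on a channel of constant query size. *)
Lemma fine_error k (a : (nat -> Y) -> bool) : adapted (k * T + n1) a ->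
  (forall y, a y -> coarse (k * T) y = i1) ->
  (Pe (fun y => a y && (fine (k * T) y != i2)) <= Pe a * e2%:E)%E.
Proof.
move=> ha hi1; pose o := (k * T)%N.
have had i : (i < M)%N -> adapted (o + n1 + n2) (fun y => L2 <= fine_score M1 K n2 X2 code o i y).
  move=> _; apply: adapted_ge.
  apply: (@adapted_sum _ _ _ _ n2 (fun u y => X2 (code i u) (y (o + n1 + u)%N))) => u un.
  by apply: adapted_coord; rewrite ?ltn_add2l.
have ha1 : adapted (o + n1 + n2) a by apply: adapted_widen ha; exact: leq_addr.
apply: le_trans (event_find_error hrun i2M ha1 had) _.
have qb u om : (u < n2)%N -> a (Yseq Yobs om) ->
    query_size V Yobs (o + n1 + u) om = qc /\
    (w \in query_set V Yobs (o + n1 + u) om) = code i2 u.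
  move=> un aom; have E := query_fine k om un; rewrite (hi1 _ aom) in E; split.
    by rewrite (query_size_bins E) fine_pattern_size.
  rewrite E mem_bins// /fine_pattern -/N -/b0 -/i1 -/i2 eqxx/=.
  have -> : (i1 == i1.+1 %% M1)%N = false.
    apply/negbTE; have [jE|jM1] := eqVneq i1.+1 M1.
      by rewrite jE modnn; apply/eqP; move: M1_gt1 jE; clear; lia.
    by rewrite modn_small ?(ltn_eqF (ltnSn _))// ltn_neqAle jM1.
  by rewrite orbF.
have lo : (Pe (fun y => a y && ~~ (L2 <= fine_score M1 K n2 X2 code o i2 y)%R) <=
    Pe a * (expR (s2 * L2) * \prod_(u < n2) r (code i2 u))%:E)%E.
  exact: (@run_score_lt _ _ _ _ _ _ _ _ _ _ _ hp _ hrun (o + n1) a n2 (fun=> qc)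
    (code i2) (fun u => X2 (code i2 u)) (fun u => r (code i2 u)) L2 s2 s20 ha
    (fun=> a0_01 qc_a0) qb (fun u => mX2 (code i2 u)) (fun u _ => (H2 qc_a0 (code i2 u)).1)).
have hi i : (Pe (fun y => a y && (L2 <= fine_score M1 K n2 X2 code o i y)%R) <=
    Pe a * (expR (- L2) * \prod_(u < n2) t (code i2 u) (code i u))%:E)%E.
  exact: (@run_score_ge _ _ _ _ _ _ _ _ _ _ _ hp _ hrun (o + n1) a n2 (fun=> qc)
    (code i2) (fun u => X2 (code i u)) (fun u => t (code i2 u) (code i u)) L2 ha
    (fun=> a0_01 qc_a0) qb (fun u => mX2 (code i u))
    (fun u _ => (H2 qc_a0 (code i2 u)).2 (code i u))).
have Pa := Pfin ha.
apply: (@le_trans _ _ (Pe a * (expR (s2 * L2) * \prod_(u < n2) r (code i2 u))%:E +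
   \sum_(j < i2) (Pe a * (expR (- L2) * \prod_(u < n2) t (code i2 u) (code j u))%:E))%E).
  by apply: leeD => //; apply: lee_sum => j _; exact: hi.
rewrite -(fineK Pa) -!EFinM.
under [X in (_ + X)%E]eq_bigr do rewrite -EFinM.
rewrite sumEFin -EFinD lee_fin -mulr_sumr -mulrDr -mulr_sumr.
by rewrite ler_wpM2l ?fine_ge0// h2.
Qed.

Lemma check_error k (a : (nat -> Y) -> bool) : adapted (k * T + n1 + n2) a ->
  (forall y, a y -> cand (k * T) y = b0) ->
  (Pe (fun y => a y && ~~ acc (k * T) y) <= Pe a * e3%:E)%E.
Proof.
move=> ha hb0.
have := @run_score_lt _ _ _ _ _ _ _ _ _ _ _ hp _ hrun (k * T + n1 + n2) a n3.+1 (fun=> qf)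
    (fun=> true) (fun=> X1) (fun=> rho1) L3 s1 s10 ha (fun=> a0_01 qf_a0) _ (fun=> mX1)
    (fun _ _ => (H1 qf_a0).2).
rewrite prodr_const card_ord => /(_ _)/wrap[]; last first.
  by move=> /le_trans; apply; rewrite lee_wpmul2l// lee_fin.
move=> u om un aom; have E := query_check k om un; rewrite (hb0 _ aom) in E.
rewrite (query_size_bins E) E mem_bins// -/N -/b0 /= eqxx; split => //.
rewrite /= (eq_bigr (fun b : 'I_N => (b == b0 :> nat) * 1)%N); last by move=> b _; rewrite muln1.
by rewrite sum_ord_eq b0N mul1r.
Qed.

(** All check queries miss the target, so the score is a sum of statistics under the false-alarm
    law, whose exponential moment is at most 1. *)
Lemma wrong_accept_at k (a : (nat -> Y) -> bool) c : adapted (k * T + n1 + n2) a -> c != b0 ->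
  (forall y, a y -> cand (k * T) y = c) ->
  (Pe (fun y => a y && acc (k * T) y) <= Pe a * (expR (- L3))%:E)%E.
Proof.
(* A candidate beyond the last bin gives an empty query, of size 0. *)
move=> ha cb0 hc; pose q : R := (c < N)%N%:R / N%:R.
have q0 : 0 <= q <= a0.
  by rewrite /q; case: (c < N)%N; rewrite ?mul1r// mul0r.
have := @run_score_ge _ _ _ _ _ _ _ _ _ _ _ hp _ hrun (k * T + n1 + n2) a n3.+1 (fun=> q)
    (fun=> false) (fun=> X1) (fun=> 1) L3 ha (fun=> a0_01 q0) _ (fun=> mX1)
    (fun _ _ => (H1 q0).1).
rewrite big1_eq mulr1; apply.
move=> u om un aom; have E := query_check k om un; rewrite (hc _ aom) in E.
rewrite (query_size_bins E) E mem_bins// -/N -/b0 /= eq_sym (negbTE cb0); split => //.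
rewrite /= (eq_bigr (fun b : 'I_N => (b == c :> nat) * 1)%N); last by move=> b _; rewrite muln1.
by rewrite sum_ord_eq muln1.
Qed.

(** The events that the candidate equals c are disjoint and precede the check phase, so summing over
    c reproduces the probability of [a], with no factor for the number of bins. *)
Lemma wrong_accept k (a : (nat -> Y) -> bool) : adapted (k * T) a ->
  (Pe (fun y => a y && acc (k * T) y && (cand (k * T) y != b0)) <= Pe a * (expR (- L3))%:E)%E.
Proof.
move=> ha; pose C := (N + M).+1.
have candC y : (cand (k * T) y < C)%N.
  rewrite /cand /candidate /C ltnS leq_add//.
    by rewrite leq_mul2r /coarse_bin -[X in (_ <= X)%N](size_iota 0) find_size orbT.
  by rewrite /fine_bin -[X in (_ <= X)%N](size_iota 0) find_size.
have ha2 : adapted (k * T + n1 + n2) a by apply: adapted_widen ha; clear; lia.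
have hcT : adapted (k * T + T) (cand (k * T)).
  by apply: adapted_widen (hcand (k * T)); rewrite -n1T; clear; lia.
have haT : adapted (k * T + T) a by apply: adapted_widen ha; exact: leq_addr.
have hne : adapted (k * T + T) (fun y => cand (k * T) y != b0).
  exact: (@adapted_nat _ Y _ (cand (k * T)) _ bool (fun i => i != b0)).
have hbad : adapted (k * T + T) (fun y => a y && acc (k * T) y && (cand (k * T) y != b0)).
  by apply: adapted_and => //; apply: adapted_and => //; exact: hacc.
rewrite (event_partition hrun hbad hcT candC).
have Pa := Pfin ha.
rewrite (event_partition hrun ha2 (hcand (k * T)) candC) ge0_sume_distrl; last by [].
apply: lee_sum => c _.
have hac : adapted (k * T + n1 + n2) (fun y => a y && (cand (k * T) y == c)).
  apply: adapted_and => //.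
  exact: (@adapted_nat _ Y _ (cand (k * T)) _ bool (fun i => i == c)).
have [cb0|cb0] := eqVneq (c : nat) b0.
  apply: (@le_trans _ _ 0%E); last by rewrite mule_ge0// lee_fin expR_ge0.
  rewrite (_ : event _ _ = set0) ?measure0//.
  apply/seteqP; split => // om; rewrite /event/= => /andP[/andP[_ h] /eqP h'].
  by move: h; rewrite h' cb0 eqxx.
apply: le_trans (wrong_accept_at hac cb0 _); last by move=> y /andP[_ /eqP].
apply: (le_event hrun (n := k * T + T) (m := k * T + T)).
- apply: adapted_and => //.
  exact: (@adapted_nat _ Y _ (cand (k * T)) _ bool (fun i => i == c)).
- apply: adapted_and; last exact: hacc.
  by apply: adapted_widen hac; rewrite -n1T; clear; lia.
- by move=> y /andP[/andP[/andP[-> ->] _] ->].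
Qed.

(** A rejection comes from a wrong coarse bin, a wrong fine bin inside the right coarse bin, or a
    failed check of the right bin. All bounds are relative to the past event [a], which makes them
    multiply over episodes. *)
Lemma reject_probability k (a : (nat -> Y) -> bool) : adapted (k * T) a ->
  (Pe (fun y => a y && ~~ acc (k * T) y) <= Pe a * (e1 + e2 + e3)%:E)%E.
Proof.
move=> ha; have o1 : (k * T + n1 <= k * T + n1 + n2)%N by exact: leq_addr.
have o2 : (k * T + n1 + n2 <= k * T + T)%N by rewrite -n1T; clear; lia.
have haT : adapted (k * T + T) a by apply: adapted_widen ha; exact: leq_addr.
have ha1 : adapted (k * T + n1) a by apply: adapted_widen ha; exact: leq_addr.
have hc1 : adapted (k * T + n1) (fun y => coarse (k * T) y == i1).
  exact: (@adapted_nat _ Y _ (coarse (k * T)) _ bool (fun i => i == i1)).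
have hf2 : adapted (k * T + n1 + n2) (fun y => fine (k * T) y == i2).
  exact: (@adapted_nat _ Y _ (fine (k * T)) _ bool (fun i => i == i2)).
have hcT : adapted (k * T + T) (fun y => coarse (k * T) y == i1).
  by apply: adapted_widen hc1; exact: (leq_trans o1).
have hfT : adapted (k * T + T) (fun y => fine (k * T) y == i2).
  by apply: adapted_widen hf2.
have hr : adapted (k * T + T) (fun y => a y && ~~ acc (k * T) y).
  by apply: adapted_and => //; apply: adapted_not; exact: hacc.
pose a2 y := a y && (coarse (k * T) y == i1).
pose a3 y := a2 y && (fine (k * T) y == i2).
have ha2 : adapted (k * T + n1) a2 by exact: adapted_and.
have ha3 : adapted (k * T + n1 + n2) a3.
  by apply: adapted_and => //; apply: adapted_widen ha2.
have ha2T : adapted (k * T + T) a2 by exact: adapted_and.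
have ha3T : adapted (k * T + T) a3 by exact: adapted_and.
have le1 : (Pe a2 <= Pe a)%E by apply: (le_event hrun ha2 ha) => y /andP[].
have le2 : (Pe a3 <= Pe a)%E by apply: (le_event hrun ha3 ha) => y /andP[/andP[]].
have E1 := coarse_error ha.
have E2 := @fine_error k a2 ha2 (fun y h => eqP (andP h).2).
have E3 : (Pe (fun y => a3 y && ~~ acc (k * T) y) <= Pe a3 * e3%:E)%E.
  apply: check_error => // y /andP[/andP[_ /eqP h] /eqP h'].
  by rewrite /cand /candidate -/(coarse (k * T) y) -/(fine (k * T) y) h h' /i1 /i2 -divn_eq.
rewrite (event_split hrun hr hcT) addeC -addrA EFinD ge0_muleDr ?lee_fin ?addr_ge0//.
apply: leeD.
  apply: le_trans E1; apply: (le_event hrun (n := k * T + T) (m := k * T + T)).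
  - by apply: adapted_and => //; exact: adapted_not.
  - by apply: adapted_and => //; exact: adapted_not.
  - by move=> y /andP[/andP[-> _] ->].
have hrc := adapted_and hr hcT.
rewrite (event_split hrun hrc hfT) addeC EFinD ge0_muleDr ?lee_fin//.
apply: leeD.
  apply: (@le_trans _ _ (Pe a2 * e2%:E)%E); last by rewrite lee_wpmul2r// lee_fin.
  apply: le_trans E2; apply: (le_event hrun (n := k * T + T) (m := k * T + T)).
  - by apply: adapted_and => //; exact: adapted_not.
  - by apply: adapted_and => //; exact: adapted_not.
  - by move=> y /andP[/andP[/andP[h _] h'] h'']; rewrite /a2 h h'.
apply: (@le_trans _ _ (Pe a3 * e3%:E)%E); last by rewrite lee_wpmul2r// lee_fin.
apply: le_trans E3; apply: (le_event hrun (n := k * T + T) (m := k * T + T)).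
- by apply: adapted_and.
- by apply: adapted_and => //; apply: adapted_not; exact: hacc.
- by move=> y /andP[/andP[/andP[h h3'] h'] h'']; rewrite /a3 /a2 h h' h'' h3'.
Qed.

End episode.

(** * Repeating an episode until acceptance *)

Lemma geometric_nneseries_le (R : realType) (a x : R) : 0 <= a -> 0 < x < 1 ->
  (\sum_(0 <= k <oo) (a * x ^+ k)%:E <= (a / (1 - x))%:E)%E.
Proof.
move=> a0 /andP[x0 x1]; apply: lime_le.
  by apply: is_cvg_nneseries => n _ _; rewrite lee_fin mulr_ge0// exprn_ge0// ltW.
apply: nearW => n; rewrite sumEFin lee_fin.
by apply: (@geometric_le_lim R n a x) => //; rewrite gtr0_norm.
Qed.

Section renewal.
Context d (Y : measurableType d) (R : realType) (s : scheme Y R).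
Context d' (Om : measurableType d') (P : probability Om R).
Variables (V : Om -> rnd s) (Yobs : nat -> Om -> Y).
Variables (mu : {sigma_finite_measure set Y -> \bar R}) (p : R -> bool -> Y -> R).
Variable w : R.
Hypothesis hrun : search_run V Yobs mu p w P.
Variables (T : nat) (acc : nat -> (nat -> Y) -> bool) (est : nat -> (nat -> Y) -> R).
Hypothesis T0 : (0 < T)%N.
Hypothesis hacc : forall k, adapted (k.+1 * T) (acc k).
Hypothesis hest : forall k, adapted (k.+1 * T) (est k).
Hypothesis stopE : forall n om, stop (history V Yobs n om) <->
  exists2 k, n = (k.+1 * T)%N & acc k (Yseq Yobs om).
Hypothesis estE : forall k om,
  estimate (history V Yobs (k.+1 * T) om) = est k (Yseq Yobs om).
Variables (nu kappa delta : R).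
Hypotheses (nu01 : 0 < nu < 1) (kappa0 : 0 <= kappa).
Local Notation Pe a := (P (event Yobs a)).
Let good k (y : nat -> Y) := `|est k y - w| <= delta.
Hypothesis reject_le : forall k (a : (nat -> Y) -> bool), adapted (k * T) a ->
  (Pe (fun y => a y && ~~ acc k y) <= Pe a * nu%:E)%E.
Hypothesis wrong_le : forall k (a : (nat -> Y) -> bool), adapted (k * T) a ->
  (Pe (fun y => a y && acc k y && ~~ good k y) <= Pe a * kappa%:E)%E.

Fixpoint unaccepted k (y : nat -> Y) : bool :=
  if k is k'.+1 then unaccepted k' y && ~~ acc k' y else true.

Lemma adapted_unaccepted k : adapted (k * T) (unaccepted k).
Proof.
elim: k => [|k IH]; first exact: adapted_cst.
apply: adapted_and; last by apply: adapted_not; exact: hacc.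
by apply: adapted_widen IH; rewrite mulSn leq_addl.
Qed.

Lemma unaccepted_le k j y : (j <= k)%N -> unaccepted k y -> unaccepted j y.
Proof.
elim: k => [|k IH]; first by rewrite leqn0 => /eqP ->.
by rewrite leq_eqVlt => /predU1P[->//|jk] /= /andP[h _]; exact: IH.
Qed.

Lemma unaccepted_acc k j y : (j < k)%N -> unaccepted k y -> ~~ acc j y.
Proof. by move=> jk /(unaccepted_le jk) /= /andP[]. Qed.

Lemma first_accepted y : (exists k, unaccepted k y && acc k y) \/ (forall k, unaccepted k y).
Proof.
have [[k hk]|H] := pselect (exists k, ~~ unaccepted k y); last first.
  by right => k; apply: contrapT => /negP h; apply: H; exists k.
left; elim: k hk => [//|k IH] /=; rewrite negb_and negbK => /orP[/IH//|ak].
by case: (boolP (unaccepted k y)) => [uk|/IH//]; exists k; rewrite uk.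
Qed.

Lemma unaccepted_probability k : (Pe (unaccepted k) <= (nu ^+ k)%:E)%E.
Proof.
elim: k => [|k IH].
  by rewrite expr0; apply: probability_le1; exact: (measurable_event hrun (adapted_unaccepted 0)).
apply: le_trans (reject_le (adapted_unaccepted k)) _.
by rewrite exprSr EFinM lee_wpmul2r// lee_fin ltW//; case/andP: nu01.
Qed.

(** [stop] may hold again after later episodes; the infimum selects the first accepted one. *)
Lemma stopping_time_accepted k om : unaccepted k (Yseq Yobs om) -> acc k (Yseq Yobs om) ->
  stopping_time V Yobs om = (k.+1 * T)%N%:R%:E.
Proof.
move=> uk ak; apply/eqP; rewrite eq_le; apply/andP; split.
  apply: ereal_inf_lbound; exists (k.+1 * T)%N => //=.
  by apply/stopE; exists k.
apply: le_ereal_inf_tmp => _ [n /= /stopE[j -> aj] <-].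
rewrite lee_fin ler_nat leq_mul2r ltnS; apply/orP; right.
by rewrite leqNgt; apply/negP => /unaccepted_acc/(_ uk); rewrite aj.
Qed.

Lemma stopping_time_unaccepted om : (forall k, unaccepted k (Yseq Yobs om)) ->
  stopping_time V Yobs om = +oo%E.
Proof.
move=> u; rewrite /stopping_time (_ : [set n%:R%:E | n in _] = set0) ?ereal_inf0//.
apply/seteqP; split => // _ [n /= /stopE[j _ aj] _].
by have := unaccepted_acc (ltnSn j) (u j.+1); rewrite aj.
Qed.

(** Tail-sum form: [T] is paid for each episode that is started, and episode k is started exactly
    when all previous ones are rejected. The identity also covers the runs that never stop. *)
Lemma stopping_time_series om : stopping_time V Yobs om =
  (\sum_(0 <= k <oo) (T%:R * (unaccepted k (Yseq Yobs om))%:R)%:E)%E.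
Proof.
set y := Yseq Yobs om.
have [[k /andP[uk ak]]|u] := first_accepted y.
  rewrite (stopping_time_accepted uk ak); apply/esym/cvg_lim => //.
  apply: cvg_near_cst; near=> n.
  have kn : (k < n)%N by near: n; exact: nbhs_infty_gt.
  rewrite sumEFin; congr EFin; rewrite -mulr_sumr mulnC natrM; congr (_ * _).
  rewrite -natr_sum; congr (_%:R); rewrite (big_cat_nat (n := k.+1))//=.
  rewrite [X in (_ + X)%N]big_nat_cond [X in (_ + X)%N]big1 ?addn0; last first.
    move=> i /andP[/andP[ki _] _]; apply/eqP; rewrite eqb0; apply/negP => ui.
    by have := unaccepted_acc ki ui; rewrite ak.
  rewrite big_nat_cond (eq_bigr (fun=> 1%N)).
    by rewrite -big_nat_cond sum_nat_const_nat subn0 muln1.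
  by move=> i /andP[/andP[_ ik] _]; rewrite (unaccepted_le _ uk).
rewrite (stopping_time_unaccepted u); apply/esym/cvg_lim => //.
under eq_fun do rewrite sumEFin.
apply/cvgeryP; apply/cvgryPge => A; near=> n.
rewrite big_mkord (eq_bigr (fun=> T%:R)); last by move=> k _; rewrite u mulr1.
rewrite sumr_const card_ord -[T%:R *+ n]mulr_natr.
have : A <= n%:R by near: n; exact: nbhs_infty_ger.
by move=> /le_trans; apply; apply: ler_peMl => //; rewrite ler1n.
Unshelve. all: by end_near. Qed.

Let unaccepted_indic k : (fun om => (unaccepted k (Yseq Yobs om))%:R) =
  \1_(event Yobs (unaccepted k)) :> (Om -> R).
Proof. by apply/funext => om; rewrite indicE mem_setE. Qed.

Let measurable_unaccepted_natr k :
  measurable_fun setT (fun om => (unaccepted k (Yseq Yobs om))%:R : R).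
Proof.
rewrite unaccepted_indic; apply: measurable_indic.
exact: (measurable_event hrun (adapted_unaccepted k)).
Qed.

(** The series is integrated term by term, and the probabilities that episode k starts are dominated
    by a geometric sequence. *)
Lemma expected_stopping_time_le :
  (\int[P]_om stopping_time V Yobs om <= (T%:R / (1 - nu))%:E)%E.
Proof.
under eq_integral do rewrite stopping_time_series.
rewrite integral_nneseries//; last first.
  by move=> k; apply/measurable_EFinP; apply: measurable_funM => //; exact: measurable_cst.
apply: le_trans (geometric_nneseries_le (ler0n R T) nu01).
apply: lee_nneseries => k _.
  by move=> _; apply: integral_ge0 => om _; rewrite lee_fin mulr_ge0.
under eq_integral do rewrite EFinM.
rewrite ge0_integralZl_EFin//; last first.
  exact/measurable_EFinP.
rewrite (integral_event hrun (adapted_unaccepted k)) EFinM lee_wpmul2l//.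
exact: unaccepted_probability.
Qed.

Let hit k y := unaccepted k y && acc k y.

Let hgood k : adapted (k.+1 * T) (good k).
Proof.
have [h1 h2] := hest k; split => [y y' h|m]; first by rewrite /good (h1 _ _ h).
apply: measurable_fun_ler; last exact: measurable_cst.
apply: measurableT_comp; first exact: normr_measurable.
by apply: measurable_funB; [exact: h2|exact: measurable_cst].
Qed.

Let hhit k : adapted (k.+1 * T) (hit k).
Proof.
apply: adapted_and; last exact: hacc.
by apply: adapted_widen (adapted_unaccepted k); rewrite mulSn leq_addl.
Qed.

Let locatedE : located V Yobs delta w = \bigcup_k event Yobs (fun y => hit k y && good k y).
Proof.
apply/seteqP; split => om.
  move=> [n tE hn]; have [[k /andP[uk ak]]|u] := first_accepted (Yseq Yobs om); last first.
    by move: tE; rewrite stopping_time_unaccepted.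
  exists k => //; rewrite /event/= /hit uk ak /= /good -estE.
  move: tE; rewrite (stopping_time_accepted uk ak) => -[] /eqP; rewrite eqr_nat => /eqP nE.
  by rewrite nE.
move=> [k _]; rewrite /event/= => /andP[/andP[uk ak] gk].
exists (k.+1 * T)%N; first exact: stopping_time_accepted.
by rewrite estE.
Qed.

(** A failure means no acceptance at all, or a first acceptance in some episode k with a bad
    estimate; the latter has probability at most nu^k kappa, which sums to kappa / (1 - nu). *)
Lemma located_probability_ge :
  (P (located V Yobs delta w) >= (1 - kappa / (1 - nu))%:E)%E.
Proof.
have mgood k : measurable (event Yobs (fun y => hit k y && good k y)).
  apply: (measurable_event hrun (n := k.+1 * T)); exact: adapted_and.
have hbad k : adapted (k.+1 * T) (fun y => hit k y && ~~ good k y).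
  by apply: adapted_and => //; exact: adapted_not.
have mbad k : measurable (event Yobs (fun y => hit k y && ~~ good k y)).
  exact: (measurable_event hrun (hbad k)).
pose B := \bigcup_k event Yobs (fun y => hit k y && ~~ good k y).
pose U := \bigcap_k event Yobs (unaccepted k).
have mU : measurable U.
  by apply: bigcapT_measurable => k; exact: (measurable_event hrun (adapted_unaccepted k)).
have mB : measurable B by exact: bigcup_measurable.
have mL : measurable (located V Yobs delta w) by rewrite locatedE; exact: bigcup_measurable.
have [nu0 nu1] := andP nu01.
(* Never accepting has probability at most nu^k for every k. *)
have PU : P U = 0%E.
  apply/eqP; rewrite eq_le measure_ge0 andbT; apply/lee_addgt0Pr => e e0; rewrite add0e.
  have /cvgrPdist_lt/(_ e e0) [k _ /(_ k (leqnn k))] : nu ^+ k @[k --> \oo] --> 0.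
    by apply: cvg_expr; rewrite gtr0_norm.
  rewrite sub0r normrN gtr0_norm ?exprn_gt0// => h.
  apply: (@le_trans _ _ (Pe (unaccepted k))).
    apply: le_measure; rewrite ?inE//; first exact: (measurable_event hrun (adapted_unaccepted k)).
    by move=> om; apply.
  by apply: le_trans (unaccepted_probability k) _; rewrite lee_fin ltW.
have PB : (P B <= (kappa / (1 - nu))%:E)%E.
  apply: (@le_trans _ _ (\sum_(0 <= k <oo) P (event Yobs (fun y => hit k y && ~~ good k y)))%E).
    exact: le_mu_bigcup.
  apply: le_trans (geometric_nneseries_le kappa0 nu01).
  apply: lee_nneseries => k _; first by move=> _; exact: measure_ge0.
  apply: le_trans (wrong_le (adapted_unaccepted k)) _.
  by rewrite muleC EFinM lee_wpmul2l ?lee_fin// unaccepted_probability.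
have cover : [set: Om] `<=` located V Yobs delta w `|` (B `|` U).
  move=> om _; have [[k hk]|u] := first_accepted (Yseq Yobs om); last first.
    by right; right => k _; exact: u.
  have [gk|gk] := boolP (good k (Yseq Yobs om)).
    by left; rewrite locatedE; exists k => //; rewrite /event/= /hit hk gk.
  by right; left; exists k => //; rewrite /event/= /hit hk gk.
have mLBU : measurable (located V Yobs delta w `|` (B `|` U)).
  by apply: measurableU => //; exact: measurableU.
have P1 : (1 <= P (located V Yobs delta w `|` (B `|` U)))%E.
  rewrite -(@probability_setT _ _ _ P).
  by apply: (@le_measure _ _ _ P); rewrite ?inE.
have : (1 <= P (located V Yobs delta w) + (kappa / (1 - nu))%:E)%E.
  apply: le_trans P1 _.
  apply: le_trans (measureU2 _ mL (measurableU _ _ mB mU)) _.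
  apply: leeD => //; apply: le_trans (measureU2 _ mB mU) _.
  by rewrite [X in (_ + X)%E]PU adde0.
by rewrite EFinB leeBlDr.
Qed.

End renewal.

(** * The three-phase scheme as an instance of the renewal argument *)

Section performance.
Context d (Y : measurableType d) (R : realType).
Variables (mu : {sigma_finite_measure set Y -> \bar R}) (p : R -> bool -> Y -> R).
Hypothesis hp : query_channel mu p.
Variables (M1 M K n2 n3 : nat) (X1 : Y -> R) (X2 : bool -> Y -> R) (L1 L2 L3 : R).
Variable code : nat -> nat -> bool.
Hypotheses (mX1 : measurable_fun setT X1) (mX2 : forall x, measurable_fun setT (X2 x)).
Hypotheses (M1_gt1 : (1 < M1)%N) (M0 : (0 < M)%N).

Let s := three_phase_scheme K n2 n3 L1 L2 L3 code mX1 mX2 M1_gt1 M0.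

Context d' (Om : measurableType d') (P : probability Om R).
Variables (V : Om -> rnd s) (Yobs : nat -> Om -> Y) (w : R).
Hypothesis w01 : 0 <= w < 1.
Hypothesis hrun : search_run V Yobs mu p w P.

Variables (a0 s1 s2 rho1 e1 e2 e3 : R) (r : bool -> R) (t : bool -> bool -> R).
Hypotheses (a01 : 0 < a0 <= 1) (ha0 : M1%:R^-1 <= a0) (s10 : 0 < s1) (s20 : 0 < s2).
Hypothesis H1 : forall q, 0 <= q <= a0 ->
    (\int[mu]_y (p q false y * expR (X1 y))%:E <= 1)%E /\
    (\int[mu]_y (p q true y * expR (- s1 * X1 y))%:E <= rho1%:E)%E.
Hypothesis H2 : forall q, 0 <= q <= a0 -> forall x,
    (\int[mu]_y (p q x y * expR (- s2 * X2 x y))%:E <= (r x)%:E)%E /\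
    forall x', (\int[mu]_y (p q x y * expR (X2 x' y))%:E <= (t x x')%:E)%E.
Hypothesis h1 : expR (s1 * L1) * rho1 ^+ K + expR (- L1) * M1%:R <= e1.
Hypothesis h2 : forall i, (i < M)%N ->
    expR (s2 * L2) * \prod_(u < n2) r (code i u) +
    expR (- L2) * (\sum_(j < i) \prod_(u < n2) t (code i u) (code j u)) <= e2.
Hypotheses (e10 : 0 <= e1) (e20 : 0 <= e2) (e30 : 0 <= e3).
Hypothesis h3 : expR (s1 * L3) * rho1 ^+ n3.+1 <= e3.
Variable delta : R.
Hypotheses (hdelta : M%:R^-1 <= delta) (e01 : 0 < e1 + e2 + e3 < 1).

Let N := (M1 * M)%N.
Let N0 : (0 < N)%N. Proof. by rewrite muln_gt0 M0 (ltnW M1_gt1). Qed.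
Let T := episode_length M1 K n2 n3.
Let acc k := accepted M1 K n2 n3 X1 L3 (k * T).
Let est k (y : nat -> Y) : R := (candidate M1 M K n2 X1 X2 L1 L2 code (k * T) y)%:R / N%:R.

Let T0 : (0 < T)%N. Proof. by rewrite /T /episode_length addnS. Qed.

Let start_le k : (k * T + M1 * K + n2 <= k.+1 * T)%N.
Proof. by rewrite mulSn [leqRHS]addnC -addnA leq_add2l /T /episode_length leq_addr. Qed.

Let hacc k : adapted (k.+1 * T) (acc k).
Proof. by rewrite mulSn addnC; exact: adapted_accepted. Qed.

Let hest k : adapted (k.+1 * T) (est k).
Proof.
apply: (@adapted_nat _ Y _ _ _ R (fun c => c%:R / N%:R)).
apply: adapted_widen (adapted_candidate M1 M K n2 L1 L2 code mX1 mX2 (k * T)).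
exact: start_le.
Qed.

Let stopE n om : stop (history V Yobs n om) <->
  exists2 k, n = (k.+1 * T)%N & acc k (Yseq Yobs om).
Proof.
have ET k : (k.+1 * T - T = k * T)%N by rewrite mulSn addKn.
split.
  move=> /and3P[n0 /dvdnP[k nE] ha]; subst n; case: k n0 ha => [//|k] _.
  by rewrite -/T ET => ha; exists k => //; rewrite -(adapted_history V Yobs om (hacc k)).
move=> [k nE ak]; subst n; apply/and3P; split; [by rewrite muln_gt0|by rewrite dvdn_mull|].
by rewrite -/T ET; move: ak; rewrite -(adapted_history V Yobs om (hacc k)).
Qed.

Let estE k om : estimate (history V Yobs (k.+1 * T) om) = est k (Yseq Yobs om).
Proof.
have ET : (k.+1 * T - T = k * T)%N by rewrite mulSn addKn.
by rewrite -(adapted_history V Yobs om (hest k)) /= /three_phase_estimate /est -/N -/T ET.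
Qed.

(** The estimate is the left end of the candidate bin, of width 1/N <= 1/M <= delta, so a bad
    estimate implies a wrong candidate. *)
Let wrong_le k (a : (nat -> Y) -> bool) : adapted (k * T) a ->
  (P (event Yobs (fun y => a y && acc k y && ~~ (`|est k y - w| <= delta)%R)) <=
   P (event Yobs a) * (expR (- L3))%:E)%E.
Proof.
move=> ha; have := wrong_accept hp w01 hrun a01 ha0 H1 ha; apply: le_trans.
have haT : adapted (k.+1 * T) (fun y => a y && acc k y).
  by apply: adapted_and (hacc k); apply: adapted_widen ha; rewrite mulSn leq_addl.
apply: (le_event hrun (n := k.+1 * T) (m := k.+1 * T)).
- apply: adapted_and => //; apply: adapted_not.
  have [g1 g2] := hest k; split => [y y' h|m]; first by rewrite (g1 _ _ h).
  apply: measurable_fun_ler; last exact: measurable_cst.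
  apply: measurableT_comp; first exact: normr_measurable.
  by apply: measurable_funB; [exact: g2|exact: measurable_cst].
- apply: adapted_and => //.
  apply: (@adapted_nat _ Y _ _ _ bool (fun c => c != bin N w)).
  apply: adapted_widen (adapted_candidate M1 M K n2 L1 L2 code mX1 mX2 (k * T)).
  exact: start_le.
- move=> y /andP[/andP[-> ay] h]; apply/andP; split; [exact: ay|apply: contra h => /eqP E].
  have {}E : candidate M1 M K n2 X1 X2 L1 L2 code (k * T) y = bin N w := E.
  rewrite /est E; apply: le_trans (bin_dist N0 _) _; first by case/andP: w01.
  apply: le_trans hdelta; rewrite lef_pV2 ?posrE ?ltr0n// ler_nat leq_pmull//.
  exact: ltnW.
Qed.

Let reject_le k (a : (nat -> Y) -> bool) : adapted (k * T) a ->
  (P (event Yobs (fun y => a y && ~~ acc k y)) <= P (event Yobs a) * (e1 + e2 + e3)%:E)%E.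
Proof.
by move=> ha; exact: (reject_probability hp w01 hrun a01 ha0 s10 s20 H1 H2 h1 h2 e10 e20 e30 h3 ha).
Qed.

Lemma three_phase_performance :
  (P (located V Yobs delta w) >= (1 - expR (- L3) / (1 - (e1 + e2 + e3)))%:E)%E /\
  (\int[P]_om stopping_time V Yobs om <= (T%:R / (1 - (e1 + e2 + e3)))%:E)%E.
Proof.
split.
  exact: (located_probability_ge hrun hacc hest stopE estE e01 (expR_ge0 _) reject_le wrong_le).
exact: (expected_stopping_time_le hrun T0 hacc stopE e01 reject_le).
Qed.

End performance.

(** * The achieved cost *)

(** The condition on n is the inequality s L - n s c ln 2 <= ln v solved for n. Its main part, L /
    (c ln 2), is the threshold in bits divided by the rate. *)
Lemma chernoff_length (R : realType) (s c L v : R) (n : nat) : 0 < s -> 0 < c -> 0 < v ->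
  (L + ln v^-1 / s) / (c * ln 2) <= n%:R ->
  expR (s * L) * expR (- s * c * ln 2) ^+ n <= v.
Proof.
move=> s0 c0 v0; have ln20 : 0 < ln 2 :> R by rewrite ln_gt0// ltr1n.
rewrite ler_pdivrMr ?mulr_gt0// => h.
rewrite -expRM_natl -expRD -[leRHS](lnK v0) ler_expR.
have : s * (L + ln v^-1 / s) <= s * (n%:R * (c * ln 2)) by rewrite ler_pM2l.
rewrite mulrDr [s * (_ / _)]mulrC divfK ?gt_eqF// lnV//.
lra.
Qed.

Lemma truncn_succ_bounds (R : realType) (x : R) : 0 <= x ->
  x <= (Num.truncn x).+1%:R <= x + 1.
Proof.
move=> x0; rewrite ltW ?truncnS_gt//=.
by rewrite -natr1 lerD2r truncn_le.
Qed.

Definition achieves (R : realType) d (Y : measurableType d)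
    (mu : {sigma_finite_measure set Y -> \bar R}) (p : R -> bool -> Y -> R)
    (delta eps b : R) (s : scheme Y R) : Prop :=
  forall w, 0 <= w < 1 ->
  forall (d' : measure_display) (Om : measurableType d')
    (P : probability Om R) (V : Om -> rnd s) (Yobs : nat -> Om -> Y),
  search_run V Yobs mu p w P ->
  (P (located V Yobs delta w) >= (1 - eps)%:E)%E /\
  (\int[P]_om stopping_time V Yobs om <= b%:E)%E.

(** Only the number of fine bins, the code and the last two thresholds and lengths vary with [delta]
    and [eps]. The coarse phase and all error tolerances are fixed beforehand, so [Kc] is chosen
    before [delta] and [eps]. *)
Lemma scheme_exists (R : realType) d (Y : measurableType d)
    (mu : {sigma_finite_measure set Y -> \bar R}) (p : R -> bool -> Y -> R)
    (hp : query_channel mu p) (hstd : standing_assumptions mu p) (cC cD nu : R) :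
  0 < cC -> 0 < cD -> 0 < nu <= 1 / 2 ->
  (cC%:E < capacity mu p 0)%E -> (cD%:E < C1 mu p 0)%E ->
  exists2 Kc : R, 0 < Kc & forall delta eps, 0 < delta < 1 -> 0 < eps < 1 ->
    exists s : scheme Y R, achieves mu p delta eps
      ((Kc + log2 (1 / delta) / cC + log2 (1 / eps) / cD) / (1 - nu)) s.
Proof.
move=> cC0 cD0 /andP[nu0 nu1] hC hD.
have ln20 : 0 < ln 2 :> R by rewrite ln_gt0// ltr1n.
have [X1 [s1 [a1 [mX1 s10 a101 hX1]]]] := detection_statistic hp hstd hD.
have [Pr [X2 [s2 [a2 [r [t [Pr01 mX2 s20 a201 [r0 t0 hr ht hX2]]]]]]]] :=
  coding_statistic hp hstd hC cC0.
pose a0 := Num.min a1 a2.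
have [a1p a1l] := andP a101; have [a2p a2l] := andP a201.
have a0p : 0 < a0 by rewrite lt_min a1p.
have a01 : 0 < a0 <= 1 by rewrite a0p ge_min a1l.
(* At least 1 / a0 coarse bins, so that all queries fall in the range of the two statistics; the
   second successor ensures [1 < M1]. *)
pose M1 := (Num.truncn a0^-1).+2.
have hM1 : M1%:R^-1 <= a0.
  rewrite -[leRHS]invrK lef_pV2 ?posrE ?invr_gt0 ?ltr0n// ltW//.
  by apply: lt_trans (truncnS_gt _) _; rewrite ltr_nat.
(* The rejection probability is 5 v: two for each of the coarse and fine phases (a miss and false
   alarms), one for the check phase. *)
pose v := nu / 6.
have v0 : 0 < v by rewrite divr_gt0.
have v1 : v <= 1 by rewrite /v; move: nu1; clear; lra.
have lnv : 0 <= ln v^-1 by rewrite ln_ge0// invf_ge1.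
(* The threshold at which [M1] false alarms of probability exp(-L1) cost [v] in total. *)
pose L1 := ln (M1%:R / v).
have M10 : 0 < M1%:R :> R by rewrite ltr0n.
have L10 : 0 <= L1.
  by rewrite ln_ge0// ler_pdivlMr// mul1r (le_trans v1)// ler1n.
pose x1 := (L1 + ln v^-1 / s1) / (cD * ln 2).
have cC2 : 0 < cC * ln 2 by rewrite mulr_gt0.
have cD2 : 0 < cD * ln 2 by rewrite mulr_gt0.
have x10 : 0 <= x1.
  apply: divr_ge0; last exact: ltW.
  by apply: addr_ge0 => //; apply: divr_ge0 => //; exact: ltW.
pose K := (Num.truncn x1).+1.
have hK := chernoff_length s10 cD0 v0 (andP (truncn_succ_bounds x10)).1.
have hL1 (m : R) : 0 < m -> expR (- ln (m / v)) * m = v.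
  move=> m0; rewrite expRN lnK ?posrE ?divr_gt0// invfM invrK mulrAC mulVf ?mul1r//.
  by rewrite gt_eqF.
pose A := ln v^-1.
pose Kc : R := M1%:R * K%:R + (ln 2 + A + A / s2) / (cC * ln 2) + 1 +
  ((ln 2 + A / s1) / (cD * ln 2) + 1).
exists Kc.
  have A0 : 0 <= A by [].
  have q1 : 0 <= (ln 2 + A + A / s2) / (cC * ln 2).
    apply: divr_ge0; last exact: ltW.
    by apply: addr_ge0; [apply: addr_ge0 => //; exact: ltW|apply: divr_ge0 => //; exact: ltW].
  have q2 : 0 <= (ln 2 + A / s1) / (cD * ln 2).
    apply: divr_ge0; last exact: ltW.
    by apply: addr_ge0; [exact: ltW|apply: divr_ge0 => //; exact: ltW].
  have q3 : 0 <= M1%:R * K%:R :> R by rewrite mulr_ge0.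
  apply: addr_gt0; last exact: ltr_wpDl.
  by apply: ltr_wpDl => //; exact: addr_ge0.
move=> delta eps /andP[de0 de1] /andP[ep0 ep1].
have dV : 1 <= delta^-1 by rewrite invf_ge1// ltW.
have eV : 1 <= eps^-1 by rewrite invf_ge1// ltW.
(* 1/delta <= M <= 1/delta + 1 <= 2/delta, so ln M exceeds ln (1/delta) by at most ln 2, which goes
   into [Kc]. *)
pose M := (Num.truncn delta^-1).+1.
have /andP[hM hM'] := truncn_succ_bounds (le_trans ler01 dV).
rewrite -/M in hM hM'.
have M0 : 0 < M%:R :> R by rewrite ltr0n.
pose L2 := ln (M%:R / v).
have L2E : L2 = ln M%:R + A by rewrite /L2 lnM ?posrE ?invr_gt0.
have lnM0 : 0 <= ln M%:R :> R by rewrite ln_ge0// ler1n.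
have lnMle : ln M%:R <= ln 2 + ln delta^-1.
  rewrite -lnM ?posrE ?invr_gt0// ler_ln ?posrE ?mulr_gt0 ?invr_gt0//.
  by apply: le_trans hM' _; rewrite mulr_natl mulr2n lerD2l.
pose x2 := (L2 + ln v^-1 / s2) / (cC * ln 2).
have x20 : 0 <= x2.
  apply: divr_ge0; last exact: ltW.
  by apply: addr_ge0; [rewrite L2E; exact: addr_ge0|apply: divr_ge0 => //; exact: ltW].
pose n2 := (Num.truncn x2).+1.
have /andP[hx2 hx2'] := truncn_succ_bounds x20.
have hn2 := chernoff_length s20 cC0 v0 hx2.
(* A wrong acceptance has probability eps/2 per episode; the factor 2 pays for the division by 1 - 5
   v >= 1/2 over all episodes. *)
pose L3 := ln (2 / eps).
have L3E : L3 = ln 2 + ln eps^-1 by rewrite /L3 lnM ?posrE ?invr_gt0.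
have lneps : 0 <= ln eps^-1 by rewrite ln_ge0.
have lndelta : 0 <= ln delta^-1 by rewrite ln_ge0.
pose x3 := (L3 + ln v^-1 / s1) / (cD * ln 2).
have x30 : 0 <= x3.
  apply: divr_ge0; last exact: ltW.
  apply: addr_ge0; last by apply: divr_ge0 => //; exact: ltW.
  by rewrite L3E; apply: addr_ge0 => //; exact: ltW.
(* No successor here: the check phase already has [n3.+1] queries. *)
pose n3 := Num.truncn x3.
have /andP[hx3 hx3'] := truncn_succ_bounds x30.
have hn3 := chernoff_length s10 cD0 v0 hx3.
have Pr01' : 0 <= Pr <= 1 by case/andP: Pr01 => h h'; rewrite !ltW.
have hcode : expR (s2 * L2) * expR (- s2 * cC * ln 2) ^+ n2 + expR (- L2) * M%:R <= v + v.
  by apply: lerD => //; rewrite /L2 hL1.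
(* The two weights are the Chernoff factors exp(s2 L2) of a miss and exp(-L2) of a false alarm, so
   that the greedy bound on a codeword is its decoding error. *)
have [code hcode'] := feinstein_code Pr01' r0 t0 hr ht (expR_ge0 _) (expR_ge0 _) hcode.
exists (three_phase_scheme K n2 n3 L1 L2 L3 code mX1 mX2 (isT : (1 < M1)%N) (isT : (0 < M)%N)).
move=> w w01 d' Om P V Yobs hrun.
have hX1' q : 0 <= q <= a0 ->
    (\int[mu]_y (p q false y * expR (X1 y))%:E <= 1)%E /\
    (\int[mu]_y (p q true y * expR (- s1 * X1 y))%:E <= (expR (- s1 * cD * ln 2))%:E)%E.
  by move=> /andP[q0 qa]; apply: hX1; rewrite q0 (le_trans qa)// ge_min lexx.
have hX2' q : 0 <= q <= a0 -> forall x,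
    (\int[mu]_y (p q x y * expR (- s2 * X2 x y))%:E <= (r x)%:E)%E /\
    forall x', (\int[mu]_y (p q x y * expR (X2 x' y))%:E <= (t x x')%:E)%E.
  by move=> /andP[q0 qa]; apply: hX2; rewrite q0 (le_trans qa)// ge_min lexx orbT.
have h1 : expR (s1 * L1) * expR (- s1 * cD * ln 2) ^+ K + expR (- L1) * M1%:R <= v + v.
  by apply: lerD => //; rewrite /L1 hL1.
have vv0 : 0 <= v + v by rewrite addr_ge0// ltW.
have hdelta : M%:R^-1 <= delta.
  by rewrite -[leRHS]invrK lef_pV2 ?posrE ?invr_gt0.
have e01 : 0 < (v + v) + (v + v) + v < 1 by rewrite /v; move: nu0 nu1; clear; lra.
have [E1 E2] := three_phase_performance hp w01 hrun a01 hM1 s10 s20 hX1' hX2' h1 hcode'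
  vv0 vv0 (ltW v0) hn3 hdelta e01.
have enu : (v + v) + (v + v) + v <= nu by rewrite /v; move: nu0; clear; lra.
have nu1' : 0 < 1 - nu by move: nu1; clear; lra.
have e1' : 0 < 1 - ((v + v) + (v + v) + v) by rewrite subr_gt0; case/andP: e01.
split.
  apply: le_trans E1; rewrite lee_fin lerB// ler_pdivrMr//.
  rewrite /L3 expRN lnK ?posrE ?divr_gt0// invf_div.
  rewrite ler_pM2l//; move: enu nu1; move: (v + v + (v + v) + v) => x; clear; lra.
apply: le_trans E2 _; rewrite lee_fin.
apply: ler_pM; rewrite ?invr_ge0 ?(ltW e1')//; last first.
  by rewrite lef_pV2 ?posrE// lerB.
rewrite /episode_length !natrD natrM /log2 !div1r.
have b2 : n2%:R <= (ln 2 + A + A / s2) / (cC * ln 2) + 1 + ln delta^-1 / ln 2 / cC.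
  apply: le_trans hx2' _; rewrite /x2 -/A addrAC lerD2r -mulrA -invfM [ln 2 * cC]mulrC -mulrDl.
  by rewrite ler_pM2r ?invr_gt0 ?mulr_gt0// L2E; move: lnMle; move: (A / s2) => B; clear; lra.
have b3 : n3.+1%:R <= (ln 2 + A / s1) / (cD * ln 2) + 1 + ln eps^-1 / ln 2 / cD.
  apply: le_trans hx3' _; rewrite /x3 -/A addrAC lerD2r -mulrA -invfM [ln 2 * cD]mulrC -mulrDl.
  by rewrite ler_pM2r ?invr_gt0 ?mulr_gt0// L3E; move: (A / s1) => B; clear; lra.
move: b2 b3; rewrite /Kc.
move: (_ / (cC * ln 2)) (_ / (cD * ln 2)) => x y.
move: (ln delta^-1 / ln 2 / cC) (ln eps^-1 / ln 2 / cD) => z t'.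
clear; lra.
Qed.

(** The denominator may be 0, as [max_info] may a priori be: the quotient is then +oo for l > 0, and
    0 for l = 0. *)
Lemma div_le_divee (R : realType) (l c : R) (x : \bar R) : 0 <= l -> 0 < c ->
  (0 <= x)%E -> (x <= c%:E)%E -> ((l / c)%:E <= l%:E / x)%E.
Proof.
move=> l0 c0; case: x => [x| |]//; rewrite !lee_fin => x0 xc.
have := l0; rewrite le_eqVlt => /predU1P[<-|lp]; first by rewrite mul0r mul0e.
have := x0; rewrite le_eqVlt => /predU1P[<-|xp].
  by rewrite inve0 gt0_muley ?lte_fin// leey.
by rewrite inver gt_eqF// -EFinM lee_fin ler_wpM2l// lef_pV2 ?posrE.
Qed.

Lemma log2_ge0 (R : realType) (x : R) : 1 <= x -> 0 <= log2 x.
Proof. by move=> x1; rewrite /log2 divr_ge0 ?ln_ge0// ler1n. Qed.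

Lemma log2_gt0 (R : realType) (x : R) : 1 < x -> 0 < log2 x.
Proof. by move=> x1; rewrite /log2 divr_gt0 ?ln_gt0// ltr1n. Qed.

(** * The overhead factor and the choice of gamma *)

Section rate.
Variable R : realType.

(** The ratio of the cost (Kc + B / (1 - eta)) / (1 - eta) to the ideal cost B, with Kc / B enlarged
    to Kc / b. Here b is the share of log(1/delta) in B, so the factor does not depend on [eps]. *)
Definition overhead (Kc b eta : R) : R := (Kc / b + (1 - eta)^-1) / (1 - eta).

Lemma overhead_gt1 (Kc b eta : R) : 0 < Kc -> 0 < b -> 0 < eta <= 1 / 2 ->
  1 < overhead Kc b eta.
Proof.
move=> K0 b0 /andP[e0 e1]; have h : 0 < 1 - eta by lra.
have hV : 1 < (1 - eta)^-1 by rewrite invf_gt1//; lra.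
rewrite /overhead ltr_pdivlMr// mul1r.
have : 0 < Kc / b by rewrite divr_gt0.
lra.
Qed.

Lemma overhead_bound (Kc b B eta : R) : 0 < Kc -> 0 < b <= B -> 0 < eta <= 1 / 2 ->
  (Kc + B / (1 - eta)) / (1 - eta) <= B * overhead Kc b eta.
Proof.
move=> K0 /andP[b0 bB] /andP[e0 e1]; have h : 0 < 1 - eta by lra.
rewrite /overhead mulrA ler_pM2r ?invr_gt0// mulrDr lerD2r.
rewrite mulrCA ler_peMr ?(ltW K0)// ler_pdivlMr// mul1r//.
Qed.

(** As b grows the overhead tends to (1 - gam/4)^-2, which is strictly less than (1 - gam)^-1; the
    room [xi] then accommodates Kc / b. *)
Lemma overhead_small (Kc gam : R) : 0 < Kc -> 0 < gam < 1 ->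
  exists2 b1, 0 < b1 & forall b, b1 <= b ->
    overhead Kc b (gam / 4) <= (1 - gam)^-1.
Proof.
move=> K0 /andP[g0 g1]; have h : 0 < 1 - gam / 4 by lra.
have h1 : 0 < 1 - gam by lra.
pose xi := (1 - gam / 4) / (1 - gam) - (1 - gam / 4)^-1.
have xi0 : 0 < xi.
  rewrite subr_gt0 ltr_pdivlMr// mulrC ltr_pdivrMr//.
  nra.
exists (Kc / xi) => [|b hb]; first by rewrite divr_gt0.
have b0 : 0 < b by apply: lt_le_trans hb; rewrite divr_gt0.
rewrite /overhead ler_pdivrMr// mulrC.
have : Kc / b <= xi by rewrite ler_pdivrMr// mulrC -ler_pdivrMr.
rewrite /xi; lra.
Qed.

End rate.

Theorem theorem2 (R : realType) (d : measure_display) (Y : measurableType d)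
    (mu : {sigma_finite_measure set Y -> \bar R}) (p : R -> bool -> Y -> R)
    (hp : query_channel mu p) (hstd : standing_assumptions mu p)
    (qs : R) (hqs : 0 < qs < 1 / 2)
    (hqs_max : forall q, 0 < q < 1 / 2 ->
      (mutual_info mu p q q <= mutual_info mu p qs qs)%E)
    (hqs_pos : (0 < mutual_info mu p qs qs)%E) :
  exists gamma : R -> R -> R,
    [/\ forall alpha delta, 0 < alpha < 1 / 2 -> 0 < delta < 1 ->
          0 < gamma alpha delta < 1,
        gamma ad.1 ad.2 @[ad --> ((0 : R)^'+, (0 : R)^'+)] --> (0 : R) &
        forall alpha delta eps,
          0 < alpha < 1 / 2 -> 0 < delta < 1 -> 0 < eps < 1 ->
          exists s : scheme Y R,
            forall w, 0 <= w < 1 ->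
            forall (d' : measure_display) (Om : measurableType d')
              (P : probability Om R) (V : Om -> rnd s) (Yobs : nat -> Om -> Y),
            search_run V Yobs mu p w P ->
            (P (located V Yobs delta w) >= (1 - eps)%:E)%E /\
            (\int[P]_om stopping_time V Yobs om <=
              ((log2 (1 / alpha))%:E / mutual_info mu p qs qs
               + (log2 (1 / delta))%:E / max_info mu p alpha
               + (log2 (1 / eps))%:E / C1 mu p delta)
              / (1 - gamma alpha delta)%:E)%E].
Proof.
have zero01 : 0 <= (0 : R) <= 1 by rewrite lexx ler01.
have ln20 : 0 < ln 2 :> R by rewrite ln_gt0// ltr1n.
have [qs0 qs1] := andP hqs.
(* Mutual information at [qs] is at most C(qs), which monotonicity bounds by C(0). *)
have C0pos : (0 < capacity mu p 0)%E.
  apply: (lt_le_trans hqs_pos); apply: (@le_trans _ _ (capacity mu p qs)).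
    by apply: ereal_sup_ubound; exists qs => //=; rewrite in_itv/=; move: qs0 qs1; clear; lra.
  by apply: (capacity_noninc hstd) => //; move: qs1; clear; lra.
have D0pos := C1_gt0_of_capacity hp zero01 C0pos.
have C0fin : capacity mu p 0 \is a fin_num.
  by rewrite ge0_fin_numE ?(ltW C0pos)//; apply: le_lt_trans (capacity_le hp zero01) (ltry _).
have D0fin : C1 mu p 0 \is a fin_num.
  by rewrite ge0_fin_numE ?(ltW D0pos)//; exact: (C1_finite hstd).
pose C0 := fine (capacity mu p 0); pose D0 := fine (C1 mu p 0).
have C0E : capacity mu p 0 = C0%:E by rewrite fineK.
have D0E : C1 mu p 0 = D0%:E by rewrite fineK.
have C00 : 0 < C0 by rewrite -lte_fin -C0E.
have D00 : 0 < D0 by rewrite -lte_fin -D0E.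
pose cost delta eps := log2 (1 / delta) / C0 + log2 (1 / eps) / D0.
(* The values of gamma that work at [delta] for all [eps] at once, against the ideal cost, which
   does not involve [alpha]. *)
pose good delta gam := 0 < gam < 1 /\ forall eps, 0 < eps < 1 ->
  exists s : scheme Y R, achieves mu p delta eps (cost delta eps / (1 - gam)) s.
have logV (x : R) : 0 < x < 1 -> 1 < 1 / x.
  by move=> /andP[x0 x1]; rewrite div1r invf_gt1.
(* A single [eta] sets both the fraction of C(0) and C_1(0) given up and the rejection probability
   of an episode. *)
have achieve eta : 0 < eta <= 1 / 2 -> exists2 Kc : R, 0 < Kc &
    forall delta gam, 0 < delta < 1 -> 0 < gam < 1 ->
      overhead Kc (log2 (1 / delta) / C0) eta <= (1 - gam)^-1 -> good delta gam.
  move=> he; have [e0 e1] := andP he.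
  have h : 0 < 1 - eta by move: e1; clear; lra.
  have lt1 : 1 - eta < 1 by rewrite ltrBlDr ltrDl.
  have [||||Kc K0 H] := @scheme_exists R d Y mu p hp hstd
    ((1 - eta) * C0) ((1 - eta) * D0) eta _ _ he.
  - exact: mulr_gt0.
  - exact: mulr_gt0.
  - by rewrite C0E lte_fin gtr_pMl.
  - by rewrite D0E lte_fin gtr_pMl.
  exists Kc => // delta gam hd hg hov; split => // eps hep.
  have [s hs] := H _ _ hd hep; exists s => w w01 d' Om P V Yobs hrun.
  have [h1 h2] := hs w w01 d' Om P V Yobs hrun; split => //.
  apply: (le_trans h2); rewrite lee_fin.
  have b0 : 0 < log2 (1 / delta) / C0 by rewrite divr_gt0// log2_gt0// logV.
  have c0 : 0 <= log2 (1 / eps) / D0 by rewrite divr_ge0 ?(ltW D00)// log2_ge0// ltW// logV.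
  have bB : 0 < log2 (1 / delta) / C0 <= cost delta eps by rewrite b0/= lerDl.
  have B0 : 0 <= cost delta eps by case/andP: bB => /ltW x /(le_trans x).
  apply: (@le_trans _ _ (cost delta eps * overhead Kc (log2 (1 / delta) / C0) eta)).
    apply: le_trans (overhead_bound K0 bB he).
    rewrite le_eqVlt; apply/orP; left; apply/eqP; congr (_ / _).
    by rewrite -addrA /cost; congr (_ + _); field; rewrite !gt_eqF.
  by rewrite ler_wpM2l.
have exgood delta : 0 < delta < 1 -> exists gam, good delta gam.
  move=> hd; have half : 0 < (1 / 2 : R) <= 1 / 2 by rewrite lexx divr_gt0.
  have [Kc K0 H] := achieve _ half.
  have b0 : 0 < log2 (1 / delta) / C0 by rewrite divr_gt0// log2_gt0// logV.
  have F1 := overhead_gt1 K0 b0 half.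
  set F := overhead _ _ _ in F1.
  have F0 : 0 < F by exact: lt_trans F1.
  (* The value with 1 / (1 - gam) = F; it lies in (0, 1) because the overhead exceeds 1. *)
  exists (1 - F^-1); apply: H => //.
    by rewrite subr_gt0 invf_lt1// F1 ltrBlDr ltrDl invr_gt0.
  by rewrite opprB addrCA subrr addr0 invrK.
have smallgood gam : 0 < gam < 1 -> exists2 d0 : R, 0 < d0 & forall delta, 0 < delta < 1 ->
    delta < d0 -> good delta gam.
  move=> hg; have [g0 g1] := andP hg.
  have he : 0 < gam / 4 <= 1 / 2 by move: g0 g1; clear; lra.
  have [Kc K0 H] := achieve _ he.
  have [b1 b10 hb1] := overhead_small K0 hg.
  (* Below this threshold log(1/delta) / C(0) is at least [b1]. *)
  exists (expR (- (b1 * C0 * ln 2))) => [|delta hd dd]; first exact: expR_gt0.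
  apply: H => //; apply: hb1.
  have [dl0 dl1] := andP hd.
  rewrite ler_pdivlMr// /log2 ler_pdivlMr// div1r lnV ?posrE//.
  by rewrite lerNr -ler_expR lnK ?posrE// ltW.
(* The infimum of the good values may fail to be attained or to be positive; a good value within
   [delta] of it has the same limit as [delta] tends to 0. *)
have near_inf delta : exists x, 0 < delta < 1 ->
    good delta x /\ forall gam, good delta gam -> x < gam + delta.
  have [hd|hd] := boolP (0 < delta < 1); last by exists 0 => h; case/negP: hd.
  have [d0 _] := andP hd.
  have hs : has_inf [set gam | good delta gam].
    split; first exact: exgood.
    by exists 0 => gam [/andP[/ltW]].
  have [x hx xi] := inf_adherent d0 hs.
  exists x => _; split => // gam hgam; apply: (lt_le_trans xi); rewrite lerD2r.
  by apply: ge_inf => //; case: hs.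
have [g hg] := choice near_inf.
exists (fun _ delta => g delta); split.
- by move=> alpha delta _ /hg[[]].
- have cv : g delta @[delta --> (0 : R)^'+] --> (0 : R).
    apply/cvgrPdist_lt => e e0.
    (* Below e/2, with the other half of e left for the distance [delta] to the infimum; the cap 1/2
       keeps [g0] below 1. *)
    pose g0 := Num.min (e / 2) (1 / 2).
    have hg0 : 0 < g0 < 1 by rewrite lt_min gt_min; move: e0; clear; lra.
    have [d0 d00 H] := smallgood _ hg0.
    near=> delta.
    have hd : 0 < delta < 1.
      by apply/andP; split; near: delta; [exact: nbhs_right_gt|exact: nbhs_right_lt].
    have [[/andP[gd0 _] _] hinf] := hg _ hd.
    have dd0 : delta < d0 by near: delta; exact: nbhs_right_lt.
    have de : delta < e / 2 by near: delta; apply: nbhs_right_lt; rewrite divr_gt0.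
    rewrite sub0r normrN gtr0_norm//; apply: (lt_trans (hinf _ (H _ hd dd0))).
    rewrite [ltRHS](splitr e); apply: ler_ltD => //.
    by rewrite ge_min lexx.
  have F : Filter (0 : R)^'+ by exact: _.
  by apply: (@cvg_comp _ _ _ snd g _ _ _ _ cv); apply: cvg_snd; exact: F.
- move=> alpha delta eps hal hd hep; have [[/andP[gd0 gd1] H] _] := hg _ hd.
  have [s hs] := H _ hep; exists s => w w01 d' Om P V Yobs hrun.
  have [h1 h2] := hs w w01 d' Om P V Yobs hrun; split => //.
  apply: (le_trans h2).
  have g1 : 0 < 1 - g delta by rewrite subr_gt0.
  rewrite EFinM inver gt_eqF// lee_wpmul2r ?lee_fin ?invr_ge0 ?(ltW g1)//.
  have [al0 al1] := andP hal; have [dl0 dl1] := andP hd.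
  have al1' : alpha < 1 by move: al1; clear; lra.
  (* This summand is nonnegative, and the other two dominate those of [cost] since their
     denominators are at most C(0) and C_1(0). *)
  have t1 : (0 <= (log2 (1 / alpha))%:E / mutual_info mu p qs qs)%E.
    rewrite mule_ge0 ?inve_ge0 ?(ltW hqs_pos)// lee_fin log2_ge0// ltW// logV//.
    by rewrite al0.
  have t2 : ((log2 (1 / delta) / C0)%:E <= (log2 (1 / delta))%:E / max_info mu p alpha)%E.
    apply: div_le_divee C00 (max_info_ge0 hp _) _.
      by rewrite log2_ge0// ltW// logV.
    by rewrite -C0E; apply: (max_info_le_capacity0 hstd); rewrite al0.
  have t3 : ((log2 (1 / eps) / D0)%:E <= (log2 (1 / eps))%:E / C1 mu p delta)%E.
    apply: div_le_divee D00 (C1_ge0 hp _) _.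
    + by rewrite log2_ge0// ltW// logV.
    + by rewrite !ltW.
    + by rewrite -D0E; apply: (C1_noninc hstd) => //; exact: ltW.
  rewrite -addeA /cost EFinD -[leLHS]add0e.
  exact: (leeD t1 (leeD t2 t3)).
Unshelve. all: by end_near. Qed.
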